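(* Let $d\ge1$, $\mathcal D=\{1,\dots,d\}$, and suppose that for every $j=1,\dots,d$ the pair $(\rho_j,\psi_j)$ satisfies $$\int_{-\infty}^{c}\frac{(\Phi_j(t))^2}{\psi_j(t)}\,dt<\infty\quad\text{and}\quad\int_c^\infty\frac{(1-\Phi_j(t))^2}{\psi_j(t)}\,dt<\infty\quad\text{for all finite }c .$$ Then the space $\mathcal W_d$ with inner product $$\langle f,\tilde f\rangle_{\mathcal W_d}=\sum_{\mathfrak u\subseteq\mathcal D}\frac1{\gamma_{\mathfrak u}}\int_{\mathbb R^{|\mathfrak u|}}\bigg(\int_{\mathbb R^{d-|\mathfrak u|}}\partial^{\mathfrak u}f(\boldsymbol x)\,\boldsymbol\rho_{\mathcal D\setminus\mathfrak u}(\boldsymbol x_{\mathcal D\setminus\mathfrak u})\,d\boldsymbol x_{\mathcal D\setminus\mathfrak u}\bigg)\bigg(\int_{\mathbb R^{d-|\mathfrak u|}}\partial^{\mathfrak u}\tilde f(\boldsymbol x)\,\boldsymbol\rho_{\mathcal D\setminus\mathfrak u}(\boldsymbol x_{\mathcal D\setminus\mathfrak u})\,d\boldsymbol x_{\mathcal D\setminus\mathfrak u}\bigg)\boldsymbol\psi_{\mathfrak u}(\boldsymbol x_{\mathfrak u})\,d\boldsymbol x_{\mathfrak u}$$ is a reproducing kernel Hilbert space with kernel $$K_d(\boldsymbol x,\boldsymbol y)=\sum_{\mathfrak u\subseteq\mathcal D}\gamma_{\mathfrak u}\prod_{j\in\mathfrak u}\eta_j(x_j,y_j),$$ where $$\eta_j(x,y)=\int_{-\infty}^{\min(x,y)}\frac{(\Phi_j(t))^2}{\psi_j(t)}\,dt+\int_{\max(x,y)}^\infty\frac{(1-\Phi_j(t))^2}{\psi_j(t)}\,dt-\int_{\min(x,y)}^{\max(x,y)}\frac{\Phi_j(t)(1-\Phi_j(t))}{\psi_j(t)}\,dt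 .$$
   Context: Let $\mathcal D=\{1,\dots,d\}$. For each $j\in\mathcal D$, $\rho_j:\mathbb R\to(0,\infty)$ is a strictly positive probability density function with distribution function $\Phi_j(x)=\int_{-\infty}^x\rho_j(t)\,dt$, and $\psi_j:\mathbb R\to(0,\infty)$ is a strictly positive locally integrable function such that $1/\psi_j$ is also locally integrable. For each $\mathfrak u\subseteq\mathcal D$ there is a weight parameter $\gamma_{\mathfrak u}>0$. Write $\boldsymbol x_{\mathfrak u}=(x_j)_{j\in\mathfrak u}$, $\boldsymbol\psi_{\mathfrak u}(\boldsymbol x_{\mathfrak u})=\prod_{j\in\mathfrak u}\psi_j(x_j)$, $\boldsymbol\rho_{\mathcal D\setminus\mathfrak u}(\boldsymbol x_{\mathcal D\setminus\mathfrak u})=\prod_{j\in\mathcal D\setminus\mathfrak u}\rho_j(x_j)$. Empty products equal $1$. $\partial^{\mathfrak u}f=\prod_{j\in\mathfrak u}\frac{\partial}{\partial x_j}f$ denotes the first-order mixed weak derivative: the locally integrable function with $\int_{\mathbb R^d}\partial^{\mathfrak u}f\,v\,d\boldsymbol x=(-1)^{|\mathfrak u|}\int_{\mathbb R^d}f\,\partial^{\mathfrak u}v\,d\boldsymbol x$ for all $v\in C_0^\infty(\mathbb R^d)$. $\mathcal W_d$ consists of the locally integrable functions $f$ on $\mathbb R^d$ (identified when equal almost everywhere) for which the norm $\|f\|_{\mathcal W_d}=\langle f,f\rangle_{\mathcal W_d}^{1/2}$ is finite, i.e. $$\|f\|_{\mathcal W_d}^2=\sum_{\mathfrak u\subseteq\mathcal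 D}\frac1{\gamma_{\mathfrak u}}\int_{\mathbb R^{|\mathfrak u|}}\bigg|\int_{\mathbb R^{d-|\mathfrak u|}}\partial^{\mathfrak u}f(\boldsymbol x)\,\boldsymbol\rho_{\mathcal D\setminus\mathfrak u}(\boldsymbol x_{\mathcal D\setminus\mathfrak u})\,d\boldsymbol x_{\mathcal D\setminus\mathfrak u}\bigg|^2\boldsymbol\psi_{\mathfrak u}(\boldsymbol x_{\mathfrak u})\,d\boldsymbol x_{\mathfrak u}<\infty .$$ Finiteness is understood to require that the weak derivatives $\partial^{\mathfrak u}f$, $\mathfrak u\subseteq\mathcal D$, exist and that the inner integrals are well defined as (absolutely convergent) Lebesgue integrals for almost all $\boldsymbol x_{\mathfrak u}$. Since elements of $\mathcal W_d$ are almost-everywhere equivalence classes, the reproducing property $f(\boldsymbol y)=\langle f,K_d(\cdot,\boldsymbol y)\rangle_{\mathcal W_d}$ is to be understood for the appropriate representative (equivalently, it holds for almost all $\boldsymbol y\in\mathbb R^d$), and $K_d(\cdot,\boldsymbol y)\in\mathcal W_d$ for all $\boldsymbol y\in\mathbb R^d$. *)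

(* Defs.v *)
From HB Require Import structures.
From mathcomp Require Import all_boot all_order all_algebra.
From mathcomp Require Import all_classical all_reals all_analysis.

Set Implicit Arguments.
Unset Strict Implicit.
Unset Printing Implicit Defensive.
Import Order.TTheory GRing.Theory Num.Theory.
Import numFieldNormedType.Exports.

Local Open Scope classical_set_scope.
Local Open Scope ring_scope.

Definition measure_matrix_display : measure_display -> measure_display.
Proof. exact. Qed.

(* Product sigma-algebra on matrices, generated by the coordinate projections.
   On 'rV[R]_n it is the Borel sigma-algebra. *)
Section measurable_matrix.
Context {d} {T : measurableType d} (m n : nat).

Definition matrix_cylinders : set (set 'M[T]_(m, n)) :=
  [set C | exists i j (A : set T),
    measurable A /\ C = [set M : 'M[T]_(m, n) | A (M i j)]].

Let mx_set0 : <<s matrix_cylinders >> set0.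
Proof. exact: sigma_algebra0. Qed.

Let mx_setC A : <<s matrix_cylinders >> A -> <<s matrix_cylinders >> (~` A).
Proof. exact: sigma_algebraC. Qed.

Let mx_bigcup (F : (set 'M[T]_(m, n))^nat) :
  (forall i, <<s matrix_cylinders >> (F i)) ->
  <<s matrix_cylinders >> (\bigcup_i F i).
Proof. exact: sigma_algebra_bigcup. Qed.

HB.instance Definition _ := @isMeasurable.Build (measure_matrix_display d)
  'M[T]_(m, n) <<s matrix_cylinders >> mx_set0 mx_setC mx_bigcup.

End measurable_matrix.

Section measurable_matrix_fun.
Context {d d'} {T : measurableType d} {U : measurableType d'} (m n : nat).

Lemma measurable_mx_coord i j :
  measurable_fun [set: 'M[T]_(m, n)] (fun M => M i j).
Proof.
move=> _ A mA; rewrite setTI; apply: sub_sigma_algebra.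
by exists i, j, A.
Qed.

Lemma measurable_fun_mxP (f : U -> 'M[T]_(m, n)) :
  (forall i j, measurable_fun setT (fun x => f x i j)) -> measurable_fun setT f.
Proof.
move=> mf; apply: (@measurability _ _ _ _ _ _ (@matrix_cylinders _ T m n)) => //.
move=> _ [_ [i [j [A [mA ->]]]] <-].
exact: mf.
Qed.

End measurable_matrix_fun.

Section lebesgue_measure_rV.
Context {R : realType}.
Local Open Scope ereal_scope.

Definition cons_rV n (p : R * 'rV[R]_n) : 'rV[R]_n.+1 :=
  \row_i (if unlift ord0 i is Some j then p.2 ord0 j else p.1).

Definition uncons_rV n (x : 'rV[R]_n.+1) : R * 'rV[R]_n :=
  (x ord0 ord0, \row_j x ord0 (lift ord0 j)).

Lemma cons_rVK n : cancel (@cons_rV n) (@uncons_rV n).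
Proof.
move=> [x v]; rewrite /uncons_rV /cons_rV; congr pair.
  by rewrite mxE unlift_none.
by apply/rowP => j; rewrite !mxE liftK.
Qed.

Lemma measurable_cons_rV n : measurable_fun setT (@cons_rV n).
Proof.
apply: measurable_fun_mxP => i j; case: (unliftP ord0 j) => [k|] ->.
  apply: (eq_measurable_fun ((fun M : 'rV[R]_n => M ord0 k) \o snd)).
    by move=> x _; rewrite /= mxE liftK.
  apply: measurableT_comp => //; exact: measurable_mx_coord.
apply: (eq_measurable_fun fst) => // x _.
by rewrite /= mxE unlift_none.
Qed.

Lemma measurable_uncons_rV n : measurable_fun setT (@uncons_rV n).
Proof.
apply: measurable_fun_pair; first exact: measurable_mx_coord.
apply: measurable_fun_mxP => i j.
apply: (eq_measurable_fun (fun M : 'rV[R]_n.+1 => M ord0 (lift ord0 j))).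
  by move=> x _; rewrite mxE.
exact: measurable_mx_coord.
Qed.

Section lebesgue_cons.
Variables (n : nat) (mu : {sigma_finite_measure set 'rV[R]_n -> \bar R}).

Definition lebesgue_cons := pushforward (lebesgue_measure \x mu) (@cons_rV n).

Let mcons : measurable_fun [set: measurableTypeR R * 'rV[R]_n] (@cons_rV n).
Proof. exact: measurable_cons_rV. Qed.

Let lebesgue_cons0 : lebesgue_cons set0 = 0.
Proof. by rewrite /lebesgue_cons /pushforward preimage_set0 measure0. Qed.

Let lebesgue_cons_ge0 A : 0 <= lebesgue_cons A.
Proof. exact: measure_ge0. Qed.

Let lebesgue_cons_sigma_additive : semi_sigma_additive lebesgue_cons.
Proof.
by have /= := @measure_semi_sigma_additive _ _ _
  (measure_function_pushforward__canonical__measure_function_Measure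
    (lebesgue_measure \x mu) mcons).
Qed.

HB.instance Definition _ := isMeasure.Build _ _ _ lebesgue_cons
  lebesgue_cons0 lebesgue_cons_ge0 lebesgue_cons_sigma_additive.

Let lebesgue_cons_sigma_finite : sigma_finite setT lebesgue_cons.
Proof.
have /sigma_finiteP[F [TF ndF Foo]] := sigma_finiteT (@lebesgue_measure R).
have /sigma_finiteP[G [TG ndG Goo]] := sigma_finiteT mu.
exists (fun k => @uncons_rV n @^-1` (F k `*` G k)).
  rewrite -preimage_bigcup (_ : \bigcup_k _ = setT) ?preimage_setT//.
  apply/seteqP; split => // -[x v] _.
  have [i _ Fx] : (\bigcup_k F k) x by rewrite -TF.
  have [j _ Gv] : (\bigcup_k G k) v by rewrite -TG.
  exists (maxn i j) => //; split => /=.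
    by move: x Fx; exact/subsetPset/ndF/leq_maxl.
  by move: v Gv; exact/subsetPset/ndG/leq_maxr.
move=> k; have [mF Fk] := Foo k; have [mG Gk] := Goo k; split.
  rewrite -[X in measurable X]setTI; apply: measurable_uncons_rV => //.
  exact: measurableX.
rewrite /lebesgue_cons /pushforward (_ : _ @^-1` _ = F k `*` G k); last first.
  by apply/seteqP; split => p; rewrite /preimage /mkset cons_rVK.
by rewrite product_measure1E// lte_mul_pinfty// ge0_fin_numE.
Qed.

HB.instance Definition _ := Measure_isSigmaFinite.Build _ _ _ lebesgue_cons
  lebesgue_cons_sigma_finite.

End lebesgue_cons.

Fixpoint lebesgue_rV n : {sigma_finite_measure set 'rV[R]_n -> \bar R} :=
  if n is m.+1 then lebesgue_cons (lebesgue_rV m) else \d_(0 : 'rV[R]_0)%R.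

Lemma lebesgue_rV_box n (A : 'I_n -> set R) : (forall i, measurable (A i)) ->
  lebesgue_rV n [set x | forall i, A i (x ord0 i)] =
  \prod_(i < n) lebesgue_measure (A i).
Proof.
elim: n A => [|n IH] A mA; first by rewrite big_ord0 /= diracE mem_set// => -[].
rewrite big_ord_recl -IH//= /lebesgue_cons /pushforward.
have mB : measurable [set x : 'rV[R]_n | forall i, A (lift ord0 i) (x ord0 i)].
  rewrite [X in measurable X](_ : _ = \bigcap_(i in [set: 'I_n])
      ((fun x : 'rV[R]_n => x ord0 i) @^-1` A (lift ord0 i))); last first.
    by apply/seteqP; split => x /= xA i; [move=> _|]; exact: xA.
  apply: fin_bigcap_measurable => // i _.
  by rewrite -[X in measurable X]setTI; exact: measurable_mx_coord.
rewrite -product_measure1E//; last exact: mA.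
congr product_measure1; apply/seteqP; split => -[x v] /=.
  by move=> xA; split=> [|i]; [move: (xA ord0)|move: (xA (lift ord0 i))];
    rewrite mxE ?unlift_none ?liftK.
by move=> [xA vA] i; rewrite mxE; case: unliftP => [j|] ->.
Qed.

End lebesgue_measure_rV.

Section ae_hilbert.
Context {d} {T : measurableType d} {R : realType}.
Variable mu : {measure set T -> \bar R}.

Definition ip_norm (ip : (T -> R) -> (T -> R) -> R) (f : T -> R) : R :=
  Num.sqrt (ip f f).

(* A Hilbert space of mu-a.e. classes of measurable functions is given by the
   set [H] of all representatives of its elements and by a form [ip] on
   representatives that is compatible with a.e. equality. *)
Record ae_hilbert (H : set (T -> R)) (ip : (T -> R) -> (T -> R) -> R) : Prop := {
  hilbert_measurable : forall f, H f -> measurable_fun setT f;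
  hilbert_ae : forall f g, H f -> measurable_fun setT g -> f = g %[ae mu] -> H g;
  hilbert_zero : H (cst 0);
  hilbert_lin : forall (a : R) f g, H f -> H g -> H (fun x => a * f x + g x);
  ip_ae : forall f f' g, H f -> H f' -> H g -> f = f' %[ae mu] ->
    ip f g = ip f' g;
  ip_sym : forall f g, H f -> H g -> ip f g = ip g f;
  ip_lin : forall (a : R) f g h, H f -> H g -> H h ->
    ip (fun x => a * f x + g x) h = a * ip f h + ip g h;
  ip_ge0 : forall f, H f -> 0 <= ip f f;
  ip_definite : forall f, H f -> ip f f = 0 -> f = cst 0 %[ae mu];
  hilbert_complete : forall F : nat -> T -> R, (forall n, H (F n)) ->
    (forall e : R, 0 < e ->
      \forall m & n \near \oo, ip_norm ip (fun x => F m x - F n x) < e) ->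
    exists2 f, H f & ip_norm ip (fun x => F n x - f x) @[n --> \oo] --> (0 : R)
}.

(* [repr_eval] says that f has a representative, itself in [H], for which the
   reproducing property holds at every point; the a.e. equality with f is also
   the a.e. form of the reproducing property. *)
Record ae_rkhs (H : set (T -> R)) (ip : (T -> R) -> (T -> R) -> R)
    (K : T -> T -> R) : Prop := {
  rkhs_hilbert : ae_hilbert H ip;
  rkhs_kernel : forall y, H (fun x => K x y);
  repr_eval : forall f, H f ->
    H (fun y => ip f (fun x => K x y)) /\
    f = (fun y => ip f (fun x => K x y)) %[ae mu]
}.

End ae_hilbert.

Section weak_derivative.
Context {R : realType} {d : nat}.
Implicit Types (f g v : 'rV[R]_d -> R) (u : {set 'I_d}) (s : seq 'I_d).

Definition partial (i : 'I_d) f : 'rV[R]_d -> R :=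
  fun x => 'D_(delta_mx ord0 i) f x.

Definition iter_partial s f : 'rV[R]_d -> R := foldr partial f s.

Definition mixed_partial u f : 'rV[R]_d -> R := iter_partial (enum u) f.

Definition smooth f := forall s,
  continuous (iter_partial s f) /\
  forall i x, derivable (iter_partial s f) x (delta_mx ord0 i).

Definition test_function v := smooth v /\ compact (closure [set x | v x != 0]).

Definition locally_integrable_rV f := measurable_fun setT f /\
  forall K : set 'rV[R]_d, compact K ->
    (\int[lebesgue_rV d]_(x in K) `|f x|%:E < +oo)%E.

Definition is_weak_derivative u f g := locally_integrable_rV g /\
  forall v, test_function v ->
    \int[lebesgue_rV d]_x (g x * v x) =
    (-1) ^+ #|u| * \int[lebesgue_rV d]_x (f x * mixed_partial u v x).

(* Weak derivatives are unique up to a.e. equality; this picks one of them, or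
   the zero function if there is none. *)
Definition weak_derivative u f : 'rV[R]_d -> R :=
  xget (cst 0) [set g | is_weak_derivative u f g].

End weak_derivative.

Section weighted_space.
Context {R : realType} {d : nat}.
Variables (rho psi : 'I_d -> R -> R) (gamma : {set 'I_d} -> R).
Implicit Types (f g : 'rV[R]_d -> R) (u : {set 'I_d}).

(* The point of R^d with u-coordinates a and (D \ u)-coordinates b, where the
   coordinates of a and b are listed in increasing order of the indices. *)
Definition glue u (a : 'rV[R]_#|u|) (b : 'rV[R]_#|~: u|) : 'rV[R]_d :=
  \sum_(k < #|u|) a ord0 k *: delta_mx ord0 (enum_val k) +
  \sum_(k < #|~: u|) b ord0 k *: delta_mx ord0 (enum_val k).

(* prod_{j in u} w_j(x_j), for a point x of R^u *)
Definition prod_weight (w : 'I_d -> R -> R) u (x : 'rV[R]_#|u|) : R :=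
  \prod_(k < #|u|) w (enum_val k) (x ord0 k).

Definition inner_integrand u f (a : 'rV[R]_#|u|) (b : 'rV[R]_#|~: u|) : R :=
  weak_derivative u f (glue a b) * prod_weight rho b.

Definition inner_integral u f (a : 'rV[R]_#|u|) : R :=
  \int[lebesgue_rV #|~: u|]_b inner_integrand f a b.

Definition W_sqnorm f : \bar R := (\sum_(u : {set 'I_d}) ((gamma u)^-1)%:E *
  \int[lebesgue_rV #|u|]_a
    (`|inner_integral f a| ^+ 2 * prod_weight psi a)%:E)%E.

Definition W_space : set ('rV[R]_d -> R) := [set f |
  [/\ locally_integrable_rV f,
      forall u, exists g, is_weak_derivative u f g,
      forall u, \forall a \ae lebesgue_rV #|u|,
        (lebesgue_rV #|~: u|).-integrable setT
          (fun b => (inner_integrand f a b)%:E) &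
      (W_sqnorm f < +oo)%E]].

Definition W_inner f g : R := \sum_(u : {set 'I_d}) (gamma u)^-1 *
  \int[lebesgue_rV #|u|]_a
    (inner_integral f a * inner_integral g a * prod_weight psi a).

Definition distr_fun (p : R -> R) (x : R) : R :=
  \int[lebesgue_measure]_(t in `]-oo, x]) p t.

Definition eta_kernel (p q : R -> R) (x y : R) : R :=
  let Phi := distr_fun p in
  \int[lebesgue_measure]_(t in `]-oo, Num.min x y]) (Phi t ^+ 2 / q t) +
  \int[lebesgue_measure]_(t in `[Num.max x y, +oo[) ((1 - Phi t) ^+ 2 / q t) -
  \int[lebesgue_measure]_(t in `[Num.min x y, Num.max x y])
    (Phi t * (1 - Phi t) / q t).

Definition W_kernel (x y : 'rV[R]_d) : R := \sum_(u : {set 'I_d})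
  gamma u * \prod_(j in u) eta_kernel (rho j) (psi j) (x ord0 j) (y ord0 j).

End weighted_space.

(* Main.v *)
Require Import Defs.
From HB Require Import structures.
From mathcomp Require Import all_boot all_order all_algebra.
From mathcomp Require Import all_classical all_reals all_analysis measurable_realfun.
From mathcomp Require Import ring lra.
Import Order.TTheory GRing.Theory Num.Theory.
Import numFieldNormedType.Exports.
Local Open Scope classical_set_scope.
Local Open Scope ring_scope.

(* Put kappa_j(t, y) = Phi_j(t) - 1[y <= t]. As a function of y it has mean zero
   against rho_j and its distributional derivative is the unit mass at t, and
   eta_j(x, y) = int kappa_j(t, x) kappa_j(t, y) / psi_j(t) dt. Hence, for any
   square-integrable family h = (h_u), the function
     G h (y) = sum_u int h_u(t) prod_{j in u} kappa_j(t_j, y_j) dt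
   has the inner integrals h_u. Conversely, a function in W_d whose inner
   integrals all vanish is zero: by decreasing induction on u, its weak derivative
   in the directions u does not depend on the coordinates outside u, so it equals
   its average against rho, which is the vanishing inner integral. So f = G (h(f)),
   W_d is isometric to a sum of weighted L^2 spaces, hence complete, and since
   K_d(., y) = G h with h_u(t) = gamma_u prod_{j in u} kappa_j(t_j, y_j) / psi_j(t_j),
   the inner product of f with K_d(., y) is G (h(f)) (y). *)

Set Implicit Arguments.
Unset Strict Implicit.
Unset Printing Implicit Defensive.

(** * Lebesgue measure on row vectors *)

(** Two obstacles shape the proof. Inner integrals live on spaces of varying dimension; to stay on
    one space, a function of the coordinates in u is kept as a function on R^d whose other
    coordinates are dummies integrated against probability densities. Exchanging the u-coordinates
    of two points of R^d is then the change of variables that separates the double integrals, and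
    such rearrangements are checked on boxes only. The second obstacle is absolute convergence. The
    tail conditions put kappa_j(., y) in L^2(dt / psi_j), uniformly for y in a bounded interval,
    which makes G h locally integrable. In an inner integral y runs over the whole line, and the
    relevant quantity is int |kappa_j(t, y)| rho_j(y) dy = 2 Phi_j(t) (1 - Phi_j(t)), which is in
    L^2(dt / psi_j) by the same conditions. Integrating against a strictly positive weight gives
    convergence for almost every frozen point. Weak derivatives of G h are verified against
    arbitrary test functions, one coordinate at a time; uniqueness uses only products of
    one-dimensional bumps. *)

Section measure_preserving.
Context d d' (X : measurableType d) (Y : measurableType d') (R : realType).
Variables (mu : {measure set X -> \bar R}) (nu : {measure set Y -> \bar R}).
Variable phi : X -> Y.

Definition measure_preserving := measurable_fun setT phi /\
  forall B, measurable B -> mu (phi @^-1` B) = nu B.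

Hypothesis mp : measure_preserving.
Local Open Scope ereal_scope.

Lemma ge0_integral_mpres (f : Y -> \bar R) : measurable_fun setT f ->
  (forall y, 0 <= f y) -> \int[mu]_x f (phi x) = \int[nu]_y f y.
Proof.
case: mp => mphi E mf f0.
have := @ge0_integral_pushforward _ _ _ _ _ _ mphi mu setT f measurableT mf (fun y _ => f0 y).
rewrite preimage_setT => <-.
pose m := measure_function_pushforward__canonical__measure_function_Measure mu mphi.
by rewrite (@eq_measure_integral _ _ _ setT nu m)// => A mA _; rewrite -E.
Qed.

Lemma integrable_mpres (f : Y -> \bar R) : measurable_fun setT f ->
  mu.-integrable setT (fun x => f (phi x)) <-> nu.-integrable setT f.
Proof.
move=> mf; split=> /integrableP[_ h]; apply/integrableP; split => //.
- have mf' : measurable_fun setT (abse \o f) by exact: measurableT_comp.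
  by rewrite -(ge0_integral_mpres mf') => [|?]; rewrite ?abse_ge0.
- by apply: measurableT_comp => //; case: mp.
- have mf' : measurable_fun setT (abse \o f) by exact: measurableT_comp.
  by rewrite (ge0_integral_mpres mf') => [//|?]; rewrite /= abse_ge0.
Qed.

Lemma integral_mpres (f : Y -> \bar R) : measurable_fun setT f ->
  \int[mu]_x f (phi x) = \int[nu]_y f y.
Proof.
move=> mf; rewrite [LHS]integralE [RHS]integralE.
have -> : (fun x => f (phi x))^\+ = (fun x => f^\+ (phi x)).
  by apply/funext => x; rewrite !funeposE.
have -> : (fun x => f (phi x))^\- = (fun x => f^\- (phi x)).
  by apply/funext => x; rewrite !funenegE.
rewrite (ge0_integral_mpres (measurable_funepos mf))//.
by rewrite (ge0_integral_mpres (measurable_funeneg mf)).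
Qed.

Lemma ae_mpres (P : Y -> Prop) : {ae nu, forall y, P y} ->
  {ae mu, forall x, P (phi x)}.
Proof.
case: mp => mphi E [N [mN N0 PN]]; exists (phi @^-1` N); split.
- by rewrite -[X in measurable X]setTI; exact: mphi.
- by rewrite E.
- by move=> x /= Px; apply: PN.
Qed.

End measure_preserving.

Section boxes.
Context {R : realType}.
Local Open Scope ereal_scope.

Definition box n (A : 'I_n -> set R) : set 'rV[R]_n :=
  [set x | forall i, A i (x ord0 i)].

Lemma measurable_box n (A : 'I_n -> set R) : (forall i, measurable (A i)) ->
  measurable (box A).
Proof.
move=> mA; rewrite [X in measurable X](_ : _ = \bigcap_(i in [set: 'I_n])
    ((fun x : 'rV[R]_n => x ord0 i) @^-1` A i)); last first.
  by apply/seteqP; split => x /= xA i; [move=> _|]; exact: xA.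
apply: fin_bigcap_measurable => // i _.
by rewrite -[X in measurable X]setTI; exact: measurable_mx_coord.
Qed.

Definition mbox n : set (set 'rV[R]_n) :=
  [set B | exists2 A : 'I_n -> set R, (forall i, measurable (A i)) & B = box A].

Lemma lebesgue_box n (A : 'I_n -> set R) : (forall i, measurable (A i)) ->
  lebesgue_rV n (box A) = \prod_(i < n) lebesgue_measure (A i).
Proof. exact: lebesgue_rV_box. Qed.

Lemma measurable_rVE n : @measurable _ 'rV[R]_n = <<s @mbox n >>.
Proof.
apply/seteqP; split.
  apply: smallest_sub; first exact: smallest_sigma_algebra.
  move=> C [i [j [A [mA ->]]]]; apply: sub_sigma_algebra.
  exists (fun k => if k == j then A else setT); first by move=> k; case: ifP.
  rewrite (ord1 i); apply/seteqP; split => [x Ax k /=|x /(_ j)]; last by rewrite eqxx.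
  by case: ifPn => // /eqP ->.
apply: smallest_sub; first exact: sigma_algebra_measurable.
by move=> _ [A mA ->]; exact: measurable_box.
Qed.

(** Boxes are stable under intersection and generate the sigma-algebra, and the cubes [g k] exhaust
    the space with finite measure, so the values on boxes determine the measure. *)
Lemma lebesgue_rV_unique n (m : {measure set 'rV[R]_n -> \bar R}) :
  (forall A : 'I_n -> set R, (forall i, measurable (A i)) ->
    m (box A) = \prod_(i < n) lebesgue_measure (A i)) ->
  forall B, measurable B -> m B = lebesgue_rV n B.
Proof.
move=> mE; pose g k : set 'rV[R]_n := box (fun=> `[(- k%:R)%R : R, k%:R]%classic).
apply: (@measure_unique _ _ _ (@mbox n) g _ _ _ _ m (lebesgue_rV n)).
- exact: measurable_rVE.
- move=> _ _ [A mA ->] [B mB ->]; exists (fun i => A i `&` B i).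
    by move=> i; exact: measurableI.
  by apply/seteqP; split => [x [Ax Bx] i|x ABx]; [|split => i; have [] := ABx i].
- by move=> k; exists (fun=> `[(- k%:R)%R : R, k%:R]%classic).
- apply/seteqP; split => // x _.
  exists (\max_(i < n) `|Num.ceil `|x ord0 i| |%N) => // i /=.
  rewrite in_itv/= -ler_norml (le_trans (Num.Theory.ceil_ge _))//.
  rewrite (le_trans (ler_norm _))// -intr_norm -abszE ler_nat.
  exact: (leq_bigmax i).
- by move=> _ [A mA ->]; rewrite mE// [RHS]lebesgue_rV_box.
- move=> k; rewrite mE// big_const_ord; elim: n {m mE g} => [|n IH]; first exact: ltry.
  by rewrite iterS lte_mul_pinfty// lebesgue_measure_itv/=; case: ifP.
Qed.

(** Reduces a rearrangement of coordinates to comparing two products of one-dimensional measures. *)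
Lemma measure_preserving_box d (X : measurableType d) n
    (mu : {measure set X -> \bar R}) (phi : X -> 'rV[R]_n) :
  measurable_fun setT phi ->
  (forall A : 'I_n -> set R, (forall i, measurable (A i)) ->
    mu (phi @^-1` box A) = \prod_(i < n) lebesgue_measure (A i)) ->
  measure_preserving mu (lebesgue_rV n) phi.
Proof.
move=> mphi E; split=> // B mB.
pose m := measure_function_pushforward__canonical__measure_function_Measure mu mphi.
exact: (@lebesgue_rV_unique n m).
Qed.

End boxes.

Section coordinates.
Context {R : realType}.

(** Freezing the coordinates in [u] without leaving R^d keeps the type of points independent of
    [u]. *)
Definition mix d (u : {set 'I_d}) (x t : 'rV[R]_d) : 'rV[R]_d :=
  \row_i if i \in u then x ord0 i else t ord0 i.

Definition swap d (u : {set 'I_d}) (p : 'rV[R]_d * 'rV[R]_d) :=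
  (mix u p.2 p.1, mix u p.1 p.2).

Definition proj d (u : {set 'I_d}) (x : 'rV[R]_d) : 'rV[R]_#|u| :=
  \row_k x ord0 (enum_val k).

Lemma measurable_fun_coord d (X : measurableType d) m n
    (g : X -> 'M[R]_(m, n)) i j : measurable_fun setT g ->
  measurable_fun setT (fun x => g x i j).
Proof.
move=> mg; apply: (measurableT_comp (measurable_mx_coord i j)); exact: mg.
Qed.

Lemma measurable_mix d (u : {set 'I_d}) : measurable_fun setT
  (fun p : 'rV[R]_d * 'rV[R]_d => mix u p.1 p.2).
Proof.
apply: measurable_fun_mxP => i j; rewrite (ord1 i).
under eq_fun do rewrite mxE.
by case: (j \in u); exact: measurable_fun_coord.
Qed.

Lemma measurable_swap d (u : {set 'I_d}) : measurable_fun setT (@swap d u).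
Proof.
apply: measurable_fun_pair; last exact: measurable_mix.
have -> : (fun p => mix u p.2 p.1) = (fun p : 'rV[R]_d * 'rV[R]_d => mix (~: u) p.1 p.2).
  by apply/funext => p; apply/rowP => i; rewrite !mxE inE; case: (i \in u).
exact: measurable_mix.
Qed.

Lemma measurable_proj d (u : {set 'I_d}) : measurable_fun setT (@proj d u).
Proof.
apply: measurable_fun_mxP => i j.
under eq_fun do rewrite mxE.
exact: measurable_mx_coord.
Qed.

Lemma row_mx_mpres m n : measure_preserving
  (lebesgue_rV m \x lebesgue_rV n)%E (@lebesgue_rV R (m + n))
  (fun p => row_mx p.1 p.2).
Proof.
apply: measure_preserving_box.
  apply: measurable_fun_mxP => i j; under eq_fun do rewrite mxE.
  by case: (fintype.split j) => k; exact: measurable_fun_coord.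
move=> A mA; rewrite big_split_ord/= -!lebesgue_box//.
rewrite -product_measure1E; [|exact: measurable_box..].
congr (product_measure1 _ _ _); apply/seteqP; split => -[x y] /=.
  by move=> xyA; split=> i; [move: (xyA (lshift n i))|move: (xyA (rshift m i))];
    rewrite ?row_mxEl ?row_mxEr.
by move=> [xA yA] i; rewrite mxE; case: splitP => j ji;
  [rewrite (_ : i = lshift n j)|rewrite (_ : i = rshift m j)] => //; exact: val_inj.
Qed.

(** On R^(2d) the exchange merely permutes the 2d factors of a box between its two blocks; [B] and
    [C] are the blocks after the exchange. *)
Lemma swap_row_mx_mpres d (u : {set 'I_d}) : measure_preserving
  (lebesgue_rV d \x lebesgue_rV d)%E (@lebesgue_rV R (d + d))
  (fun p => row_mx (swap u p).1 (swap u p).2).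
Proof.
apply: measure_preserving_box.
  apply: (measurableT_comp (proj1 (row_mx_mpres d d))); exact: measurable_swap.
move=> A mA; rewrite big_split_ord/=.
pose B i := if i \in u then A (rshift d i) else A (lshift d i).
pose C i := if i \in u then A (lshift d i) else A (rshift d i).
have mB i : measurable (B i) by rewrite /B; case: ifP.
have mC i : measurable (C i) by rewrite /C; case: ifP.
transitivity ((\prod_(i < d) lebesgue_measure (B i)) *
  (\prod_(i < d) lebesgue_measure (C i)))%E; last first.
  rewrite -!big_split/=; apply: eq_bigr => i _; rewrite /B /C.
  by case: ifP => _ //; rewrite muleC.
rewrite -!lebesgue_box// -product_measure1E; [|exact: measurable_box..].
congr (product_measure1 _ _ _); apply/seteqP; split => -[x y] /=.
  move=> xyA; split=> i; move: (xyA (lshift d i)) (xyA (rshift d i));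
    by rewrite row_mxEl row_mxEr !mxE /B /C; case: ifP.
move=> [xA yA] i; rewrite mxE; case: splitP => j ji;
  [rewrite (_ : i = lshift d j)|rewrite (_ : i = rshift d j)]; try exact: val_inj;
  by move: (xA j) (yA j); rewrite !mxE /B /C; case: ifP.
Qed.

(** A measurable set of pairs is the preimage under [row_mx] of a measurable set of R^(2d).
    Concatenation preserves the measure both with and without the exchange, hence so does the
    exchange. *)
Lemma swap_mpres d (u : {set 'I_d}) : measure_preserving
  (lebesgue_rV d \x lebesgue_rV d)%E (@lebesgue_rV R d \x lebesgue_rV d)%E (swap u).
Proof.
split; first exact: measurable_swap.
move=> B mB.
pose B' : set 'rV[R]_(d + d) := (fun z => (lsubmx z, rsubmx z)) @^-1` B.
have mB' : measurable B'.
  rewrite -[X in measurable X]setTI; apply: (_ : measurable_fun setT _) => //.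
  apply: measurable_fun_pair; apply: measurable_fun_mxP => i j;
    under eq_fun do rewrite mxE; exact: measurable_mx_coord.
have -> : B = (fun p => row_mx p.1 p.2) @^-1` B'.
  by apply/seteqP; split => -[x y]; rewrite /B' /= row_mxKl row_mxKr.
rewrite (proj2 (row_mx_mpres d d))// -(proj2 (swap_row_mx_mpres u))//.
Qed.

Lemma glue_in d (u : {set 'I_d}) (a : 'rV[R]_#|u|) (b : 'rV[R]_#|~: u|) k :
  Defs.glue a b ord0 (enum_val k) = a ord0 k.
Proof.
rewrite /Defs.glue mxE !summxE (bigD1 k)//= [X in _ + X]big1 ?addr0; last first.
  move=> l _; rewrite !mxE eqxx/=; case: eqP => [kl|_]; last by rewrite mulr0.
  by have := enum_valP l; rewrite -kl inE (enum_valP k).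
rewrite !mxE !eqxx mulr1 big1 ?addr0// => l lk.
by rewrite !mxE eqxx/= (inj_eq enum_val_inj) eq_sym (negbTE lk) mulr0.
Qed.

Lemma glue_out d (u : {set 'I_d}) (a : 'rV[R]_#|u|) (b : 'rV[R]_#|~: u|) k :
  Defs.glue a b ord0 (enum_val k) = b ord0 k.
Proof.
rewrite /Defs.glue mxE !summxE [X in _ + X](bigD1 k)//= big1 ?add0r; last first.
  move=> l _; rewrite !mxE eqxx/=; case: eqP => [kl|_]; last by rewrite mulr0.
  by have := enum_valP k; rewrite inE kl (enum_valP l).
rewrite !mxE !eqxx mulr1 big1 ?addr0// => l lk.
by rewrite !mxE eqxx/= (inj_eq enum_val_inj) eq_sym (negbTE lk) mulr0.
Qed.

Lemma prod_setC (K : comPzSemiRingType) d (u : {set 'I_d}) (F : 'I_d -> K) :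
  \prod_i F i = (\prod_(k < #|u|) F (enum_val k)) *
               (\prod_(k < #|~: u|) F (enum_val k)).
Proof.
rewrite (bigID (mem u))/=; congr (_ * _); first by rewrite big_enum_val.
transitivity (\prod_(i in ~: u) F i); last exact: big_enum_val.
by apply: eq_bigl => i; rewrite inE.
Qed.

Lemma eprod_setC d (u : {set 'I_d}) (F : 'I_d -> \bar R) :
  (\prod_i F i = (\prod_(k < #|u|) F (enum_val k)) *
               (\prod_(k < #|~: u|) F (enum_val k)))%E.
Proof.
rewrite (bigID (mem u))/=; congr (_ * _)%E; first by rewrite big_enum_val.
transitivity (\prod_(i in ~: u) F i)%E; last exact: big_enum_val.
by apply: eq_bigl => i; rewrite inE.
Qed.

Lemma measurable_glue d (u : {set 'I_d}) : measurable_fun setT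
  (fun p : 'rV[R]_#|u| * 'rV[R]_#|~: u| => Defs.glue p.1 p.2).
Proof.
apply: measurable_fun_mxP => i j; rewrite (ord1 i).
have [ju|ju] := boolP (j \in u).
  have -> : j = enum_val (enum_rank_in ju j) by rewrite enum_rankK_in.
  under eq_fun do rewrite glue_in.
  exact: measurable_fun_coord.
have ju' : j \in ~: u by rewrite inE.
have -> : j = enum_val (enum_rank_in ju' j) by rewrite enum_rankK_in.
under eq_fun do rewrite glue_out.
exact: measurable_fun_coord.
Qed.

Lemma glue_mpres d (u : {set 'I_d}) : measure_preserving
  (lebesgue_rV #|u| \x lebesgue_rV #|~: u|)%E (@lebesgue_rV R d)
  (fun p => Defs.glue p.1 p.2).
Proof.
apply: measure_preserving_box; first exact: measurable_glue.
move=> A mA; rewrite (eprod_setC u) -!lebesgue_box//.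
rewrite -product_measure1E; [|by apply: measurable_box => i; exact: mA..].
congr (product_measure1 _ _ _); apply/seteqP; split => -[x y] /=.
  by move=> xyA; split=> i; move: (xyA (enum_val i)); rewrite ?glue_in ?glue_out.
move=> [xA yA] i; have [iu|iu] := boolP (i \in u).
  by rewrite -(enum_rankK_in iu iu) glue_in; exact: xA.
have iu' : i \in ~: u by rewrite inE.
by rewrite -(enum_rankK_in iu' iu') glue_out; exact: yA.
Qed.

Lemma cons_rV_mpres n : measure_preserving
  (@lebesgue_measure R \x lebesgue_rV n)%E (@lebesgue_rV R n.+1) (@cons_rV R n).
Proof. by split => //; exact: measurable_cons_rV. Qed.

Lemma cons_rV0 n p : @cons_rV R n p ord0 ord0 = p.1.
Proof. by rewrite mxE unlift_none. Qed.

Lemma cons_rVS n p i : @cons_rV R n p ord0 (lift ord0 i) = p.2 ord0 i.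
Proof. by rewrite mxE liftK. Qed.

End coordinates.

(** * Real-valued integrals, Fubini and product integrands *)

Section Rintegral_extra.
Context d d' (X : measurableType d) (Y : measurableType d') (R : realType).

Lemma Rintegral_mpres (mu : {measure set X -> \bar R})
    (nu : {measure set Y -> \bar R}) (phi : X -> Y) (f : Y -> R) :
  measure_preserving mu nu phi -> measurable_fun setT f ->
  \int[mu]_x f (phi x) = \int[nu]_y f y.
Proof.
move=> mp mf; rewrite /Rintegral; congr fine.
by apply: (integral_mpres mp (f := EFin \o f)); exact/measurable_EFinP.
Qed.

Lemma EFin_Rintegral (mu : {measure set X -> \bar R}) (f : X -> R) :
  mu.-integrable setT (EFin \o f) ->
  (\int[mu]_x f x)%:E = (\int[mu]_x (f x)%:E)%E.
Proof. by move=> fi; rewrite /Rintegral fineK//; exact: integrable_fin_num. Qed.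

Lemma integrable_EFinP (mu : {measure set X -> \bar R}) (f : X -> R) :
  mu.-integrable setT (EFin \o f) <->
  measurable_fun setT f /\ (\int[mu]_x `|f x|%:E < +oo)%E.
Proof.
split=> [/integrableP[/measurable_EFinP]|[mf foo]] //.
by apply/integrableP; split => //; exact/measurable_EFinP.
Qed.

End Rintegral_extra.

Section RFubini.
Context d d' (X : measurableType d) (Y : measurableType d') (R : realType).
Variables (m1 : {sigma_finite_measure set X -> \bar R})
  (m2 : {sigma_finite_measure set Y -> \bar R}).

(** The inner integral is the difference of the Tonelli integrals of the positive and negative
    parts, both measurable in x; [fine] sends infinite values to 0. *)
Lemma measurable_Rintegral1 (F : X * Y -> R) : measurable_fun setT F ->
  measurable_fun setT (fun x => \int[m2]_y F (x, y)).
Proof.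
move=> /measurable_EFinP mF; apply: measurableT_comp => //.
rewrite (_ : (fun x => _) = (fun x => fubini_F m2 (EFin \o F)^\+%E x -
    fubini_F m2 (EFin \o F)^\-%E x)%E); last first.
  apply/funext => x; rewrite /fubini_F [LHS]integralE; congr (_ - _)%E;
  by apply: eq_integral => y _; rewrite ?funeposE ?funenegE.
apply: emeasurable_funB; apply: measurable_fun_fubini_tonelli_F => //.
- exact: measurable_funepos.
- exact: measurable_funeneg.
Qed.

Lemma measurable_Rintegral2 (F : X * Y -> R) : measurable_fun setT F ->
  measurable_fun setT (fun y => \int[m1]_x F (x, y)).
Proof.
move=> /measurable_EFinP mF; apply: measurableT_comp => //.
rewrite (_ : (fun x => _) = (fun x => fubini_G m1 (EFin \o F)^\+%E x -
    fubini_G m1 (EFin \o F)^\-%E x)%E); last first.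
  apply/funext => x; rewrite /fubini_G [LHS]integralE; congr (_ - _)%E;
  by apply: eq_integral => y _; rewrite ?funeposE ?funenegE.
apply: emeasurable_funB; apply: measurable_fun_fubini_tonelli_G => //.
- exact: measurable_funepos.
- exact: measurable_funeneg.
Qed.

Section integrable.
Variable F : X * Y -> R.
Hypothesis iF : (m1 \x m2)%E.-integrable setT (EFin \o F).

(** On the almost all sections that are integrable, [fine] loses nothing, so the real-valued and the
    extended inner integrals agree. *)
Let ae12 : {ae m1, forall x, (\int[m2]_y F (x, y))%:E = (\int[m2]_y (F (x, y))%:E)%E}.
Proof.
have := ae_integrable1 iF; apply: filterS => x /= ix.
by rewrite EFin_Rintegral.
Qed.

Let ae21 : {ae m2, forall y, (\int[m1]_x F (x, y))%:E = (\int[m1]_x (F (x, y))%:E)%E}.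
Proof.
have := ae_integrable2 iF; apply: filterS => x /= ix.
by rewrite EFin_Rintegral.
Qed.

Let mF : measurable_fun setT F.
Proof. by have /integrableP[/measurable_EFinP] := iF. Qed.

Lemma integrable_Rintegral1 :
  m1.-integrable setT (fun x => (\int[m2]_y F (x, y))%:E).
Proof.
have iF1 := integrable_fubini_F iF.
apply/integrable_EFinP; split; first exact: measurable_Rintegral1.
have /integrableP[mF1] := iF1; congr (_ < _)%E; apply: ae_eq_integral => //.
- exact: measurableT_comp.
- by apply/measurable_EFinP/measurableT_comp => //; exact: measurable_Rintegral1.
- by have := ae12; apply: filterS => x /= xE _; rewrite /fubini_F/= -xE.
Qed.

Lemma Rintegral12 : \int[m1]_x \int[m2]_y F (x, y) = \int[(m1 \x m2)%E]_z F z.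
Proof.
rewrite /Rintegral -(integral12_prod_meas1 iF); congr fine.
apply: ae_eq_integral => //.
- by apply/measurable_EFinP; exact: measurable_Rintegral1.
- exact: (measurable_fubini_F iF).
- by have := ae12; apply: filterS => x /= xE _; rewrite ?/fubini_F ?/fubini_G/= -?xE//.
Qed.

Lemma RFubini : \int[m1]_x \int[m2]_y F (x, y) = \int[m2]_y \int[m1]_x F (x, y).
Proof.
rewrite Rintegral12 /Rintegral -(integral21_prod_meas1 iF); congr fine.
apply: ae_eq_integral => //.
- exact: (measurable_fubini_G iF).
- by apply/measurable_EFinP; exact: measurable_Rintegral2.
- by have := ae21; apply: filterS => x /= xE _; rewrite ?/fubini_F ?/fubini_G/= -?xE//.
Qed.

End integrable.
End RFubini.

Section ae_product.
Context d d' (X : measurableType d) (Y : measurableType d') (R : realType).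
Variables (m1 : {sigma_finite_measure set X -> \bar R})
  (m2 : {sigma_finite_measure set Y -> \bar R}).
Local Open Scope ereal_scope.

(** The measure of the null set is the integral of the measures of its sections, so almost every
    section is null. *)
Lemma ae_product_section (P : X * Y -> Prop) :
  {ae (m1 \x m2), forall z, P z} ->
  {ae m1, forall x, {ae m2, forall y, P (x, y)}}.
Proof.
move=> [N [mN N0 PN]].
have mx := measurable_fun_xsection m2 mN.
have : \int[m1]_x `|(m2 \o xsection N) x| = 0.
  by rewrite -[RHS]N0; apply: eq_integral => x _ /=; rewrite gee0_abs.
move/(ae_eq_integral_abs m1 measurableT mx).
apply: filterS => x /= /(_ I) Nx; exists (xsection N x); split => //.
  exact: measurable_xsection.
by move=> y /= Py; rewrite /xsection/= inE; exact: PN.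
Qed.

(** Measurability of [A] makes the measure of its complement the integral of the measures of the
    sections, which vanish almost everywhere. *)
Lemma ae_product_measurable (A : set (X * Y)) : measurable A ->
  {ae m1, forall x, {ae m2, forall y, A (x, y)}} ->
  {ae (m1 \x m2), forall z, A z}.
Proof.
move=> mA h; exists (~` A); split => //; first exact: measurableC.
rewrite /product_measure1/=.
transitivity (\int[m1]_x cst 0 x); last by rewrite integral_cst// mul0e.
apply: ge0_ae_eq_integral => //.
- by apply: measurable_fun_xsection; exact: measurableC.
- apply: filterS h => x /= [N [mN N0 AN]] _.
  apply: (subset_measure0 _ mN _ N0).
    by apply: measurable_xsection; exact: measurableC.
  by move=> y; rewrite /xsection/= inE; exact: AN.
Qed.

End ae_product.

Section product_integrals.
Context {R : realType}.

Lemma measurable_prod_coord n (g : 'I_n -> R -> R) :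
  (forall i, measurable_fun setT (g i)) ->
  measurable_fun setT (fun x : 'rV[R]_n => \prod_i g i (x ord0 i)).
Proof.
move=> mg; apply: measurable_prod => i _.
apply: (measurableT_comp (mg i)); exact: measurable_mx_coord.
Qed.

(** Induction on the dimension, the first coordinate being split off by [cons_rV]; in dimension 0
    the measure is a Dirac mass and both sides are 1. *)
Lemma ge0_integral_prod n (g : 'I_n -> R -> R) :
  (forall i, measurable_fun setT (g i)) -> (forall i x, 0 <= g i x) ->
  (\int[lebesgue_rV n]_x (\prod_i g i (x ord0 i))%:E =
  \prod_i \int[lebesgue_measure]_x (g i x)%:E)%E.
Proof.
elim: n g => [|n IH] g mg g0.
  rewrite big_ord0 integral_dirac// ?diracE ?in_setT ?mul1e ?big_ord0//.
  apply/measurable_EFinP.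
  by under eq_fun do rewrite big_ord0; exact: measurable_cst.
rewrite big_ord_recl.
rewrite -(ge0_integral_mpres (cons_rV_mpres n) (f := fun x => (\prod_i g i (x ord0 i))%:E))//=.
- rewrite fubini_tonelli1//=.
  + rewrite /fubini_F.
    transitivity (\int[lebesgue_measure]_x ((g ord0 x)%:E *
      \prod_(i < n) \int[lebesgue_measure]_x (g (lift ord0 i) x)%:E))%E.
      apply: eq_integral => x _; rewrite -IH//.
      rewrite -ge0_integralZl//=; last 3 first.
      * by apply/measurable_EFinP; exact: (@measurable_prod_coord n (fun i => g (lift ord0 i))).
      * by move=> y _; rewrite lee_fin prodr_ge0.
      * by rewrite lee_fin.
      apply: eq_integral => y _; rewrite big_ord_recl cons_rV0 EFinM.
      by congr (_ * _%:E)%E; apply: eq_bigr => i _; rewrite cons_rVS.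
    rewrite ge0_integralZr//.
    * by apply/measurable_EFinP; exact: mg.
    * by move=> x _; rewrite lee_fin.
    * by apply: prode_ge0 => i _; apply: integral_ge0 => x _; rewrite lee_fin.
  + apply/measurable_EFinP; apply: (measurableT_comp (measurable_prod_coord mg)).
    exact: measurable_cons_rV.
  + by move=> x; rewrite lee_fin prodr_ge0.
- by apply/measurable_EFinP; exact: measurable_prod_coord.
- by move=> x; rewrite lee_fin prodr_ge0.
Qed.

Lemma eprod_lty (I : finType) (P : pred I) (F : I -> \bar R) :
  (forall i, P i -> 0 <= F i)%E ->
  (forall i, P i -> F i < +oo)%E -> (\prod_(i | P i) F i < +oo)%E.
Proof.
move=> F0 Foo; suff : (\prod_(i | P i) F i \is a fin_num)%E.
  by move=> /fin_numPlt /andP[].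
elim/big_ind : _ => //; first exact: fin_numM.
by move=> i Pi; rewrite ge0_fin_numE ?F0 ?Foo.
Qed.

Lemma integrable_prod n (g : 'I_n -> R -> R) :
  (forall i, (@lebesgue_measure R).-integrable setT (EFin \o g i)) ->
  (lebesgue_rV n).-integrable setT (fun x => (\prod_i g i (x ord0 i))%:E).
Proof.
move=> ig; have mg i : measurable_fun setT (g i).
  by have /integrable_EFinP[] := ig i.
apply/integrable_EFinP; split; first exact: measurable_prod_coord.
under eq_integral do rewrite normr_prod.
rewrite (@ge0_integral_prod n (fun i x => `|g i x|))//; last first.
  by move=> i; apply: measurableT_comp.
apply: eprod_lty => i _; first by apply: integral_ge0 => x _; rewrite lee_fin.
by have /integrable_EFinP[] := ig i.
Qed.

Lemma Rintegral_prod n (g : 'I_n -> R -> R) :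
  (forall i, (@lebesgue_measure R).-integrable setT (EFin \o g i)) ->
  \int[lebesgue_rV n]_x (\prod_i g i (x ord0 i)) =
  \prod_i \int[lebesgue_measure]_x (g i x).
Proof.
elim: n g => [|n IH] g ig.
  rewrite big_ord0 /Rintegral integral_dirac// ?diracE ?in_setT ?mul1e ?big_ord0//.
  apply/measurable_EFinP.
  by under eq_fun do rewrite big_ord0; exact: measurable_cst.
have mg i : measurable_fun setT (g i).
  by have /integrable_EFinP[] := ig i.
rewrite big_ord_recl -(Rintegral_mpres (cons_rV_mpres n)); last first.
  exact: measurable_prod_coord.
have E := @Rintegral12 _ _ _ _ _ (@lebesgue_measure R) (lebesgue_rV n)
  (fun z => \prod_i g i (cons_rV z ord0 i)).
rewrite -[LHS]E; last first.
  apply/(integrable_mpres (cons_rV_mpres n) (f := fun x => (\prod_i g i (x ord0 i))%:E)).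
    by apply/measurable_EFinP; exact: measurable_prod_coord.
  exact: integrable_prod.
rewrite -IH//.
transitivity (\int[lebesgue_measure]_x (g ord0 x *
  \int[lebesgue_rV n]_y (\prod_i g (lift ord0 i) (y ord0 i)))).
  apply: eq_Rintegral => x _; rewrite -RintegralZl//; last first.
    exact: (@integrable_prod n (fun i => g (lift ord0 i))).
  apply: eq_Rintegral => y _; rewrite big_ord_recl cons_rV0.
  by congr (_ * _); apply: eq_bigr => i _; rewrite cons_rVS.
by rewrite RintegralZr//; exact: ig.
Qed.

End product_integrals.

(** * The kernel kappa in one variable *)

Section line.
Context {R : realType}.
Local Notation mu := (@lebesgue_measure R).
Implicit Types (f g w dw : R -> R).

Lemma Rintegral_itvNyc f t :
  \int[mu]_(y in `]-oo, t]) f y = \int[mu]_y ((y <= t)%R%:R * f y).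
Proof.
rewrite Rintegral_mkcond; apply: eq_Rintegral => y _.
rewrite patchE mem_setE in_itv/=; case: ifP => _; rewrite ?mul1r ?mul0r//.
Qed.

Lemma measurable_le_ind (t : R) : measurable_fun setT (fun y : R => (y <= t)%R%:R : R).
Proof.
have -> : (fun y : R => (y <= t)%R%:R : R) = \1_(`]-oo, t] : set R).
  by apply/funext => y; rewrite indicE mem_setE in_itv.
exact: measurable_indic.
Qed.

Lemma integrable_le_ind f t : mu.-integrable setT (EFin \o f) ->
  mu.-integrable setT (fun y => ((y <= t)%R%:R * f y)%:E).
Proof.
move=> fi; apply: le_integrable (fi) => //.
  apply/measurable_EFinP; apply: measurable_funM; first exact: measurable_le_ind.
  by have /integrable_EFinP[] := fi.
move=> y _ /=; rewrite lee_fin normrM normr_nat.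
by case: (y <= t)%R; rewrite ?mul1r ?mul0r.
Qed.

(** The fundamental theorem of calculus on an interval reaching beyond the support, where the
    boundary values vanish. *)
Lemma FTC_support w dw (M : R) : (forall x, is_derive x (1 : R) w (dw x)) ->
  continuous dw -> (forall x, M < `|x| -> w x = 0) ->
  (forall x, M < `|x| -> dw x = 0) ->
  [/\ mu.-integrable setT (EFin \o dw),
      \int[mu]_s dw s = 0 &
      forall t, \int[mu]_s ((s <= t)%R%:R * dw s) = w t].
Proof.
move=> Dw cdw w0 dw0.
have ftc a b : a < b -> \int[mu]_(s in `[a, b]) dw s = w b - w a.
  move=> ab; rewrite /Rintegral (@continuous_FTC2 _ dw w)//.
  - exact: continuous_subspaceT.
  - split.
    + by move=> x _; have [] := Dw x.
    + have /derivable1_diffP/differentiable_continuous : derivable w a 1 by have [] := Dw a.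
      by move=> /cvg_at_right_filter.
    + have /derivable1_diffP/differentiable_continuous : derivable w b 1 by have [] := Dw b.
      by move=> /cvg_at_left_filter.
  - by move=> x _; rewrite derive1E; have [_ ->] := Dw x.
have idw : mu.-integrable setT (EFin \o dw).
  have M1 : forall x, ~ `[- (M + 1), M + 1]%classic x -> dw x = 0.
    move=> x /=; rewrite in_itv/= -ler_norml => /negP; rewrite -ltNge => Mx.
    by apply: dw0; rewrite (lt_trans _ Mx)// ltrDl.
  have : mu.-integrable `[- (M + 1), M + 1] (EFin \o dw).
    apply: continuous_compact_integrable; first exact: segment_compact.
    exact: continuous_subspaceT.
  move/integrable_mkcond => /(_ (measurable_itv _)); apply: eq_integrable => // x _.
  rewrite patchE; case: ifPn => // /negP; rewrite inE => /M1 xM.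
  by rewrite /= xM.
have total t : \int[mu]_s ((s <= t)%R%:R * dw s) = w t.
  (* [N] exceeds both |t| and M, so -N lies to the left of t and outside the support. *)
  pose N := `|t| + `|M| + 1.
  have Nt : - N < t.
    rewrite ltrNl; apply: le_lt_trans (ler_norm _) _; rewrite normrN /N.
    by rewrite -addrA ltrDl ltr_wpDl.
  have NM : M < N.
    apply: le_lt_trans (ler_norm _) _; rewrite /N -addrA addrCA ltrDl.
    by rewrite ltr_wpDl.
  have N0 : 0 < N by rewrite /N ltr_wpDl// addr_ge0.
  have M1 : forall x, x < - N -> dw x = 0.
    move=> x xN; apply: dw0; apply: (lt_trans NM); rewrite ltr0_norm.
      by rewrite ltrNr.
    by rewrite (lt_trans xN)// oppr_lt0.
  rewrite -[RHS]subr0 -(w0 (- N)); last by rewrite normrN gtr0_norm.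
  rewrite -ftc// [RHS]Rintegral_mkcond; apply: eq_Rintegral => y _.
  rewrite patchE mem_setE in_itv/=; case: (leP (- N) y) => [_|/M1 ->] /=.
    by case: ifP => _; rewrite ?mul1r ?mul0r.
  by rewrite mulr0.
split => //.
pose N := `|M| + 1.
have NM : M < `|N|.
  rewrite gtr0_norm /N; last by rewrite ltr_wpDl.
  by apply: le_lt_trans (ler_norm _) _; rewrite ltrDl.
rewrite -(w0 N)// -total; apply: eq_Rintegral => y _.
case: leP; rewrite ?mul1r// => Ny; rewrite mul0r; apply: dw0.
by rewrite (lt_le_trans NM)// gtr0_norm ?(le_trans (ltW Ny) (ler_norm _))// /N ltr_wpDl.
Qed.

End line.

Section univariate.
Context {R : realType}.
Local Notation mu := (@lebesgue_measure R).
Variables (rho psi : R -> R).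
Hypotheses (mrho : measurable_fun setT rho) (rho_gt0 : forall x, 0 < rho x)
  (rho1 : (\int[mu]_x (rho x)%:E = 1)%E).
Hypotheses (psi_gt0 : forall x, 0 < psi x) (psi_loc : locally_integrable setT psi)
  (psiV_loc : locally_integrable setT (fun x => (psi x)^-1)).
Local Notation Phi := (distr_fun rho).
Hypotheses
  (left_tail : forall c : R, (\int[mu]_(t in `]-oo, c]) (Phi t ^+ 2 / psi t)%:E < +oo)%E)
  (right_tail : forall c : R, (\int[mu]_(t in `[c, +oo[) ((1 - Phi t) ^+ 2 / psi t)%:E < +oo)%E).

Let mpsi : measurable_fun setT psi. Proof. by have [] := psi_loc. Qed.

Lemma integrable_density : mu.-integrable setT (EFin \o rho).
Proof.
apply/integrable_EFinP; split => //.
under eq_integral do rewrite gtr0_norm//.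
by rewrite rho1 ltry.
Qed.
Let irho := integrable_density.

Lemma Rintegral_density : \int[mu]_x rho x = 1.
Proof. by rewrite /Rintegral rho1. Qed.

Lemma distr_funE t : Phi t = \int[mu]_y ((y <= t)%R%:R * rho y).
Proof. exact: Rintegral_itvNyc. Qed.

Lemma distr_fun_ge0 t : 0 <= Phi t.
Proof. by apply: Rintegral_ge0 => x _; exact: ltW. Qed.

Lemma distr_fun_le1 t : Phi t <= 1.
Proof.
rewrite distr_funE -[leRHS]Rintegral_density; apply: le_Rintegral => //.
  exact: integrable_le_ind.
by move=> x _; case: (x <= t)%R; rewrite ?mul1r ?mul0r// ltW.
Qed.

Lemma distr_fun_homo : {homo Phi : s t / s <= t}.
Proof.
move=> s t st; rewrite !distr_funE; apply: le_Rintegral => //;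
  [exact: integrable_le_ind..|].
move=> x _; apply: ler_wpM2r; first exact: ltW.
by rewrite ler_nat; case: (leP x s) => // xs; rewrite (le_trans xs st).
Qed.

Lemma measurable_distr_fun : measurable_fun setT Phi.
Proof. by apply: nondecreasing_measurable => // s t; exact: distr_fun_homo. Qed.
Let mPhi := measurable_distr_fun.

Definition kappa (t y : R) : R := Phi t - (y <= t)%R%:R.

Lemma measurable_kappa : measurable_fun setT (fun p : R * R => kappa p.1 p.2).
Proof.
apply: measurable_funB; first exact: measurableT_comp.
apply: (measurableT_comp (f := fun b : bool => b%:R : R)) => //.
by apply: measurable_fun_ler.
Qed.

Lemma measurable_kappa1 y : measurable_fun setT (kappa ^~ y).
Proof. exact: (measurableT_comp measurable_kappa (pair2_measurable y)). Qed.

Lemma measurable_kappa2 t : measurable_fun setT (kappa t).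
Proof. exact: (measurableT_comp measurable_kappa (pair1_measurable t)). Qed.

(** The form affine in the indicator lets the integral in y against rho be expressed through Phi
    alone. *)
Lemma normr_kappa t y :
  `|kappa t y| = Phi t + (y <= t)%R%:R * (1 - 2 * Phi t).
Proof.
have P0 := distr_fun_ge0 t; have P1 := distr_fun_le1 t.
rewrite /kappa; case: (y <= t)%R => /=.
  by rewrite ler0_norm; lra.
by rewrite ger0_norm; lra.
Qed.

Lemma normr_kappa_le1 t y : `|kappa t y| <= 1.
Proof.
have := distr_fun_ge0 t; have := distr_fun_le1 t.
by rewrite normr_kappa; case: (y <= t)%R => /=; lra.
Qed.

Lemma integrable_kappa_density t :
  mu.-integrable setT (fun y => (kappa t y * rho y)%:E).
Proof.
apply: le_integrable irho => //.
  by apply/measurable_EFinP; apply: measurable_funM => //; exact: measurable_kappa2.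
move=> y _ /=; rewrite lee_fin normrM ler_piMl// normr_kappa_le1//.
Qed.

Lemma Rintegral_kappa_density t : \int[mu]_y (kappa t y * rho y) = 0.
Proof.
rewrite /kappa; under eq_Rintegral do rewrite mulrBl.
rewrite RintegralB//; last 2 first.
- exact: (integrableZl _ (Phi t) irho).
- exact: integrable_le_ind.
by rewrite RintegralZl// Rintegral_density -distr_funE mulr1 subrr.
Qed.

(** The value of int |kappa(t, y)| rho(y) dy. It is at most 2 Phi(t) and at most 2 (1 - Phi(t)), so
    each tail condition controls it on its own side. *)
Definition kappa_mass t := 2 * Phi t * (1 - Phi t).

Lemma integral_kappa_mass t :
  (\int[mu]_y (`|kappa t y| * rho y)%:E = (kappa_mass t)%:E)%E.
Proof.
have ik : mu.-integrable setT (fun y => (`|kappa t y| * rho y)%:E).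
  apply: le_integrable irho => //.
    apply/measurable_EFinP; apply: measurable_funM => //.
    by apply: measurableT_comp => //; exact: measurable_kappa2.
  by move=> y _ /=; rewrite lee_fin normrM normr_id ler_piMl// normr_kappa_le1.
rewrite -(EFin_Rintegral ik); congr EFin.
under eq_Rintegral do rewrite normr_kappa mulrDl -mulrA mulrCA.
rewrite RintegralD//; last 2 first.
- exact: (integrableZl _ (Phi t) irho).
- exact: (integrableZl _ (1 - 2 * Phi t) (integrable_le_ind t irho)).
rewrite RintegralZl// Rintegral_density.
rewrite RintegralZl//; last exact: integrable_le_ind.
rewrite -distr_funE /kappa_mass; ring.
Qed.

Definition sq_finite (g : R -> R) := measurable_fun setT g /\
  (\int[mu]_t (g t ^+ 2 / psi t)%:E < +oo)%E.

Let psiV0 t : 0 <= (psi t)^-1. Proof. by rewrite invr_ge0 ltW. Qed.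

Let mpsiV : measurable_fun setT (fun t => (psi t)^-1).
Proof. by have [] := psiV_loc. Qed.

(** The two tail conditions handle the outer regions, local integrability of 1 / psi the compact
    middle. *)
Lemma sq_finite_split (g : R -> R) (C a b : R) : measurable_fun setT g ->
  (forall t, t < a -> `|g t| <= C * Phi t) ->
  (forall t, a <= t -> t <= b -> `|g t| <= C) ->
  (forall t, b < t -> `|g t| <= C * (1 - Phi t)) ->
  sq_finite g.
Proof.
move=> mg ga gab gb; split => //.
pose F1 t := ((Phi t ^+ 2 / psi t)%:E : \bar R).
pose F2 t := (((psi t)^-1)%:E : \bar R).
pose F3 t := (((1 - Phi t) ^+ 2 / psi t)%:E : \bar R).
have mF1 : measurable_fun setT F1.
  by apply/measurable_EFinP; apply: measurable_funM => //; exact: measurable_funX.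
have mF2 : measurable_fun setT F2 by apply/measurable_EFinP.
have mF3 : measurable_fun setT F3.
  apply/measurable_EFinP; apply: measurable_funM => //; apply: measurable_funX.
  exact: measurable_funB.
have F1_0 t : (0 <= F1 t)%E by rewrite lee_fin mulr_ge0// sqr_ge0.
have F2_0 t : (0 <= F2 t)%E by rewrite lee_fin.
have F3_0 t : (0 <= F3 t)%E by rewrite lee_fin mulr_ge0// sqr_ge0.
pose G1 := F1 \_ `]-oo, a]; pose G2 := F2 \_ `[a, b]; pose G3 := F3 \_ `[b, +oo[.
have G1_0 t : (0 <= G1 t)%E by rewrite /G1 patchE; case: ifP.
have G2_0 t : (0 <= G2 t)%E by rewrite /G2 patchE; case: ifP.
have G3_0 t : (0 <= G3 t)%E by rewrite /G3 patchE; case: ifP.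
have mG1 : measurable_fun setT G1 by apply/(measurable_restrictT _ _).1 => //; exact: measurable_funTS.
have mG2 : measurable_fun setT G2 by apply/(measurable_restrictT _ _).1 => //; exact: measurable_funTS.
have mG3 : measurable_fun setT G3 by apply/(measurable_restrictT _ _).1 => //; exact: measurable_funTS.
have G1oo : (\int[mu]_t G1 t < +oo)%E by rewrite /G1 -integral_mkcond; exact: left_tail.
have G3oo : (\int[mu]_t G3 t < +oo)%E by rewrite /G3 -integral_mkcond; exact: right_tail.
have G2oo : (\int[mu]_t G2 t < +oo)%E.
  rewrite /G2 -integral_mkcond; have [_ _ /(_ `[a, b]%classic)] := psiV_loc.
  move=> /(_ (@subsetT _ _)) h; have := h (@segment_compact R a b); congr (_ < _)%E.
  by apply: eq_integral => x _; rewrite /F2 ger0_norm.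
apply: (@le_lt_trans _ _ (\int[mu]_t ((C ^+ 2)%:E * (G1 t + G2 t + G3 t)))%E).
  apply: ge0_le_integral => //.
  - by move=> t _; rewrite lee_fin mulr_ge0// sqr_ge0.
  - by apply/measurable_EFinP; apply: measurable_funM => //; exact: measurable_funX.
  - apply: emeasurable_funM => //.
    by apply: emeasurable_funD => //; exact: emeasurable_funD.
  move=> t _; rewrite -real_normK ?num_real//.
  have sq (x y : R) : `|x| <= y -> `|x| ^+ 2 <= y ^+ 2.
    by move=> xy; rewrite ler_sqr ?nnegrE// (le_trans _ xy).
  have [ta|ta] := ltP t a.
    apply: (@le_trans _ _ ((C ^+ 2)%:E * G1 t)%E).
      rewrite /G1 patchE mem_setE in_itv/= (ltW ta) -EFinM lee_fin mulrA.
      by rewrite ler_wpM2r// -exprMn; apply: sq; exact: ga.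
    by rewrite lee_pmul ?lee_fin ?sqr_ge0// -addeA leeDl// adde_ge0.
  have [tb|tb] := leP t b.
    apply: (@le_trans _ _ ((C ^+ 2)%:E * G2 t)%E).
      rewrite /G2 patchE mem_setE in_itv/= ta tb -EFinM lee_fin.
      by rewrite ler_wpM2r//; apply: sq; exact: gab.
    by rewrite lee_pmul ?lee_fin ?sqr_ge0// addeAC leeDr// adde_ge0.
  apply: (@le_trans _ _ ((C ^+ 2)%:E * G3 t)%E).
    rewrite /G3 patchE mem_setE in_itv/= (ltW tb) -EFinM lee_fin mulrA.
    by rewrite ler_wpM2r// -exprMn; apply: sq; exact: gb.
  by rewrite lee_pmul ?lee_fin ?sqr_ge0// leeDr// adde_ge0.
rewrite ge0_integralZl//; last 3 first.
- by apply: emeasurable_funD => //; exact: emeasurable_funD.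
- by move=> t _; rewrite !adde_ge0.
- by rewrite lee_fin sqr_ge0.
rewrite ge0_integralD//; last 2 first.
- by move=> t _; rewrite adde_ge0.
- exact: emeasurable_funD.
rewrite ge0_integralD//.
apply: lte_mul_pinfty => //; first by rewrite lee_fin sqr_ge0.
by apply: lte_add_pinfty => //; apply: lte_add_pinfty.
Qed.

Lemma sq_finite_kappa_mass : sq_finite kappa_mass.
Proof.
(* The middle interval shrinks to the point 0, since the two tail bounds already cover the line. *)
apply: (@sq_finite_split _ 2 0 0).
- apply: measurable_funM; first exact: measurable_funM.
  exact: measurable_funB.
- move=> t _; have P0 := distr_fun_ge0 t; have P1 := distr_fun_le1 t.
  by rewrite /kappa_mass ger0_norm; nra.
- move=> t _ _; have P0 := distr_fun_ge0 t; have P1 := distr_fun_le1 t.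
  by rewrite /kappa_mass ger0_norm; nra.
- move=> t _; have P0 := distr_fun_ge0 t; have P1 := distr_fun_le1 t.
  by rewrite /kappa_mass ger0_norm; nra.
Qed.

(** A bound on |kappa(t, y)| uniform over |y| <= M: to the left of -M no such y is <= t and kappa is
    Phi(t), to the right of M all of them are and kappa is Phi(t) - 1. *)
Definition kappa_sup (M t : R) :=
  if t < - M then Phi t else if t <= M then 1 else 1 - Phi t.

Lemma kappa_sup_ge0 M t : 0 <= kappa_sup M t.
Proof.
have P0 := distr_fun_ge0 t; have P1 := distr_fun_le1 t.
by rewrite /kappa_sup; case: ifP => // _; case: ifP => // _; rewrite subr_ge0.
Qed.

Lemma measurable_kappa_sup M : measurable_fun setT (kappa_sup M).
Proof.
apply: measurable_fun_ifT => //.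
  by apply: measurable_fun_ltr.
apply: measurable_fun_ifT => //; last exact: measurable_funB.
by apply: measurable_fun_ler.
Qed.

Lemma normr_kappa_sup (M t y : R) : `|y| <= M -> `|kappa t y| <= kappa_sup M t.
Proof.
rewrite ler_norml => /andP[My yM]; have P0 := distr_fun_ge0 t.
have P1 := distr_fun_le1 t; rewrite /kappa_sup.
case: ifPn => [tM|]; last (rewrite -leNgt => tM; case: ifPn => [_|]; last rewrite -ltNge => Mt).
- by rewrite /kappa (leNgt y t) (lt_le_trans tM My)/= subr0 ger0_norm.
- exact: normr_kappa_le1.
- by rewrite /kappa (le_trans yM (ltW Mt)) ler0_norm ?opprB// subr_le0.
Qed.

Lemma le_sq_finite (g h : R -> R) : measurable_fun setT g ->
  (forall t, `|g t| <= `|h t|) -> sq_finite h -> sq_finite g.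
Proof.
move=> mg gh [mh hoo]; split => //; apply: le_lt_trans hoo.
apply: ge0_le_integral => //.
- by move=> t _; rewrite lee_fin mulr_ge0// sqr_ge0.
- by apply/measurable_EFinP; apply: measurable_funM => //; exact: measurable_funX.
- by apply/measurable_EFinP; apply: measurable_funM => //; exact: measurable_funX.
- move=> t _; rewrite lee_fin ler_wpM2r//.
  by rewrite -(real_normK (num_real (g t))) -(real_normK (num_real (h t))) ler_sqr ?nnegrE.
Qed.

Lemma sq_finite_kappa_sup (M : R) : 0 <= M -> sq_finite (kappa_sup M).
Proof.
move=> M0; apply: (@sq_finite_split _ 1 (- M) M); first exact: measurable_kappa_sup.
- by move=> t tM; rewrite mul1r /kappa_sup tM ger0_norm// distr_fun_ge0.
- by move=> t tM Mt; rewrite /kappa_sup ltNge tM/= Mt normr1.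
- move=> t Mt; rewrite ger0_norm ?kappa_sup_ge0// /kappa_sup.
  rewrite (ltNge t) (leNgt t) Mt/= (le_trans _ (ltW Mt))/= ?mul1r//.
  by rewrite (le_trans _ M0)// oppr_le0.
Qed.

Lemma sq_finite_kappa y : sq_finite (kappa ^~ y).
Proof.
apply: (@le_sq_finite _ (kappa_sup `|y|)); first exact: measurable_kappa1.
  by move=> t; rewrite [leRHS]ger0_norm ?kappa_sup_ge0// normr_kappa_sup.
exact: sq_finite_kappa_sup.
Qed.

Lemma sq_finite_indic M : sq_finite \1_`[- M, M].
Proof.
apply: (@sq_finite_split _ 1 (- M) M).
- exact: measurable_indic.
- move=> t tM; rewrite indicE mem_setE in_itv/= (leNgt _ t) tM/= normr0 mul1r.
  exact: distr_fun_ge0.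
- by move=> t _ _; rewrite indicE; case: (_ \in _); rewrite ?normr1 ?normr0.
- move=> t tM; rewrite indicE mem_setE in_itv/= (leNgt t) tM/= andbF normr0 mul1r.
  by rewrite subr_ge0 distr_fun_le1.
Qed.

(** Strictly positive, so that a finite integral against it forces finiteness almost everywhere. As
    min(x, 1)^2 <= x for x > 0, its square is at most psi rho, which makes it square-integrable
    against 1 / psi. *)
Definition small_weight t := Num.min (psi t) 1 * Num.min (rho t) 1.

Lemma small_weight_gt0 t : 0 < small_weight t.
Proof. by rewrite mulr_gt0// lt_min ?psi_gt0 ?rho_gt0 ltr01. Qed.

Lemma measurable_small_weight : measurable_fun setT small_weight.
Proof. by apply: measurable_funM; apply: measurable_minr. Qed.

Lemma sq_finite_small_weight : sq_finite small_weight.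
Proof.
split; first exact: measurable_small_weight.
apply: (@le_lt_trans _ _ (\int[mu]_t (rho t)%:E)%E); last by rewrite rho1 ltry.
apply: ge0_le_integral => //.
- by move=> t _; rewrite lee_fin mulr_ge0// sqr_ge0.
- apply/measurable_EFinP; apply: measurable_funM => //; apply: measurable_funX.
  exact: measurable_small_weight.
- exact/measurable_EFinP.
move=> t _; rewrite lee_fin ler_pdivrMr// /small_weight exprMn mulrC.
have sq (x : R) : 0 < x -> Num.min x 1 ^+ 2 <= x.
  by move=> x0; rewrite minElt; case: ltP => x1; nra.
by apply: ler_pM; rewrite ?sqr_ge0// sq.
Qed.

Lemma integrable_sq_finite g h : sq_finite g -> sq_finite h ->
  mu.-integrable setT (fun t => (g t * h t / psi t)%:E).
Proof.
move=> [mg goo] [mh hoo].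
have mgg : measurable_fun setT (fun t => (g t ^+ 2 / psi t)%:E).
  by apply/measurable_EFinP; apply: measurable_funM => //; exact: measurable_funX.
have mhh : measurable_fun setT (fun t => (h t ^+ 2 / psi t)%:E).
  by apply/measurable_EFinP; apply: measurable_funM => //; exact: measurable_funX.
apply/integrable_EFinP; split.
  by apply: measurable_funM => //; exact: measurable_funM.
apply: (@le_lt_trans _ _ (\int[mu]_t ((g t ^+ 2 / psi t)%:E + (h t ^+ 2 / psi t)%:E))%E).
  apply: ge0_le_integral => //.
  - apply/measurable_EFinP; apply: measurableT_comp => //.
    by apply: measurable_funM => //; exact: measurable_funM.
  - exact: emeasurable_funD.
  move=> t _; rewrite lee_fin normrM [X in _ * X]ger0_norm// -mulrDl ler_wpM2r//.
  rewrite normrM -(real_normK (num_real (g t))) -(real_normK (num_real (h t))).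
  have := sqr_ge0 (`|g t| - `|h t|); have := normr_ge0 (g t); have := normr_ge0 (h t).
  by nra.
rewrite ge0_integralD//.
- by rewrite lte_add_pinfty.
- by move=> t _; rewrite lee_fin mulr_ge0// sqr_ge0.
- by move=> t _; rewrite lee_fin mulr_ge0// sqr_ge0.
Qed.

Lemma integrable_kappa_kappa x y :
  mu.-integrable setT (fun t => (kappa t x * kappa t y / psi t)%:E).
Proof. by apply: integrable_sq_finite; exact: sq_finite_kappa. Qed.

(** The three terms of eta are the three ranges of t: both kappas equal Phi to the left of min(x,
    y), both equal Phi - 1 to the right of max(x, y), and in between there is one of each. *)
Lemma eta_kernelE x y :
  eta_kernel rho psi x y = \int[mu]_t (kappa t x * kappa t y / psi t).
Proof.
set F := fun t => kappa t x * kappa t y / psi t.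
have iF : mu.-integrable setT (EFin \o F) := integrable_kappa_kappa x y.
set a := Num.min x y; set b := Num.max x y.
have ab : a <= b by rewrite /a /b ge_min !le_max !lexx.
have kE z t : t < a -> (z == x) || (z == y) -> kappa t z = Phi t.
  move=> ta zxy; rewrite /kappa leNgt (lt_le_trans ta) ?subr0// /a ge_min.
  by case/orP : zxy => /eqP ->; rewrite lexx ?orbT.
have kE' z t : b <= t -> (z == x) || (z == y) -> kappa t z = Phi t - 1.
  move=> ta zxy; rewrite /kappa (le_trans _ ta)//= /b le_max.
  by case/orP : zxy => /eqP ->; rewrite lexx ?orbT.
(* Exactly one of the two indicators is 1 here, whichever of x and y is the smaller. *)
have kE2 t : a <= t -> t < b -> kappa t x * kappa t y = Phi t * (Phi t - 1).
  rewrite /a /b /kappa; case: (ltP x y) => [xy xt ty|yx yt tx].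
    by rewrite xt (leNgt y) ty/= subr0 mulrC.
  by rewrite yt (leNgt x) tx/= subr0.
have iF1 : mu.-integrable `]-oo, a[ (EFin \o F) by apply: integrableS iF.
have iF2 : mu.-integrable `[a, +oo[ (EFin \o F) by apply: integrableS iF.
have iF21 : mu.-integrable `[a, b[ (EFin \o F) by apply: integrableS iF.
have iF22 : mu.-integrable `[b, +oo[ (EFin \o F) by apply: integrableS iF.
have UT : setT = `]-oo, a[ `|` `[a, +oo[ :> set R.
  apply/seteqP; split => // t _ /=; rewrite !in_itv/= andbT.
  by case: (ltP t a) => _; [left|right].
have U2 : `[a, +oo[%classic = `[a, b[ `|` `[b, +oo[ :> set R.
  apply/seteqP; split => t /=; rewrite !in_itv/= ?andbT.
    by move=> ->; case: (ltP t b) => _; [left|right].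
  by case=> [/andP[]//|]; exact: le_trans.
rewrite [in RHS]UT Rintegral_setU//; last 2 first.
- by rewrite -UT.
- apply/disj_setPS => t [/=]; rewrite !in_itv/= andbT => h.
  by rewrite leNgt h.
rewrite U2 Rintegral_setU//; last 2 first.
- by rewrite -U2.
- apply/disj_setPS => t [/=]; rewrite !in_itv/= andbT => /andP[_ h].
  by rewrite leNgt h.
rewrite /eta_kernel -/a -/b -addrA [X in _ = _ + X]addrC; congr (_ + (_ + _)).
- rewrite -Rintegral_itv_bndo_bndc; last first.
    apply: eq_integrable iF1 => // t; rewrite inE/= in_itv/= => ta.
    by rewrite /F !kE ?eqxx ?orbT// expr2.
  by apply: eq_Rintegral => t; rewrite inE/= in_itv/= => ta; rewrite /F !kE ?eqxx ?orbT// expr2.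
- apply: eq_Rintegral => t; rewrite inE/= in_itv/= andbT => ta.
  by rewrite /F !kE' ?eqxx ?orbT// -expr2 -sqrrN opprB.
- rewrite -Rintegral_itv_bndo_bndc; last first.
    have := integrableN iF21; apply: eq_integrable => // t; rewrite inE/= in_itv/= => /andP[ta tb].
    by rewrite /= /F kE2//; congr EFin; ring.
  rewrite -mulN1r -RintegralZl//; last first.
    have := integrableN iF21; apply: eq_integrable => // t; rewrite inE/= in_itv/= => /andP[ta tb].
    by rewrite /= /F kE2//; congr EFin; ring.
  apply: eq_Rintegral => t; rewrite inE/= in_itv/= => /andP[ta tb].
  by rewrite /F kE2//; ring.
Qed.

(** The term Phi(t) is constant in s and integrates the derivative of w to 0; the indicator
    integrates it to w(t). *)
Lemma Rintegral_kappa_deriv (w dw : R -> R) (M : R) :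
  (forall x, is_derive x (1 : R) w (dw x)) ->
  continuous dw -> (forall x, M < `|x| -> w x = 0) ->
  (forall x, M < `|x| -> dw x = 0) ->
  forall t, \int[mu]_s (kappa t s * dw s) = - w t.
Proof.
move=> Dw cdw w0 dw0 t; have [idw dwT dwt] := FTC_support Dw cdw w0 dw0.
rewrite /kappa; under eq_Rintegral do rewrite mulrBl.
rewrite RintegralB//; last 2 first.
- exact: (integrableZl _ (Phi t) idw).
- exact: integrable_le_ind.
by rewrite RintegralZl// dwT dwt mulr0 sub0r.
Qed.

End univariate.

(** * Test functions *)

Section row_topology.
Context {R : realType} {d : nat}.
Implicit Types (U K : set 'rV[R]_d) (v : 'rV[R]_d -> R).

Let rat_cube (p : 'rV[rat]_d * nat) : set 'rV[R]_d :=
  box (fun i => `]ratr (p.1 ord0 i) - p.2.+1%:R^-1, ratr (p.1 ord0 i) + p.2.+1%:R^-1[%classic).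

(** The sigma-algebra is generated by the coordinates, so an open set has to be exhibited as a
    countable union of boxes: the cubes with rational centre and radius 1 / (n + 1) that it
    contains. *)
Lemma open_measurable_rV U : open U -> measurable U.
Proof.
move=> oU.
pose C n := if unpickle n is Some p
  then (if `[< rat_cube p `<=` U >] then rat_cube p else set0) else set0.
have -> : U = \bigcup_n C n.
  apply/seteqP; split; last first.
    move=> x [n _]; rewrite /C; case: unpickle => // p.
    by case: asboolP => // pU; exact: pU.
  move=> x Ux; move: oU; rewrite openE => /(_ x Ux)/nbhs_ballP[e /= e0 xeU].
  (* With a radius below e / 2, a cube containing x stays inside the ball of radius e around x. *)
  have [n ne] : exists n : nat, n.+1%:R^-1 < e / 2.
    have [n _ /(_ n (leqnn n)) /=] := near_infty_natSinv_lt (PosNum (divr_gt0 e0 (ltr0n _ 2))).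
    by move=> ?; exists n.
  have e2 : 0 < n.+1%:R^-1 :> R by rewrite invr_gt0.
  have hq i : exists q : rat, `|x ord0 i - ratr q| < n.+1%:R^-1.
    have : x ord0 i - n.+1%:R^-1 < x ord0 i + n.+1%:R^-1 by rewrite ltrBlDr -addrA ltrDl addr_gt0.
    move=> /rat_in_itvoo[q]; rewrite in_itv/= => /andP[q1 q2]; exists q.
    by rewrite ltr_distlC q1 q2.
  have /choice[q qE] := hq.
  pose p : 'rV[rat]_d * nat := (\row_i q i, n).
  exists (pickle p) => //; rewrite /C pickleK.
  have -> : `[< rat_cube p `<=` U >].
    apply/asboolP => y py; apply: xeU; split => // i j; rewrite (ord1 i).
    rewrite /ball/= (le_lt_trans (ler_distD (ratr (q j)) _ _))//.
    rewrite [ltRHS](splitr e); apply: ltrD; first exact: (lt_trans (qE j)).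
    apply: lt_trans ne; move: (py j); rewrite /= mxE in_itv/= => /andP[y1 y2].
    by rewrite ltr_distlC y1 y2.
  move=> i /=; rewrite in_itv/= mxE.
  by have := qE i; rewrite ltr_distl => /andP[-> ->].
apply: bigcup_measurable => n _; rewrite /C; case: unpickle => // p.
by case: asboolP => // _; apply: measurable_box => i; exact: measurable_itv.
Qed.

Lemma continuous_measurable_rV v : continuous v -> measurable_fun setT v.
Proof.
move=> cv; apply: (measurability _ (RGenOpens.measurableE R)) => _ [_ [a [b ->]] <-].
rewrite setTI; apply: open_measurable_rV.
by move/continuousP : cv; apply; exact: interval_open.
Qed.

Definition cube (M : R) : set 'rV[R]_d := box (fun=> `[- M, M]%classic).

Lemma cubeP M x : cube M x <-> forall i, `|x ord0 i| <= M.
Proof. by split => h i; have := h i; rewrite /= in_itv/= -ler_norml. Qed.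

Lemma measurable_cube M : measurable (cube M).
Proof. by apply: measurable_box => i; exact: measurable_itv. Qed.

Lemma compact_cube M : compact (cube M).
Proof. by apply: rV_compact => i; exact: segment_compact. Qed.

Lemma coord_le_norm (x : 'rV[R]_d) i : `|x ord0 i| <= `|x|.
Proof.
rewrite [leRHS]/Num.norm /= mx_normrE; apply/bigmax_geP; right => /=.
by exists (ord0, i).
Qed.

Lemma compact_sub_cube K : compact K -> exists2 M, 0 <= M & K `<=` cube M.
Proof.
move=> /compact_bounded[M [Mreal KM]]; exists (`|M| + 1); first by rewrite addr_ge0.
move=> x Kx; apply/cubeP => i; apply: le_trans (coord_le_norm x i) _.
by apply: KM => //; apply: le_lt_trans (ler_norm _) _; rewrite ltrDl.
Qed.

(** The integrals over [K] and [A] are compared through the simple functions lying below the two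
    restricted integrands. *)
Lemma subset_ge0_integral (K A : set 'rV[R]_d) (f : 'rV[R]_d -> \bar R) : K `<=` A ->
  (forall x, 0 <= f x)%E ->
  (\int[lebesgue_rV d]_(x in K) f x <= \int[lebesgue_rV d]_(x in A) f x)%E.
Proof.
move=> KA f0; rewrite integral_mkcond [leRHS]integral_mkcond.
rewrite !ge0_integralTE; last 2 first.
- by move=> x; rewrite patchE; case: ifP.
- by move=> x; rewrite patchE; case: ifP.
apply: le_ereal_sup => _ [h hf <-]; exists h => // x.
apply: le_trans (hf x) _; rewrite !patchE.
case: ifPn => xK; first by rewrite ifT// inE; apply: KA; rewrite -inE.
by case: ifP.
Qed.

Lemma locally_integrable_rVP v : locally_integrable_rV v <->
  measurable_fun setT v /\
  forall M, (\int[lebesgue_rV d]_(x in cube M) `|v x|%:E < +oo)%E.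
Proof.
split=> [[mv h]|[mv h]]; split => //; first by move=> M; apply: h; exact: compact_cube.
move=> K /compact_sub_cube[M _ KM]; apply: le_lt_trans (h M).
by apply: subset_ge0_integral => // x; rewrite lee_fin.
Qed.

Lemma locally_integrable_ge0 v : locally_integrable_rV v ->
  forall M, (\int[lebesgue_rV d]_x (`|v x| * \1_(cube M) x)%:E < +oo)%E.
Proof.
move=> /locally_integrable_rVP[_ h] M; move: (h M); congr (_ < _)%E.
rewrite integral_mkcond; apply: eq_integral => x _.
by rewrite patchE indicE; case: (x \in _); rewrite ?mulr1 ?mulr0.
Qed.

End row_topology.

Section test_functions.
Context {R : realType} {d : nat}.
Implicit Types (v : 'rV[R]_d -> R).

Definition cube_supported (M : R) v := forall (x : 'rV[R]_d) i, M < `|x ord0 i| -> v x = 0.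

(** Equivalent to [test_function]; a bounding cube is easier to carry along coordinate lines and
    through partial derivatives than a compact closure. *)
Definition tame v := smooth v /\ exists2 M, 0 <= M & cube_supported M v.

Lemma test_function_tame v : test_function v -> tame v.
Proof.
move=> [sv cv]; split => //; have [M M0 KM] := compact_sub_cube cv.
exists M => // x i xM; apply: contrapT => /eqP vx0.
have /KM/cubeP/(_ i) : closure [set x | v x != 0] x by exact: subset_closure.
by rewrite leNgt xM.
Qed.

Lemma tame_test_function v : tame v -> test_function v.
Proof.
move=> [sv [M M0 vM]]; split => //; apply: (@subclosed_compact _ _ (cube M)).
- exact: closed_closure.
- exact: compact_cube.
have cM : closed (@cube R d M).
  by apply: compact_closed; [exact: norm_hausdorff|exact: compact_cube].
rewrite [X in _ `<=` X](closure_id _).1//; apply: closure_subset => x /= vx0.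
apply/cubeP => i; rewrite leNgt; apply/negP => /vM vx.
by rewrite vx eqxx in vx0.
Qed.

Definition upd (x : 'rV[R]_d) (j : 'I_d) (s : R) : 'rV[R]_d :=
  \row_i if i == j then s else x ord0 i.

Lemma upd_shift (x : 'rV[R]_d) j s h :
  upd x j (h + s) = h *: delta_mx ord0 j + upd x j s.
Proof.
apply/rowP => i; rewrite !mxE eqxx/=; case: eqP => _; first by rewrite mulr1.
by rewrite mulr0 add0r.
Qed.

Lemma is_derive_upd v (x : 'rV[R]_d) j s :
  derivable v (upd x j s) (delta_mx ord0 j) ->
  is_derive s (1 : R) (fun r => v (upd x j r)) (partial j v (upd x j s)).
Proof.
move=> dv.
have E : (fun h : R => h^-1 *: (((fun r => v (upd x j r)) \o shift s) (h *: (1 : R)) - v (upd x j s))) =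
   (fun h => h^-1 *: ((v \o shift (upd x j s)) (h *: delta_mx ord0 j) - v (upd x j s))).
  by apply/funext => h; rewrite /= /GRing.scale/= mulr1 upd_shift.
split; first by rewrite /derivable E.
by rewrite /derive E.
Qed.

Lemma continuous_upd (x : 'rV[R]_d) j : continuous (upd x j).
Proof.
move=> s A /nbhs_ballP[e /= e0 sA]; apply/nbhs_ballP; exists e => //= r sr.
apply: sA; split => // i k; rewrite !mxE; case: ifP => // _.
exact: ballxx.
Qed.

Lemma smooth_continuous v : smooth v -> continuous v.
Proof. by move=> /(_ [::])[]. Qed.

Lemma smooth_derivable v x i : smooth v -> derivable v x (delta_mx ord0 i).
Proof. by move=> /(_ [::])[_ +]; apply. Qed.

Lemma smooth_partial v i : smooth v -> smooth (partial i v).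
Proof.
move=> sv s; have := sv (rcons s i).
by rewrite /iter_partial foldr_rcons.
Qed.

Lemma updK (x : 'rV[R]_d) j : upd x j (x ord0 j) = x.
Proof. by apply/rowP => i; rewrite mxE; case: eqP => [->|]. Qed.

(** Near the point, v vanishes along the line in direction i: on the whole line if the large
    coordinate is another one, and by openness of M < |r| if it is the i-th. *)
Lemma cube_supported_partial M v i : smooth v -> cube_supported M v ->
  cube_supported M (partial i v).
Proof.
move=> sv vM x j xM; rewrite -(updK x i).
have dv := @smooth_derivable v (upd x i (x ord0 i)) i sv.
have [_ <-] := is_derive_upd dv.
have : \forall r \near x ord0 i, v (upd x i r) = 0.
  have [ij|ij] := eqVneq j i; last first.
    have z r : v (upd x i r) = 0 by apply: (vM _ j); rewrite mxE (negbTE ij).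
    by near do exact: z.
  move: xM; rewrite ij => xM.
  have : \forall r \near x ord0 i, M < `|r|.
    have : (fun r : R => `|r|) @ (x ord0 i) --> `|x ord0 i| by exact: norm_continuous.
    by move/cvgr_gt; apply.
  by apply: filterS => r rM; apply: (vM _ i); rewrite mxE eqxx.
move=> nz; rewrite (@near_eq_derive _ _ _ _ (cst 0)) ?derive_cst//.
Unshelve. all: by end_near. Qed.

Lemma tame_partial v i : tame v -> tame (partial i v).
Proof.
move=> [sv [M M0 vM]]; split; first exact: smooth_partial.
by exists M => //; exact: cube_supported_partial.
Qed.

Lemma tame_bounded v : tame v -> exists2 C, 0 <= C & forall x, `|v x| <= C.
Proof.
move=> [sv [M M0 vM]].
have : compact (v @` cube M).
  apply: continuous_compact; last exact: compact_cube.
  by apply: continuous_subspaceT; exact: smooth_continuous.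
move=> /compact_bounded[C [Creal h]]; exists (`|C| + 1); first by rewrite addr_ge0.
move=> x; have [xM|] := pselect (cube M x).
  apply: h; last by exists x.
  by apply: le_lt_trans (ler_norm _) _; rewrite ltrDl.
move=> /cubeP/existsNP[i /negP]; rewrite -ltNge => /vM ->.
by rewrite normr0 addr_ge0.
Qed.

Lemma tame_le_cube v : tame v -> exists C M, [/\ 0 <= C, 0 <= M &
  forall x, `|v x| <= C * \1_(cube M) x].
Proof.
move=> tv; have [C C0 vC] := tame_bounded tv; case: tv => sv [M M0 vM].
exists C, M; split => // x; rewrite indicE.
case: (boolP (x \in cube M)) => [_|]; first by rewrite mulr1.
rewrite notin_setE => /cubeP/existsNP[i /negP]; rewrite -ltNge => /vM ->.
by rewrite normr0 mulr0.
Qed.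

Lemma tame_measurable v : tame v -> measurable_fun setT v.
Proof. by move=> [sv _]; apply: continuous_measurable_rV; exact: smooth_continuous. Qed.

Lemma locally_integrable_tame f v : locally_integrable_rV f -> tame v ->
  (lebesgue_rV d).-integrable setT (fun x => (f x * v x)%:E).
Proof.
move=> lf tv; have [C [M [C0 M0 vC]]] := tame_le_cube tv.
have mf := lf.1; have mv := tame_measurable tv.
apply/integrable_EFinP; split; first exact: measurable_funM.
have m1 : measurable_fun setT (fun x => `|f x| * \1_(cube M) x).
  apply: measurable_funM; first exact: measurableT_comp.
  by apply: measurable_indic; exact: measurable_cube.
apply: (@le_lt_trans _ _ (\int[lebesgue_rV d]_x (C%:E * (`|f x| * \1_(cube M) x)%:E))%E).
  apply: ge0_le_integral => //.
  - by apply/measurable_EFinP/measurableT_comp => //; exact: measurable_funM.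
  - by apply: emeasurable_funM => //; apply/measurable_EFinP.
  - move=> x _; rewrite -EFinM lee_fin normrM mulrCA ler_wpM2l//.
rewrite ge0_integralZl//.
- by rewrite lte_mul_pinfty ?lee_fin//; exact: locally_integrable_ge0.
- exact/measurable_EFinP.
Qed.

End test_functions.

(** * Smooth bump functions of one variable *)

Section bump_functions.
Context {R : realType}.
Implicit Types (P Q : {poly R}).

(** Coefficientwise, since y^i <= i! exp(y) for y >= 0. *)
Lemma poly_le_expR P : exists2 C, 0 <= C & forall y, 0 <= y -> `|P.[y]| <= C * expR y.
Proof.
exists (\sum_(i < size P) `|P`_i| * i`!%:R); first by apply: sumr_ge0 => i _; rewrite mulr_ge0.
move=> y y0; rewrite horner_coef mulr_suml (le_trans (ler_norm_sum _ _ _))//.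
apply: ler_sum => i _; rewrite normrM -mulrA ler_wpM2l// ger0_norm ?exprn_ge0//.
case: (nat_of_ord i) => [|n].
  by rewrite expr0 fact0 mul1r -expR0 ler_expR.
have := expR_ge1Dxn n y0.
have f0 : 0 < n.+1`!%:R :> R by rewrite ltr0n fact_gt0.
rewrite -ler_pdivrMl// mulrC => h; apply: le_trans h.
by rewrite lerDr.
Qed.

(* The functions P(1/x) exp(-1/x) on x > 0, extended by 0, are closed under
   differentiation. *)
Definition flat P (x : R) := if 0 < x then P.[x^-1] * expR (- x^-1) else 0.

(** The chain rule: the derivative of P(1/x) exp(-1/x) is x^(-2) (P - P')(1/x) exp(-1/x). *)
Definition flatD P : {poly R} := 'X^2 * (P - P^`()).

Lemma flat_le0 P x : x <= 0 -> flat P x = 0.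
Proof. by rewrite /flat ltNge => ->. Qed.

Lemma flatZ c P x : flat (c *: P) x = c * flat P x.
Proof. by rewrite /flat; case: ifP; rewrite ?mulr0// hornerZ mulrA. Qed.

(** The exponential bound is applied to P X^2, whose extra factor x^(-2) becomes x^2 on the right.
    Quadratic decay is what gives a zero derivative at the origin. *)
Lemma flat_quadratic P : exists2 C, 0 <= C & forall x, `|flat P x| <= C * x ^+ 2.
Proof.
have [C C0 PC] := poly_le_expR (P * 'X^2); exists C => // x.
rewrite /flat; case: ifPn => [x0|_]; last by rewrite normr0 mulr_ge0// sqr_ge0.
have y0 : 0 <= x^-1 by rewrite invr_ge0 ltW.
have := PC _ y0; rewrite hornerM hornerXn normrM (@ger0_norm _ (x^-1 ^+ 2)) ?exprn_ge0//.
rewrite normrM (@ger0_norm _ (expR _)) ?expR_ge0// expRN ler_pdivrMr ?expR_gt0//.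
move=> h; rewrite -mulrA [x ^+ 2 * _]mulrC mulrA -ler_pdivrMr ?exprn_gt0//.
by rewrite -exprVn.
Qed.

Lemma is_derive_flat P x : is_derive x (1 : R) (flat P) (flat (flatD P) x).
Proof.
have [x0|x0|<-] := ltgtP 0 x.
- have E : \forall y \near x, P.[y^-1] * expR (- y^-1) = flat P y.
    have : \forall y \near x, 0 < y by exact: lt_nbhsr.
    by apply: filterS => y y0; rewrite /flat y0.
  apply: (near_eq_is_derive E).
  have xn0 : x != 0 by rewrite gt_eqF.
  have dV : is_derive x (1 : R) (fun y => y^-1) (- x ^- 2 *: 1).
    by apply: (@is_deriveV _ id).
  have d1 := @is_derive1_comp _ (horner P) (fun y => y^-1) x _ _ (is_derive_poly P x^-1) dV.
  have d2 := @is_derive1_comp _ expR (fun y => - y^-1) x _ _ (is_derive_expR _) (is_deriveN dV).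
  have := is_deriveM d1 d2; move/is_derive_eq; apply.
  rewrite /flat x0 /flatD !hornerE /= /GRing.scale/= exprVn; ring.
- have E : \forall y \near x, cst 0 y = flat P y.
    have : \forall y \near x, y < 0 by exact: lt_nbhsl.
    by apply: filterS => y y0; rewrite flat_le0// ltW.
  apply: (near_eq_is_derive E).
  by rewrite flat_le0 ?(ltW x0)//; exact: is_derive_cst.
(* At the origin the quadratic bound makes the difference quotient at most C |h|. *)
- rewrite flat_le0//; have [C C0 PC] := flat_quadratic P.
  have h : (fun h : R => h^-1 *: ((flat P \o shift 0) (h *: (1 : R)) - flat P 0)) @ 0^' --> (0 : R).
    apply/cvgrPdist_lt => e e0; near=> h.
    rewrite sub0r normrN /= addr0 (flat_le0 P (lexx 0)) subr0 /GRing.scale/= mulr1.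
    have hn0 : h != 0 by near: h; exact: nbhs_dnbhs_neq.
    rewrite normrM normfV; apply: (@le_lt_trans _ _ (C * `|h|)).
      rewrite mulrC ler_pdivrMr ?normr_gt0// -mulrA -expr2 real_normK ?num_real//.
    have : `|h| < e / (C + 1).
      near: h; apply: dnbhs0_lt; rewrite divr_gt0// ltr_wpDl//.
    rewrite ltr_pdivlMr ?ltr_wpDl// => he; apply: le_lt_trans he.
    by rewrite mulrC ler_wpM2l// lerDl.
  split; first by apply/cvg_ex; exists 0.
  exact: (cvg_lim _ h).
Unshelve. all: by end_near. Qed.

(** A compactly supported smooth function presented with all its derivatives: [phi k] is the k-th
    derivative of [phi 0]. Carrying the sequence turns differentiation into an index shift. *)
Definition test_tower (phi : nat -> R -> R) :=
  (forall k x, is_derive x (1 : R) (phi k) (phi k.+1 x)) /\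
  exists2 M, 0 <= M & forall k x, M < `|x| -> phi k x = 0.

Section bump.
Variables (a b c : R).
Hypothesis c0 : 0 < c.

Definition bump_sum (s : seq ({poly R} * {poly R})) x :=
  \sum_(p <- s) flat p.1 (c * (x - a)) * flat p.2 (c * (b - x)).

(** The Leibniz rule on lists of factor pairs; c and -c are the derivatives of the two affine inner
    functions. *)
Definition bumpD (s : seq ({poly R} * {poly R})) : seq ({poly R} * {poly R}) :=
  flatten [seq [:: (c *: flatD p.1, p.2); (p.1, - c *: flatD p.2)] | p <- s].

Lemma is_derive_bump_sum s x : is_derive x (1 : R) (bump_sum s) (bump_sum (bumpD s) x).
Proof.
elim: s => [|p s IH].
  have -> : bump_sum [::] = cst 0 by apply/funext => y; rewrite /bump_sum big_nil.
  exact: is_derive_cst.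
have -> : bump_sum (p :: s) = (fun y => flat p.1 (c * (y - a))) * (fun y => flat p.2 (c * (b - y))) + bump_sum s.
  by apply/funext => y; rewrite /bump_sum big_cons.
have da : is_derive x (1 : R) (fun y => c * (y - a)) c.
  have := is_deriveZ c (is_deriveB (is_derive_id x (1 : R)) (is_derive_cst a x (1 : R))).
  by move/is_derive_eq; apply; rewrite subr0 /GRing.scale/= mulr1.
have db : is_derive x (1 : R) (fun y => c * (b - y)) (- c).
  have := is_deriveZ c (is_deriveB (is_derive_cst b x (1 : R)) (is_derive_id x (1 : R))).
  by move/is_derive_eq; apply; rewrite sub0r /GRing.scale/= mulrN1.
have d1 := @is_derive1_comp R (flat p.1) (fun y => c * (y - a)) x _ _ (is_derive_flat p.1 (c * (x - a))) da.
have d2 := @is_derive1_comp R (flat p.2) (fun y => c * (b - y)) x _ _ (is_derive_flat p.2 (c * (b - x))) db.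
have := is_deriveD (is_deriveM d1 d2) IH; move/is_derive_eq; apply.
rewrite /bump_sum /bumpD /= !big_cons /= !flatZ /GRing.scale/=; ring.
Qed.

(** The parameter c is a steepness: as it grows, the bump increases to the indicator of the open
    interval from a to b. *)
Definition bump k x := bump_sum (iter k bumpD [:: (1, 1)]) x.

Lemma bump_tower : test_tower bump.
Proof.
split; first by move=> k x; exact: is_derive_bump_sum.
exists (`|a| + `|b|); first by rewrite addr_ge0.
move=> k x xM; rewrite /bump /bump_sum big1// => p _.
have [xa|ax] := leP x a.
  by rewrite flat_le0 ?mul0r// mulr_ge0_le0 ?(ltW c0)// subr_le0.
rewrite [X in _ * X]flat_le0 ?mulr0// mulr_ge0_le0 ?(ltW c0)// subr_le0.
have : - `|a| <= a by rewrite lerNl -normrN ler_norm.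
have := ler_norm b; have := normr_ge0 a; have := normr_ge0 b.
move: xM; case: (ltP x 0) => x0; [rewrite (ltr0_norm x0)|rewrite (ger0_norm x0)]; lra.
Qed.

Lemma bump0E x : bump 0 x = flat 1 (c * (x - a)) * flat 1 (c * (b - x)).
Proof. by rewrite /bump /= /bump_sum big_seq1. Qed.

End bump.

Lemma flat1_itv x : 0 <= flat 1 x <= 1.
Proof.
rewrite /flat; case: ifPn => [x0|_]; last by rewrite lexx ler01.
by rewrite hornerC mul1r expR_ge0/= expR_le1 oppr_le0 invr_ge0 ltW.
Qed.

Lemma flat1_cvg x : flat 1 (n.+1%:R * x) @[n --> \oo] --> ((0 < x)%R%:R : R).
Proof.
have [x0|x0] := ltP 0 x; last first.
  rewrite (_ : (fun n : nat => _) = cst 0); first exact: cvg_cst.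
  by apply/funext => n; rewrite flat_le0// mulr_ge0_le0.
have -> : (fun n : nat => flat 1 (n.+1%:R * x)) = (fun n : nat => expR (- (x^-1 * n.+1%:R^-1))).
  apply/funext => n; rewrite /flat mulr_gt0// hornerC mul1r invfM mulrC//.
have : (- (x^-1 * n.+1%:R^-1)) @[n --> \oo] --> (0 : R).
  have h : (fun n : nat => x^-1 * n.+1%:R^-1) @ \oo --> x^-1 * 0.
    by apply: cvgMr; exact: cvg_harmonic.
  by rewrite -oppr0; apply: cvgN; rewrite mulr0 in h.
by move=> /(continuous_cvg _ (@continuous_expR R 0)); rewrite expR0.
Qed.

Lemma test_tower_continuous phi k : test_tower phi -> continuous (phi k).
Proof.
move=> [D _] x; apply: differentiable_continuous; apply/derivable1_diffP.
by have [] := D k x.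
Qed.

Lemma test_tower_FTC phi (M : R) : test_tower phi ->
  [/\ forall k, (@lebesgue_measure R).-integrable setT (EFin \o phi k),
      forall k, \int[lebesgue_measure]_s phi k.+1 s = 0 &
      forall k t, \int[lebesgue_measure]_s ((s <= t)%R%:R * phi k.+1 s) = phi k t].
Proof.
move=> tphi; have cphi k := @test_tower_continuous phi k tphi.
case: tphi => D [N N0 phiN].
have F k := FTC_support (D k) (cphi k.+1) (phiN k) (phiN k.+1).
split => [[|k]|k|k]; try by have [] := F k.
have [+ _ _] := F 0; move=> _.
have : (@lebesgue_measure R).-integrable `[- (N + 1), N + 1] (EFin \o phi 0%N).
  apply: continuous_compact_integrable; first exact: segment_compact.
  exact: continuous_subspaceT.
move/integrable_mkcond => /(_ (measurable_itv _)); apply: eq_integrable => // x _.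
rewrite patchE; case: ifPn => //; rewrite notin_setE/= in_itv/= -ler_norml => /negP.
rewrite -ltNge => xN; rewrite /= phiN//.
by apply: lt_trans xN; rewrite ltrDl.
Qed.

End bump_functions.

Section product_test_functions.
Context {R : realType} {d : nat}.
Implicit Types (phi : 'I_d -> nat -> R -> R) (k : 'I_d -> nat) (l : nat).

(** [k] is a multi-index of orders of differentiation, so every partial derivative of a product is
    again a [prodf]. *)
Definition prodf phi k (x : 'rV[R]_d) : R := \prod_i phi i (k i) (x ord0 i).

Lemma derive_upd (v : 'rV[R]_d -> R) (x : 'rV[R]_d) j s (D : R) :
  is_derive s (1 : R) (fun r => v (upd x j r)) D ->
  derivable v (upd x j s) (delta_mx ord0 j) /\ partial j v (upd x j s) = D.
Proof.
move=> [dv vD].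
have E : (fun h : R => h^-1 *: (((fun r => v (upd x j r)) \o shift s) (h *: (1 : R)) - v (upd x j s))) =
   (fun h => h^-1 *: ((v \o shift (upd x j s)) (h *: delta_mx ord0 j) - v (upd x j s))).
  by apply/funext => h; rewrite /= /GRing.scale/= mulr1 upd_shift.
split; first by move: dv; rewrite /derivable E.
by rewrite -vD /partial /derive E.
Qed.

Lemma partial_prodf phi k j : (forall i, test_tower (phi i)) ->
  (forall x, derivable (prodf phi k) x (delta_mx ord0 j)) /\
  partial j (prodf phi k) = prodf phi (fun i => (j == i) + k i)%N.
Proof.
move=> tphi.
have D x : derivable (prodf phi k) x (delta_mx ord0 j) /\
    partial j (prodf phi k) x = prodf phi (fun i => (j == i) + k i)%N x.
  rewrite -(updK x j); apply: derive_upd; rewrite updK.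
  pose c := \prod_(i | i != j) phi i (k i) (x ord0 i).
  have -> : (fun r : R => prodf phi k (upd x j r)) = (fun r => c * phi j (k j) r).
    apply/funext => r; rewrite /prodf (bigD1 j)//= mxE eqxx mulrC; congr (_ * _).
    by apply: eq_bigr => i ij; rewrite mxE (negbTE ij).
  have := is_deriveZ c ((tphi j).1 (k j) (x ord0 j)); move/is_derive_eq; apply.
  rewrite /prodf (bigD1 j)//= eqxx /GRing.scale/= mulrC; congr (_ * _).
  by apply: eq_bigr => i ij; rewrite eq_sym (negbTE ij).
by split; [move=> x; have [] := D x|apply/funext => x; have [] := D x].
Qed.

Lemma iter_partial_prodf phi k s : (forall i, test_tower (phi i)) ->
  iter_partial s (prodf phi k) = prodf phi (fun i => count_mem i s + k i)%N.
Proof.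
move=> tphi; elim: s => [|j s IH] /=; first by [].
rewrite IH (partial_prodf _ _ tphi).2; congr prodf; apply/funext => i.
by rewrite addnA.
Qed.

Lemma continuous_prod_coord (g : 'I_d -> R -> R) : (forall i, continuous (g i)) ->
  continuous (fun x : 'rV[R]_d => \prod_i g i (x ord0 i)).
Proof.
move=> cg; elim: (index_enum _) => [|i s IH] x.
  by under eq_fun do rewrite big_nil; exact: cst_continuous.
under eq_fun do rewrite big_cons.
apply: continuousM; last exact: IH.
apply: (@continuous_comp _ _ _ (fun x : 'rV[R]_d => x ord0 i) (g i)); last exact: cg.
exact: coord_continuous.
Qed.

Lemma tame_prodf phi k : (forall i, test_tower (phi i)) -> tame (prodf phi k).
Proof.
move=> tphi; split.
  move=> s; rewrite iter_partial_prodf//; split.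
    apply: (@continuous_prod_coord (fun i => phi i (count_mem i s + k i)%N)) => i.
    exact: test_tower_continuous.
  by move=> i; exact: (partial_prodf _ _ tphi).1.
have /choice[M MP] : forall i, exists M, 0 <= M /\ forall l x, M < `|x| -> phi i l x = 0.
  by move=> i; have [_ [M M0 h]] := tphi i; exists M.
exists (\sum_i M i); first by apply: sumr_ge0 => i _; have [] := MP i.
move=> x i xi; rewrite /prodf (bigD1 i)//= (MP i).2 ?mul0r//.
apply: le_lt_trans xi; rewrite (bigD1 i)//= lerDl sumr_ge0// => j _.
by have [] := MP j.
Qed.

Lemma mixed_partial_prodf phi (u : {set 'I_d}) k : (forall i, test_tower (phi i)) ->
  mixed_partial u (prodf phi k) = prodf phi (fun i => (i \in u) + k i)%N.
Proof.
move=> tphi; rewrite /mixed_partial iter_partial_prodf//; congr prodf.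
by apply/funext => i; rewrite count_uniq_mem ?enum_uniq// mem_enum.
Qed.

End product_test_functions.

(** * Fundamental lemma of the calculus of variations *)

Section fundamental_lemma.
Context {R : realType} {d : nat}.
Local Notation lam := (@lebesgue_rV R d).

Definition hbox (a : 'I_d -> R) : set 'rV[R]_d := box (fun i => `]a i, +oo[%classic).

Lemma measurable_hbox a : measurable (hbox a).
Proof. by apply: measurable_box => i; exact: measurable_itv. Qed.

(** A generating family stable under intersection whose members, cut by an open cube, are again open
    boxes, the sets on which the integral of F is known to vanish. *)
Definition hboxes : set (set 'rV[R]_d) := [set B | exists a, B = hbox a].

Lemma hboxes_generate : @measurable _ 'rV[R]_d = <<s hboxes >>.
Proof.
apply/seteqP; split; last first.
  apply: smallest_sub; first exact: sigma_algebra_measurable.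
  by move=> _ [a ->]; exact: measurable_hbox.
apply: smallest_sub; first exact: smallest_sigma_algebra.
move=> C [i [j [A [mA ->]]]]; rewrite (ord1 i).
pose T := g_sigma_algebraType hboxes.
have /(_ measurableT A mA) : measurable_fun (setT : set T) (fun x : T => (x : 'rV[R]_d) ord0 j).
  apply: (measurability _ (RGenOInfty.measurableE R)) => _ [_ [a ->] <-].
  have -> : setT `&` (fun x : T => (x : 'rV[R]_d) ord0 j) @^-1` `]a, +oo[ =
     \bigcup_n hbox (fun l => if l == j then a else - n%:R).
    apply/seteqP; split => x.
      move=> [_]; rewrite /= in_itv/= andbT => ax.
      exists (\max_(i < d) `|Num.ceil `|(x : 'rV[R]_d) ord0 i| |%N).+1 => // l.
      rewrite /= in_itv/= andbT; case: ifPn => [/eqP->//|_].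
      rewrite ltrNl; apply: le_lt_trans (ler_norm _) _; rewrite normrN.
      rewrite (le_lt_trans (Num.Theory.ceil_ge _))//.
      rewrite (le_lt_trans (ler_norm _))// -intr_norm -abszE ltr_nat ltnS.
      exact: (leq_bigmax l).
    move=> [n _ /(_ j)]; rewrite /= eqxx => ax; split => //.
  apply: bigcup_measurable => n _; apply: sub_sigma_algebra.
  by eexists.
by rewrite setTI.
Qed.

Variable F : 'rV[R]_d -> R.
Hypothesis lF : locally_integrable_rV F.
Hypothesis F0 : forall phi : 'I_d -> nat -> R -> R, (forall i, test_tower (phi i)) ->
  \int[lam]_x (F x * \prod_i phi i 0%N (x ord0 i)) = 0.

Let mF : measurable_fun setT F. Proof. exact: lF.1. Qed.

Definition obox (a b : 'I_d -> R) : set 'rV[R]_d := box (fun i => `]a i, b i[%classic).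

Let measurable_obox a b : measurable (obox a b).
Proof. by apply: measurable_box => i; exact: measurable_itv. Qed.

Let integrable_obox a b : lam.-integrable setT (fun x => (F x * \1_(obox a b) x)%:E).
Proof.
apply/integrable_EFinP; split; first by apply: measurable_funM => //; exact: measurable_indic.
pose M := \sum_i (`|a i| + `|b i|).
apply: le_lt_trans (locally_integrable_ge0 lF M).
apply: ge0_le_integral => //.
- apply/measurable_EFinP; apply: measurableT_comp => //.
  by apply: measurable_funM => //; exact: measurable_indic.
- apply/measurable_EFinP; apply: measurable_funM; first exact: measurableT_comp.
  by apply: measurable_indic; exact: measurable_cube.
move=> x _; rewrite lee_fin normrM ler_wpM2l// !indicE.
case: (boolP (x \in obox a b)) => [|_]; last by rewrite normr0.
rewrite inE => xab; rewrite mem_set ?normr1//; apply/cubeP => i.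
have := xab i; rewrite /= in_itv/= => /andP[ax xb].
have : `|a i| + `|b i| <= M.
  by rewrite /M (bigD1 i)//= lerDl sumr_ge0// => j _; rewrite addr_ge0.
apply: le_trans; have := ler_norm (b i); have := ler_norm (- a i); rewrite normrN.
have := normr_ge0 (a i); have := normr_ge0 (b i).
by case: (ltP (x ord0 i) 0) => x0; [rewrite (ltr0_norm x0)|rewrite (ger0_norm x0)]; lra.
Qed.

(** Products of bumps of steepness n + 1 converge pointwise to the indicator of the box and stay
    below it, so dominated convergence applies with |F| times that indicator. *)
Let obox0 a b : (\int[lam]_x (F x * \1_(obox a b) x)%:E = 0)%E.
Proof.
pose f n x := (F x * \prod_i bump (a i) (b i) n.+1%:R 0 (x ord0 i))%:E.
have fint n : (\int[lam]_x f n x = 0)%E.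
  have tw i : test_tower (bump (a i) (b i) n.+1%:R) by apply: bump_tower.
  rewrite -(EFin_Rintegral (f := fun x => F x * \prod_i bump (a i) (b i) n.+1%:R 0 (x ord0 i))).
    by rewrite (F0 tw).
  exact: (locally_integrable_tame lF (tame_prodf (fun=> 0%N) tw)).
have bumpE n i y : bump (a i) (b i) n.+1%:R 0 y =
    flat 1 (n.+1%:R * (y - a i)) * flat 1 (n.+1%:R * (b i - y)) by exact: bump0E.
have ind x : \1_(obox a b) x = \prod_i ((0 < x ord0 i - a i)%R%:R * (0 < b i - x ord0 i)%R%:R) :> R.
  rewrite indicE; case: (boolP (x \in obox a b)) => [|].
    rewrite inE => xab; rewrite big1// => i _; have := xab i.
    by rewrite /= in_itv/= !subr_gt0 => /andP[-> ->]; rewrite mulr1.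
  rewrite notin_setE => /existsNP[i]; rewrite /= in_itv/= => /negP xi.
  rewrite (bigD1 i)//= !subr_gt0; move: xi.
  by case: (a i < x ord0 i); case: (x ord0 i < b i); rewrite ?mulr0 ?mul0r.
have cv x : f ^~ x @ \oo --> (F x * \1_(obox a b) x)%:E.
  rewrite /f; apply/cvg_EFin; first by near=> n.
  rewrite /comp/=; apply: cvgMr; rewrite ind.
  elim: (index_enum _) => [|i s IH].
    under eq_fun do rewrite big_nil.
    by rewrite big_nil; exact: cvg_cst.
  under eq_fun do rewrite big_cons.
  rewrite big_cons; apply: cvgM => //.
  under eq_fun do rewrite bumpE.
  by apply: cvgM; exact: flat1_cvg.
have mf n : measurable_fun setT (f n).
  apply/measurable_EFinP; apply: measurable_funM => //.
  apply: (@measurable_prod_coord _ _ (fun i => bump (a i) (b i) n.+1%:R 0)) => i.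
  apply: continuous_measurable_fun; apply: test_tower_continuous.
  exact: bump_tower.
have [] := @dominated_convergence _ _ _ lam setT measurableT f
  (fun x => (F x * \1_(obox a b) x)%:E) (fun x => `|(F x * \1_(obox a b) x)%:E|%E) mf.
- by apply/measurable_EFinP; apply: measurable_funM => //; exact: measurable_indic.
- by apply: aeW => x _; exact: cv.
- by apply: integrable_abse; exact: integrable_obox.
- apply: aeW => x n _; rewrite /f /= lee_fin !normrM ler_wpM2l// normr_prod ind normr_prod.
  apply: ler_prod => i _; rewrite normr_ge0/= bumpE !normrM.
  have fl (y : R) : `|flat 1 (n.+1%:R * y)| <= `|(0 < y)%R%:R|.
    have [y0|y0] := ltP 0 y; last by rewrite flat_le0 ?normr0// mulr_ge0_le0.
    by rewrite normr1 ger0_norm; have /andP[] := flat1_itv (n.+1%:R * y).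
  by apply: ler_pM.
move=> _ _ /cvg_lim; under eq_fun do rewrite fint.
by move=> <- //; rewrite lim_cst.
Unshelve. all: by end_near. Qed.

(** Restricted to an open cube, F is integrable. The measurable sets on which its integral vanishes
    form a Dynkin class containing the orthants, hence are all measurable sets, so F is zero almost
    everywhere on each cube. *)
Lemma fundamental_lemma : {ae lam, forall x, F x = 0}.
Proof.
pose C (n : nat) := obox (fun=> - n%:R) (fun=> n%:R).
have aeC n : {ae lam, forall x, F x * \1_(C n) x = 0}.
  pose G x := (F x * \1_(C n) x)%:E.
  have iG : lam.-integrable setT G by exact: integrable_obox.
  have GT : (\int[lam]_x G x = 0)%E by exact: obox0.
  have GE S : measurable S -> (\int[lam]_(x in S) G x = 0)%E.
    move=> mS; move: (mS); rewrite hboxes_generate.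
    move: S {mS}; apply: (dynkin_induction (G := hboxes)).
    - exact: hboxes_generate.
    - move=> _ _ [a ->] [b ->]; exists (fun i => Num.max (a i) (b i)).
      apply/seteqP; split => [x [xa xb] i|x xab].
        by have := xa i; have := xb i; rewrite /= !in_itv/= !andbT gt_max => -> ->.
      by split=> i; have := xab i; rewrite /= !in_itv/= !andbT gt_max => /andP[].
    - exact: GT.
    - move=> _ [a ->].
      (* The lower corner max(a, -n) describes the intersection of the orthant with [C n]. *)
      have := obox0 (fun i => Num.max (a i) (- n%:R)) (fun=> n%:R); move=> <-.
      rewrite integral_mkcond; apply: eq_integral => x _; rewrite patchE /G.
      rewrite !indicE.
      have -> : (x \in obox (fun i => Num.max (a i) (- n%:R)) (fun=> n%:R)) =
                (x \in hbox a) && (x \in C n).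
        apply/idP/andP; rewrite !inE.
          move=> h; split=> i; have := h i; rewrite /= !in_itv/= ?andbT gt_max => /andP[/andP[] + +] //.
          by move=> ? -> ->.
        move=> [h1 h2] i; have := h1 i; have := h2 i; rewrite /= !in_itv/= ?andbT gt_max.
        by move=> /andP[-> ->] ->.
      by case: (x \in hbox a); rewrite ?mulr0.
    - move=> S mS S0.
      have : (\int[lam]_(x in S `|` ~` S) G x = \int[lam]_(x in S) G x + \int[lam]_(x in ~` S) G x)%E.
        apply: integral_setU => //; first exact: measurableC.
        + by rewrite setUv; have /integrableP[] := iG.
        + by apply/disj_setPS; rewrite setICr.
      by rewrite setUv GT S0 add0e => <-.
    - move=> S mS tS S0; rewrite integral_bigcup//.
        by apply: eseries0 => k _ _; exact: S0.
      by apply: integrableS iG => //; exact: bigcup_measurable.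
  have := @integral_ae_eq _ _ _ lam setT measurableT (cst 0%E) G iG (measurable_cst _).
  have h : forall E, E `<=` setT -> measurable E ->
      (\int[lam]_(x in E) G x = \int[lam]_(x in E) cst 0 x)%E.
    by move=> E _ mE; rewrite GE// integral0.
  by move=> /(_ h); apply: filterS => x /(_ I) [].
have := ae_foralln aeC.
apply: filterS => x Fx.
pose n := (\max_(i < d) `|Num.ceil `|x ord0 i| |%N).+1.
have := Fx n; rewrite indicE mem_set ?mulr1// => i.
rewrite /= in_itv/= -ltr_norml.
rewrite (le_lt_trans (Num.Theory.ceil_ge _))//.
rewrite (le_lt_trans (ler_norm _))// -intr_norm -abszE ltr_nat ltnS.
exact: (leq_bigmax i).
Qed.

End fundamental_lemma.

(** * Functions with prescribed inner integrals *)

Section coordinate_Fubini.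
Context {R : realType} {d : nat}.
Local Notation lam := (@lebesgue_rV R d).
Local Notation leb := (@lebesgue_measure R).
Local Notation upd := (@upd R d).

Definition exchange (j : 'I_d) (p : R * 'rV[R]_d) := (p.2 ord0 j, upd p.2 j p.1).

Lemma measurable_upd j : measurable_fun setT (fun p : R * 'rV[R]_d => upd p.2 j p.1).
Proof.
apply: measurable_fun_mxP => i l; under eq_fun do rewrite mxE.
by case: (l == j); [exact: measurable_fst|exact: measurable_fun_coord].
Qed.

Lemma measurable_exchange j : measurable_fun setT (exchange j).
Proof.
apply: measurable_fun_pair; last exact: measurable_upd.
exact: measurable_fun_coord.
Qed.

Lemma exchange_mpres j :
  measure_preserving (leb \x lam)%E (leb \x lam)%E (exchange j).
Proof.
have mpc : measure_preserving (leb \x lam)%E (@lebesgue_rV R d.+1) (@cons_rV R d \o exchange j).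
  apply: measure_preserving_box.
    apply: (measurableT_comp (@measurable_cons_rV R d)); exact: measurable_exchange.
  move=> A mA; pose B i := A (if i == j then ord0 else lift ord0 i).
  have mB : measurable (box B) by apply: measurable_box => i; exact: mA.
  transitivity ((leb \x lam)%E (A (lift ord0 j) `*` box B)).
    congr (product_measure1 _ _ _); apply/seteqP; split => -[r y] /=.
      move=> h; split.
        by have := h (lift ord0 j); rewrite cons_rVS/= mxE eqxx.
      move=> i; rewrite /B; case: eqP => [->|/eqP ij].
        by have := h ord0; rewrite cons_rV0.
      by have := h (lift ord0 i); rewrite cons_rVS/= mxE (negbTE ij).
    move=> [Ar By] i; case: (unliftP ord0 i) => [l|] ->.
      rewrite cons_rVS/= mxE; case: eqP => [->//|/eqP lj].
      by have := By l; rewrite /B (negbTE lj).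
    by rewrite cons_rV0/=; have := By j; rewrite /B eqxx.
  transitivity (leb (A (lift ord0 j)) * \prod_i leb (B i))%E.
    rewrite -(lebesgue_box (A := B)); last by move=> i; exact: mA.
    by apply: product_measure1E => //; exact: mA.
  rewrite big_ord_recl (bigD1 j)//= [RHS](_ : _ = leb (A ord0) * (leb (A (lift ord0 j)) *
     \prod_(i < d | i != j) leb (A (lift ord0 i))))%E; last by rewrite (bigD1 j).
  rewrite /B eqxx muleCA; congr (_ * (_ * _))%E.
  by apply: eq_bigr => i ij; rewrite (negbTE ij).
split; first exact: measurable_exchange.
move=> B mB.
pose B' : set 'rV[R]_d.+1 := @uncons_rV R d @^-1` B.
have mB' : measurable B'.
  by rewrite -[X in measurable X]setTI; apply: measurable_uncons_rV.
have -> : B = @cons_rV R d @^-1` B'.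
  by apply/seteqP; split => p; rewrite /B' /= cons_rVK.
rewrite (proj2 (@cons_rV_mpres R d))// -(proj2 mpc)//.
Qed.

Lemma integrable_tensor d1 d2 (X : measurableType d1) (Y : measurableType d2)
    (m1 : {sigma_finite_measure set X -> \bar R})
    (m2 : {sigma_finite_measure set Y -> \bar R}) (f : X -> R) (g : Y -> R) :
  m1.-integrable setT (EFin \o f) -> m2.-integrable setT (EFin \o g) ->
  (m1 \x m2)%E.-integrable setT (fun z => (f z.1 * g z.2)%:E).
Proof.
move=> /integrable_EFinP[mf foo] /integrable_EFinP[mg goo].
have mfg : measurable_fun setT (fun z : X * Y => f z.1 * g z.2).
  by apply: measurable_funM; apply: measurableT_comp.
apply/integrable12ltyP => /=; first exact/measurable_EFinP.
rewrite (eq_integral (fun x => `|f x|%:E * \int[m2]_y `|g y|%:E)%E).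
  rewrite ge0_integralZr//.
  - by rewrite lte_mul_pinfty ?integral_ge0// ge0_fin_numE ?integral_ge0.
  - by apply/measurable_EFinP; exact: measurableT_comp.
  - exact: integral_ge0.
move=> x _; rewrite -ge0_integralZl//=.
  by apply: eq_integral => y _; rewrite normrM EFinM.
by apply/measurable_EFinP; exact: measurableT_comp.
Qed.

(** Fubini in one coordinate without leaving R^d: the function r(s) G(y) is integrated before and
    after exchanging s with y_j. The old coordinate survives as a dummy of total mass 1. *)
Lemma coordinate_Fubini j (r : R -> R) (G : 'rV[R]_d -> R) :
  leb.-integrable setT (EFin \o r) -> \int[leb]_s r s = 1 ->
  lam.-integrable setT (EFin \o G) ->
  \int[lam]_y G y = \int[lam]_y (r (y ord0 j) * \int[leb]_s G (upd y j s)).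
Proof.
move=> ir r1 iG; have [mr _] := (integrable_EFinP _ _).1 ir.
have [mG _] := (integrable_EFinP _ _).1 iG.
have iT := integrable_tensor ir iG.
have mT : measurable_fun setT (fun z : R * 'rV[R]_d => r z.1 * G z.2).
  by apply: measurable_funM; apply: measurableT_comp.
have iE : (leb \x lam)%E.-integrable setT (fun z => (r (z.2 ord0 j) * G (upd z.2 j z.1))%:E).
  apply/(integrable_mpres (exchange_mpres j) (f := fun z => (r z.1 * G z.2)%:E)) => //.
  exact/measurable_EFinP.
have mGu y : measurable_fun setT (fun s => G (upd y j s)).
  by apply: (measurableT_comp mG); exact: (measurableT_comp (measurable_upd j) (pair2_measurable y)).
transitivity (\int[(leb \x lam)%E]_z (r z.1 * G z.2)).
  rewrite -[RHS](@Rintegral12 _ _ _ _ R leb lam (fun z => r z.1 * G z.2) iT)/=.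
  transitivity (\int[leb]_s (r s * \int[lam]_y G y)); first by rewrite RintegralZr// r1 mul1r.
  by apply: eq_Rintegral => s _; rewrite RintegralZl.
rewrite -(Rintegral_mpres (exchange_mpres j) mT)/=.
pose GE (z : R * 'rV[R]_d) := r (z.2 ord0 j) * G (upd z.2 j z.1).
rewrite -[LHS](@Rintegral12 _ _ _ _ R leb lam GE iE) (@RFubini _ _ _ _ R leb lam GE iE)/=.
have aei := ae_integrable2 iE.
rewrite /Rintegral; congr fine; apply: ae_eq_integral => //.
- by apply/measurable_EFinP; apply: (@measurable_Rintegral2 _ _ _ _ _ leb GE); have [] := (integrable_EFinP _ _).1 iE.
- apply/measurable_EFinP; apply: measurable_funM.
    by apply: measurableT_comp => //; exact: measurable_mx_coord.
  apply: (@measurable_Rintegral2 _ _ _ _ _ leb (fun z => G (upd z.2 j z.1))).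
  by apply: (measurableT_comp mG); exact: measurable_upd.
- apply: filterS aei => y /= iy _; congr EFin.
  (* Integrability of the section of G can be recovered only where the factor r is nonzero; where it
     vanishes, both sides are 0. *)
  have [r0|r0] := eqVneq (r (y ord0 j)) 0.
    rewrite r0 mul0r integral0_eq// => s _.
    by rewrite /GE/= r0 mul0r.
  have iGy : leb.-integrable setT (fun s => (G (upd y j s))%:E).
    have := integrableZl measurableT (r (y ord0 j))^-1 iy.
    apply: eq_integrable => // s _.
    by rewrite -EFinM mulrA mulVf// mul1r.
  by rewrite -[RHS](@RintegralZl _ _ _ leb setT (fun s => G (upd y j s))).
Qed.

End coordinate_Fubini.

Section section_integrals.
Context d d' (X : measurableType d) (Y : measurableType d') (R : realType).

Lemma ae_eq_integrable (m : {measure set X -> \bar R}) (f g : X -> R) :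
  measurable_fun setT g -> {ae m, forall x, f x = g x} ->
  m.-integrable setT (EFin \o f) ->
  m.-integrable setT (EFin \o g) /\ \int[m]_x f x = \int[m]_x g x.
Proof.
move=> mg fg /integrable_EFinP[mf foo]; split; last first.
  rewrite /Rintegral; congr fine; apply: ae_eq_integral => //; try exact/measurable_EFinP.
  by apply: filterS fg => x /= -> _.
apply/integrable_EFinP; split => //; rewrite (ae_eq_integral (EFin \o (fun x => `|f x|)))//.
- by apply/measurable_EFinP; exact: measurableT_comp.
- by apply/measurable_EFinP; exact: measurableT_comp.
- by apply: filterS fg => x /= -> _.
Qed.

Variables (m1 : {sigma_finite_measure set X -> \bar R})
  (m2 : {sigma_finite_measure set Y -> \bar R}).

(** Only the weighted function is known to be integrable. Almost everywhere, dividing by g x gives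
    integrability of the section of F if g x is nonzero, and both sides are 0 otherwise. *)
Lemma Rintegral_mul_section (F : X * Y -> R) (g : X -> R) :
  measurable_fun setT F -> measurable_fun setT g ->
  (m1 \x m2)%E.-integrable setT (fun z => (F z * g z.1)%:E) ->
  m1.-integrable setT (fun x => ((\int[m2]_y F (x, y)) * g x)%:E) /\
  \int[m1]_x ((\int[m2]_y F (x, y)) * g x) = \int[(m1 \x m2)%E]_z (F z * g z.1).
Proof.
move=> mF mg iFg.
pose G (z : X * Y) := F z * g z.1.
have iG1 : m1.-integrable setT (EFin \o (fun x => \int[m2]_y G (x, y))) := integrable_Rintegral1 iFg.
rewrite -(@Rintegral12 _ _ _ _ R m1 m2 G iFg).
have [] := @ae_eq_integrable m1 (fun x => \int[m2]_y G (x, y)) (fun x => (\int[m2]_y F (x, y)) * g x).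
- by apply: measurable_funM => //; exact: measurable_Rintegral1.
- have := ae_integrable1 iFg; apply: filterS => x /= ix.
  have [g0|g0] := eqVneq (g x) 0.
    by rewrite g0 mulr0 /Rintegral integral0_eq// => y _; rewrite /G /= g0 mulr0.
  rewrite -RintegralZr//.
  have := integrableZl measurableT (g x)^-1 ix.
  by apply: eq_integrable => // y _; rewrite /= -EFinM mulrC -mulrA mulfV// mulr1.
- exact: iG1.
by [].
Qed.

End section_integrals.

Lemma integrable_Rintegral2 d d' (X : measurableType d) (Y : measurableType d') (R : realType)
    (m1 : {sigma_finite_measure set X -> \bar R})
    (m2 : {sigma_finite_measure set Y -> \bar R}) (F : X * Y -> R) :
  (m1 \x m2)%E.-integrable setT (EFin \o F) ->
  m2.-integrable setT (fun y => (\int[m1]_x F (x, y))%:E).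
Proof.
move=> iF; have [mF _] := (integrable_EFinP _ _).1 iF.
apply/integrable_EFinP; split; first exact: measurable_Rintegral2.
have := (integrable21ltyP m1 m2 ((measurable_EFinP _ _).2 mF)).1 iF.
apply: le_lt_trans; apply: ge0_le_integral => //.
- by apply/measurable_EFinP/measurableT_comp => //; exact: measurable_Rintegral2.
- apply: (@measurable_fun_fubini_tonelli_G _ _ _ _ _ m1 (fun z => `|(F z)%:E|%E)) => //.
  by apply: measurableT_comp => //; exact/measurable_EFinP.
move=> y _; apply: (@le_trans _ _ `|\int[m1]_x (F (x, y))%:E|%E).
  by rewrite /Rintegral; case: (\int[m1]_x (F (x, y))%:E)%E => //=; rewrite normr0 leey.
apply: le_abse_integral => //; apply/measurable_EFinP.
exact: (measurableT_comp mF (pair2_measurable y)).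
Qed.

(** The unit cube has measure 1, so a null set is not the whole space. *)
Lemma ae_exists {R : realType} n (P : 'rV[R]_n -> Prop) :
  {ae lebesgue_rV n, forall x, P x} -> exists x, P x.
Proof.
move=> [N [mN N0 PN]]; apply: contrapT => /forallNP nP.
have NT : N = setT by apply/seteqP; split => // x _; apply: PN; exact: nP.
pose C : set 'rV[R]_n := box (fun=> `[0, 1]%classic).
have mC : measurable C by apply: measurable_box => i; exact: measurable_itv.
have : (lebesgue_rV n C <= lebesgue_rV n N)%E by apply: le_measure; rewrite ?inE// NT.
have -> : lebesgue_rV n C = 1%E.
  rewrite /C lebesgue_box; last by move=> i; exact: measurable_itv.
  by rewrite big1// => i _; rewrite lebesgue_measure_itv/= lte_fin ltr01 sube0.
by rewrite N0 leNgt lte_fin ltr01.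
Qed.

Section synthesis.
Context {R : realType} {d : nat}.
Local Notation lam := (@lebesgue_rV R d).
Local Notation leb := (@lebesgue_measure R).
Variables (rho psi : 'I_d -> R -> R).
Hypotheses (mrho : forall j, measurable_fun setT (rho j))
  (rho_gt0 : forall j x, 0 < rho j x)
  (rho1 : forall j, (\int[leb]_x (rho j x)%:E = 1)%E)
  (psi_gt0 : forall j x, 0 < psi j x)
  (psi_loc : forall j, locally_integrable setT (psi j))
  (psiV_loc : forall j, locally_integrable setT (fun x => (psi j x)^-1))
  (left_tail : forall j (c : R),
    (\int[leb]_(t in `]-oo, c]) (distr_fun (rho j) t ^+ 2 / psi j t)%:E < +oo)%E)
  (right_tail : forall j (c : R),
    (\int[leb]_(t in `[c, +oo[) ((1 - distr_fun (rho j) t) ^+ 2 / psi j t)%:E < +oo)%E).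
Implicit Types (u v : {set 'I_d}) (H : 'rV[R]_d -> R) (x y t : 'rV[R]_d).

Let mpsi j : measurable_fun setT (psi j). Proof. by have [] := psi_loc j. Qed.
Let irho j : leb.-integrable setT (EFin \o rho j).
Proof. exact: integrable_density. Qed.
Let rho_ge0 j s : 0 <= rho j s. Proof. exact: ltW. Qed.
Let psi_ge0 j s : 0 <= psi j s. Proof. exact: ltW. Qed.

Definition pw (g : 'I_d -> R -> R) x : R := \prod_i g i (x ord0 i).

Lemma pw_ge0 g x : (forall i s, 0 <= g i s) -> 0 <= pw g x.
Proof. by move=> g0; apply: prodr_ge0. Qed.

Lemma measurable_pw g : (forall i, measurable_fun setT (g i)) -> measurable_fun setT (pw g).
Proof. exact: measurable_prod_coord. Qed.

Definition split_weight v i := if i \in v then psi i else rho i.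

Let split_weight_gt0 v i s : 0 < split_weight v i s.
Proof. by rewrite /split_weight; case: ifP. Qed.

Let measurable_split_weight v i : measurable_fun setT (split_weight v i).
Proof. by rewrite /split_weight; case: ifP. Qed.

(** For H depending only on the coordinates in v this is square-integrability against psi_v, the
    remaining coordinates being dummies of mass 1. *)
Definition L2w v H := measurable_fun setT H /\
  (\int[lam]_x (H x ^+ 2 * pw (split_weight v) x)%:E < +oo)%E.

(** Cauchy-Schwarz in the pointwise form |H| b <= H^2 a + b^2 / a, with a the weight of [L2w] and b
    the product of the [B i]. The quotient b^2 / a is the product [q] of one-dimensional functions
    of finite integral. *)
Lemma L2w_pairing v H (B : 'I_d -> R -> R) : L2w v H ->
  (forall i s, 0 <= B i s) ->
  (forall i, i \in v -> sq_finite (psi i) (B i)) ->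
  (forall i, i \notin v -> B i = rho i) ->
  (\int[lam]_x (`|H x| * pw B x)%:E < +oo)%E.
Proof.
move=> [mH Hoo] B0 Bv Brho.
have mB i : measurable_fun setT (B i).
  by have [iv|iv] := boolP (i \in v); [have [] := Bv i iv|rewrite Brho].
pose q i s := B i s ^+ 2 / split_weight v i s.
have q0 i s : 0 <= q i s by rewrite /q divr_ge0// ?sqr_ge0// ltW.
have qrho i : i \notin v -> q i = rho i.
  move=> iv; apply/funext => s; rewrite /q /split_weight (negbTE iv) Brho//.
  by rewrite expr2 mulfK ?gt_eqF.
have mq i : measurable_fun setT (q i).
  have [iv|iv] := boolP (i \in v); last by rewrite qrho.
  apply: measurable_funM; first exact: measurable_funX.
  by rewrite /split_weight iv; have [] := psiV_loc i.
have qE x : pw q x = (pw B x) ^+ 2 / pw (split_weight v) x.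
  by rewrite /pw -prodrXl -prodf_div.
have A0 x : 0 < pw (split_weight v) x by apply: prodr_gt0.
have qoo : (\int[lam]_x (pw q x)%:E < +oo)%E.
  rewrite ge0_integral_prod//; apply: eprod_lty => i _.
    by apply: integral_ge0 => s _; rewrite lee_fin.
  have [iv|iv] := boolP (i \in v).
    by have [_] := Bv i iv; rewrite /q /split_weight iv.
  by rewrite qrho// rho1 ltry.
have mHA : measurable_fun setT (fun x => (H x ^+ 2 * pw (split_weight v) x)%:E).
  apply/measurable_EFinP; apply: measurable_funM; first exact: measurable_funX.
  exact: measurable_pw.
have mqq : measurable_fun setT (fun x => (pw q x)%:E).
  by apply/measurable_EFinP; exact: measurable_pw.
apply: (@le_lt_trans _ _ (\int[lam]_x ((H x ^+ 2 * pw (split_weight v) x)%:E + (pw q x)%:E))%E).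
  apply: ge0_le_integral => //.
  - by move=> x _; rewrite lee_fin mulr_ge0// pw_ge0.
  - apply/measurable_EFinP; apply: measurable_funM; first exact: measurableT_comp.
    exact: measurable_pw.
  - exact: emeasurable_funD.
  move=> x _; rewrite lee_fin qE.
  have a0 := A0 x; set a := pw (split_weight v) x in a0 *.
  have b0 : 0 <= pw B x by exact: pw_ge0.
  set b := pw B x in b0 *; rewrite -(real_normK (num_real (H x))).
  rewrite -lerBlDl -subr_ge0.
  have -> : b ^+ 2 / a - (`|H x| * b - `|H x| ^+ 2 * a) =
     a^-1 * (b ^+ 2 - `|H x| * a * b + (`|H x| * a) ^+ 2).
    by field; rewrite gt_eqF.
  apply: mulr_ge0; first by rewrite invr_ge0 ltW.
  have := sqr_ge0 (b - `|H x| * a).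
  have : 0 <= `|H x| * a by rewrite mulr_ge0// ltW.
  nra.
rewrite ge0_integralD//.
- by rewrite lte_add_pinfty.
- by move=> x _; rewrite lee_fin mulr_ge0 ?sqr_ge0// ltW.
- by move=> x _; rewrite lee_fin pw_ge0.
Qed.

Lemma mixK u x t : mix u (mix u t x) (mix u x t) = t.
Proof. by apply/rowP => i; rewrite !mxE; case: (i \in u). Qed.

(** The common source of absolute convergence: [k] majorises the kappa factors in t and [w] is a
    weight in y. Exchanging the u-coordinates of y and t makes the integrand a product of a function
    of each, the first controlled by [L2w_pairing] and the second by one-dimensional integrals. *)
Lemma key_bound u v H (k w : 'I_d -> R -> R) : u \subset v -> L2w v H ->
  (forall i s, 0 <= k i s) -> (forall i s, 0 <= w i s) ->
  (forall i, measurable_fun setT (w i)) ->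
  (forall i, sq_finite (psi i) (k i)) ->
  (forall i, i \in u -> sq_finite (psi i) (w i)) ->
  (forall i, i \notin u -> \int[leb]_s (w i s)%:E < +oo)%E ->
  (\int[(lam \x lam)%E]_z (`|H (mix u z.1 z.2)| *
     pw (fun i => if i \in v :\: u then k i else rho i) z.2 * pw w z.1)%:E < +oo)%E.
Proof.
move=> uv LH k0 w0 mw sk sw wu; have mH := LH.1.
set A := fun i => if i \in v :\: u then k i else rho i.
have A0 i s : 0 <= A i s by rewrite /A; case: ifP.
have mA i : measurable_fun setT (A i) by rewrite /A; case: ifP => _; [have [] := sk i|].
(* [B] collects the factors that go with H after the exchange, [C] those of the other variable. *)
pose B i := if i \in u then w i else A i.
pose C i := if i \in u then rho i else w i.
have B0 i s : 0 <= B i s by rewrite /B; case: ifP.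
have C0 i s : 0 <= C i s by rewrite /C; case: ifP.
have mB i : measurable_fun setT (B i) by rewrite /B; case: ifP.
have mC i : measurable_fun setT (C i) by rewrite /C; case: ifP.
have mF : measurable_fun setT (fun z : 'rV[R]_d * 'rV[R]_d =>
   (`|H (mix u z.1 z.2)| * pw A z.2 * pw w z.1)%:E).
  apply/measurable_EFinP; apply: measurable_funM; last first.
    by apply: measurableT_comp => //; exact: measurable_pw.
  apply: measurable_funM; last by apply: measurableT_comp => //; exact: measurable_pw.
  apply: measurableT_comp => //; apply: (measurableT_comp mH).
  exact: measurable_mix.
rewrite -(ge0_integral_mpres (swap_mpres u) mF); last first.
  by move=> z; rewrite lee_fin !mulr_ge0// pw_ge0.
under eq_integral => z _.
  rewrite /= mixK; have -> : (`|H z.2| * pw A (mix u z.1 z.2) * pw w (mix u z.2 z.1))%R =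
      (`|H z.2| * pw B z.2 * pw C z.1)%R.
    rewrite -!mulrA; congr (_ * _); rewrite /pw -!big_split/=; apply: eq_bigr => i _.
    rewrite /B /C !mxE; case: (boolP (i \in u)) => iu //.
    by rewrite /A inE iu/= mulrC.
  over.
have mHB : measurable_fun setT (fun x => (`|H x| * pw B x)%:E).
  apply/measurable_EFinP; apply: measurable_funM; first exact: measurableT_comp.
  exact: measurable_pw.
have mCC : measurable_fun setT (fun x => (pw C x)%:E).
  by apply/measurable_EFinP; exact: measurable_pw.
rewrite fubini_tonelli2//=.
- rewrite /fubini_G/=.
  under eq_integral => y _.
    under eq_integral do rewrite EFinM.
    rewrite ge0_integralZl//; last 2 first.
    + by move=> x _; rewrite lee_fin pw_ge0.
    + by rewrite lee_fin mulr_ge0// pw_ge0.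
    over.
  rewrite ge0_integralZr//; last 2 first.
  + by move=> x _; rewrite lee_fin mulr_ge0// pw_ge0.
  + by apply: integral_ge0 => x _; rewrite lee_fin pw_ge0.
  have Coo : (\int[lam]_x (pw C x)%:E < +oo)%E.
    rewrite ge0_integral_prod//; apply: eprod_lty => i _.
      by apply: integral_ge0 => s _; rewrite lee_fin.
    by rewrite /C; case: ifPn => iu; [rewrite rho1 ltry|exact: wu].
  have C0' : (0 <= \int[lam]_x (pw C x)%:E)%E.
    by apply: integral_ge0 => x _; rewrite lee_fin pw_ge0.
  rewrite lte_mul_pinfty//.
  + by apply: integral_ge0 => x _; rewrite lee_fin mulr_ge0// pw_ge0.
  + rewrite ge0_fin_numE; last by apply: integral_ge0 => x _; rewrite lee_fin mulr_ge0// pw_ge0.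
    apply: (L2w_pairing LH) => // i iv.
      rewrite /B /A; case: ifPn => iu; first exact: sw.
      by rewrite inE iu iv; exact: sk.
    rewrite /B /A; case: ifPn => [iu|iu]; first by rewrite (fintype.subsetP uv _ iu) in iv.
    by rewrite inE (negbTE iv) andbF.
- apply/measurable_EFinP; apply: measurable_funM; last first.
    by apply: measurableT_comp => //; exact: measurable_pw.
  apply: measurable_funM; last by apply: measurableT_comp => //; exact: measurable_pw.
  by apply: measurableT_comp => //; apply: (measurableT_comp mH).
- by move=> z; rewrite lee_fin !mulr_ge0// pw_ge0.
Qed.

Let sq_kappa_sup (M : R) i : 0 <= M -> sq_finite (psi i) (kappa_sup (rho i) M).
Proof. by move=> M0; apply: sq_finite_kappa_sup. Qed.

Let sq_indic (M : R) i : sq_finite (psi i) \1_`[- M, M].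
Proof. by apply: (@sq_finite_indic _ (rho i)). Qed.

Let sq_kappa_mass i : sq_finite (psi i) (kappa_mass (rho i)).
Proof. by apply: sq_finite_kappa_mass. Qed.

Let sq_small i : sq_finite (psi i) (small_weight (rho i) (psi i)).
Proof. by apply: sq_finite_small_weight. Qed.

(** Only the coordinates of t in v \ u carry kappa. Those in u are dummies because H takes them from
    y, those outside v because H is meant not to depend on them. *)
Definition ker v u t y : R := \prod_i
  if i \in v :\: u then kappa (rho i) (t ord0 i) (y ord0 i) else rho i (t ord0 i).

Definition synth_integrand v u H (z : 'rV[R]_d * 'rV[R]_d) :=
  H (mix u z.1 z.2) * ker v u z.2 z.1.

(* With H depending only on the coordinates in v, this is the mixed derivative
   in the directions u of [synth v finset.set0 H]. *)
Definition synth v u H y : R := \int[lam]_t synth_integrand v u H (y, t).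

Lemma measurable_ker v u : measurable_fun setT
  (fun z : 'rV[R]_d * 'rV[R]_d => ker v u z.2 z.1).
Proof.
apply: measurable_prod => i _; case: (i \in v :\: u); last first.
  apply: measurableT_comp => //; exact: measurable_fun_coord.
apply: (measurableT_comp (@measurable_kappa _ _ (mrho i) (rho_gt0 i) (rho1 i))
  (g := fun z : 'rV[R]_d * 'rV[R]_d => (z.2 ord0 i, z.1 ord0 i))).
by apply: measurable_fun_pair; exact: measurable_fun_coord.
Qed.

Lemma measurable_synth_integrand v u H : measurable_fun setT H ->
  measurable_fun setT (synth_integrand v u H).
Proof.
move=> mH; apply: measurable_funM; last exact: measurable_ker.
by apply: (measurableT_comp mH); exact: measurable_mix.
Qed.

Lemma measurable_synth v u H : measurable_fun setT H -> measurable_fun setT (synth v u H).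
Proof. by move=> mH; apply: measurable_Rintegral1; exact: measurable_synth_integrand. Qed.

(** [key_bound] with [k] the uniform bound on kappa over the cube containing the support of g, and
    [w] the indicator of [-M, M]. *)
Lemma integrable_synth_integrand u v H (g : 'rV[R]_d -> R) (C M : R) : u \subset v -> L2w v H ->
  measurable_fun setT g -> 0 <= C -> 0 <= M ->
  (forall y, `|g y| <= C * \1_(cube M) y) ->
  (lam \x lam)%E.-integrable setT (fun z => (synth_integrand v u H z * g z.1)%:E).
Proof.
move=> uv LH mg C0 M0 gC; have mH := LH.1.
pose k i := kappa_sup (rho i) M.
pose w (i : 'I_d) := \1_(`[- M, M] : set R) : R -> R.
have k0 i s : 0 <= k i s by apply: kappa_sup_ge0.
have mk i : measurable_fun setT (k i) by apply: measurable_kappa_sup.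
have w0 i s : 0 <= w i s by [].
have mw i : measurable_fun setT (w i) by apply: measurable_indic.
have wE y : pw w y = \1_(cube M) y.
  rewrite /pw /w [RHS]indicE; case: (boolP (y \in cube M)) => [|].
    by rewrite inE => yM; rewrite big1// => i _; rewrite indicE mem_set//; exact: (yM i).
  rewrite notin_setE => /existsNP[i yM]; rewrite (bigD1 i)//= indicE memNset ?mul0r//.
have wu i : i \notin u -> (\int[leb]_s (w i s)%:E < +oo)%E.
  move=> _; have /integrable_EFinP[_] := integrable_indic_itv (- M) M true false.
  by under eq_integral do rewrite ger0_norm//.
have := @key_bound u v H k w uv LH k0 w0 mw (fun i => sq_kappa_sup i M0) (fun i _ => sq_indic M i) wu.
pose A (i : 'I_d) := if i \in v :\: u then k i else rho i.
pose B (z : 'rV[R]_d * 'rV[R]_d) := (`|H (mix u z.1 z.2)| * pw A z.2 * pw w z.1)%:E.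
have A0 i s : 0 <= A i s by rewrite /A; case: ifP.
have mA i : measurable_fun setT (A i) by rewrite /A; case: ifP => _; [exact: mk|].
move=> h.
have mB : measurable_fun setT B.
  apply/measurable_EFinP; apply: measurable_funM; last first.
    by apply: measurableT_comp => //; exact: measurable_pw.
  apply: measurable_funM; last by apply: measurableT_comp => //; exact: measurable_pw.
  apply: measurableT_comp => //; apply: (measurableT_comp mH).
  exact: measurable_mix.
have mI : measurable_fun setT (fun z : 'rV[R]_d * 'rV[R]_d => synth_integrand v u H z * g z.1).
  apply: measurable_funM; first exact: measurable_synth_integrand.
  exact: measurableT_comp.
apply/integrable_EFinP; split => //.
apply: (@le_lt_trans _ _ (\int[(lam \x lam)%E]_z (C%:E * B z))%E); last first.
  rewrite ge0_integralZl//.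
    by rewrite lte_mul_pinfty ?lee_fin.
  by move=> z _; rewrite /B lee_fin !mulr_ge0// pw_ge0.
apply: ge0_le_integral => //.
- by apply/measurable_EFinP; exact: measurableT_comp.
- exact: emeasurable_funM.
move=> z _; rewrite /B -EFinM lee_fin normrM /synth_integrand normrM wE.
apply: (@le_trans _ _ (`|H (mix u z.1 z.2)| * `|ker v u z.2 z.1| * (C * \1_(cube M) z.1))).
  by rewrite ler_wpM2l// mulr_ge0.
rewrite mulrCA ler_wpM2l// indicE; case: (boolP (z.1 \in cube M)) => [|_]; last by rewrite !mulr0.
rewrite inE !mulr1 => /cubeP zM; rewrite ler_wpM2l// /ker normr_prod /pw.
apply: ler_prod => i _; rewrite normr_ge0/= /A; case: ifP => _.
  exact: normr_kappa_sup.
by rewrite ger0_norm.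
Qed.

Lemma locally_integrable_synth u v H : u \subset v -> L2w v H ->
  locally_integrable_rV (synth v u H).
Proof.
move=> uv LH; apply/locally_integrable_rVP; split; first exact: measurable_synth LH.1.
have h (M : R) : 0 <= M -> (\int[lam]_(x in cube M) `|synth v u H x|%:E < +oo)%E.
  move=> M0.
  have mg : measurable_fun setT (\1_(cube M) : 'rV[R]_d -> R).
    by apply: measurable_indic; exact: measurable_cube.
  have := @integrable_synth_integrand u v H _ 1 M uv LH mg ler01 M0.
  have gb (y : 'rV[R]_d) : `|\1_(cube M) y| <= 1 * \1_(cube M) y :> R by rewrite mul1r ger0_norm.
  move=> /(_ gb) /integrable_Rintegral1 /integrable_EFinP[_] h.
  apply: le_lt_trans h; rewrite le_eqVlt; apply/orP; left; apply/eqP.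
  rewrite [LHS]integral_mkcond; apply: eq_integral => y _.
  rewrite patchE; case: (boolP (y \in cube M)) => yM.
    by congr (`|_|%:E); apply: eq_Rintegral => t _; rewrite /= indicE yM mulr1.
  rewrite /Rintegral integral0_eq ?normr0// => t _.
  by rewrite /= indicE (negbTE yM) mulr0.
(* A cube of negative half-side lies in the one of half-side 0. *)
move=> M; have [M0|M0] := leP 0 M; first exact: h.
apply: le_lt_trans (h 0 (lexx 0)); apply: subset_ge0_integral; last by move=> x; rewrite lee_fin.
by move=> x /cubeP xM; apply/cubeP => i; rewrite (le_trans (xM i))// ltW.
Qed.

(* Pairing with a function of y after integrating out the coordinates in v \ u
   against [kappa]: the coordinates in u are frozen at t. *)
Definition test_ker v u t y : R := \prod_i
  if i \in u then rho i (y ord0 i)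
  else if i \in v then kappa (rho i) (t ord0 i) (y ord0 i) else 1.

Definition Lam v u (w : 'rV[R]_d -> R) t := \int[lam]_y (test_ker v u t y * w (mix u t y)).

Lemma integrable_Lam v u w t : tame w ->
  lam.-integrable setT (fun y => (test_ker v u t y * w (mix u t y))%:E).
Proof.
move=> tw; have [C [M [C0 M0 wC]]] := tame_le_cube tw.
pose g i := if i \in u then rho i else \1_(`[- M, M] : set R) : R -> R.
have ig i : leb.-integrable setT (EFin \o g i).
  rewrite /g; case: ifP => _ //; exact: integrable_indic_itv.
have := integrableZl measurableT C (integrable_prod ig).
have mw := tame_measurable tw.
have mk : measurable_fun setT (test_ker v u t).
  apply: measurable_prod => i _; case: (i \in u).
    by apply: measurableT_comp => //; exact: measurable_mx_coord.
  case: (i \in v) => //; apply: (measurableT_comp (measurable_kappa2 _ _ _ _)) => //.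
  exact: measurable_mx_coord.
have mm : measurable_fun setT (mix u t).
  by apply: (measurableT_comp (@measurable_mix R d u) (pair1_measurable t)).
apply: le_integrable => //.
  by apply/measurable_EFinP; apply: measurable_funM => //; exact: measurableT_comp.
move=> y _; rewrite /= lee_fin normrM [leRHS]ger0_norm; last first.
  by rewrite mulr_ge0// prodr_ge0// => i _; rewrite /g; case: ifP.
have k1 : `|test_ker v u t y| <= \prod_i (if i \in u then rho i (y ord0 i) else 1).
  rewrite normr_prod; apply: ler_prod => i _; rewrite normr_ge0/=.
  case: ifP => _; first by rewrite ger0_norm.
  by case: ifP => _; [exact: normr_kappa_le1|rewrite normr1].
apply: (@le_trans _ _ (\prod_i (if i \in u then rho i (y ord0 i) else 1) *
    (C * \1_(cube M) (mix u t y)))).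
  by apply: ler_pM.
rewrite mulrCA ler_wpM2l// indicE.
case: (boolP (mix u t y \in cube M)) => [|_]; last first.
  by rewrite mulr0 prodr_ge0// => i _; rewrite /g; case: ifP.
rewrite inE mulr1 => yM; apply: ler_prod => i _; rewrite /g.
have := yM i; rewrite !mxE; case: ifP => iu /=; first by rewrite lexx ltW.
by rewrite ler01/= indicE => yiM; rewrite mem_set.
Qed.

(** Integration by parts in the coordinate j, isolated with density rho_j. If j is in v, the
    derivative of kappa is the unit mass at t_j, which freezes that coordinate of w with a minus
    sign, and the dummy factor rho_j(y_j) is the one [test_ker] has for the enlarged set. If j is
    not in v, the kernel is constant in y_j and a compactly supported derivative integrates to 0. *)
Lemma Lam_partial v u w t j : tame w -> j \notin u ->
  Lam v u (partial j w) t = if j \in v then - Lam v (j |: u) w t else 0.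
Proof.
move=> tw ju; have tpw := tame_partial j tw.
have [sw [M M0 wM]] := tw.
have r1 : \int[leb]_s rho j s = 1 by exact: Rintegral_density.
rewrite /Lam (coordinate_Fubini j (irho j) r1 (integrable_Lam v u t tpw)).
pose A y := \prod_(i | i != j) if i \in u then rho i (y ord0 i)
  else if i \in v then kappa (rho i) (t ord0 i) (y ord0 i) else 1.
have kE y s : test_ker v u t (upd y j s) =
    (if j \in v then kappa (rho j) (t ord0 j) s else 1) * A y.
  rewrite /test_ker (bigD1 j)//= (negbTE ju) mxE eqxx; congr (_ * _).
  by apply: eq_bigr => i ij; rewrite mxE (negbTE ij).
have mE y s : mix u t (upd y j s) = upd (mix u t y) j s.
  apply/rowP => i; rewrite !mxE; case: (eqVneq i j) => [->|//].
  by rewrite (negbTE ju).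
have D y s : is_derive s (1 : R) (fun r => w (upd (mix u t y) j r)) (partial j w (upd (mix u t y) j s)).
  by apply: is_derive_upd; exact: smooth_derivable.
have cD y : continuous (fun s => partial j w (upd (mix u t y) j s)).
  move=> s; apply: (@continuous_comp _ _ _ (upd (mix u t y) j) (partial j w)).
    exact: continuous_upd.
  by apply: smooth_continuous; exact: smooth_partial.
have s0 y s : M < `|s| -> w (upd (mix u t y) j s) = 0.
  by move=> sM; apply: (wM _ j); rewrite mxE eqxx.
have ds0 y s : M < `|s| -> partial j w (upd (mix u t y) j s) = 0.
  by move=> sM; apply: (cube_supported_partial j sw wM (i := j)); rewrite mxE eqxx.
have F y := FTC_support (D y) (cD y) (s0 y) (ds0 y).
have [jv|jv] := boolP (j \in v); last first.
  rewrite /Rintegral integral0_eq// => y _.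
  congr EFin; apply/eqP; rewrite mulf_eq0; apply/orP; right; apply/eqP.
  rewrite [LHS](_ : _ = \int[leb]_s (A y * partial j w (upd (mix u t y) j s))).
    by have [iF F0 _] := F y; rewrite RintegralZl// F0 mulr0.
  by apply: eq_Rintegral => s _; rewrite kE mE (negbTE jv) mul1r.
rewrite -mulN1r -RintegralZl//; last exact: integrable_Lam.
apply: eq_Rintegral => y _.
transitivity (rho j (y ord0 j) * (A y * \int[leb]_s (kappa (rho j) (t ord0 j) s * partial j w (upd (mix u t y) j s)))).
  congr (_ * _); rewrite -RintegralZl//.
    by apply: eq_Rintegral => s _; rewrite kE mE jv mulrAC mulrC mulrA.
  have [iF _ _] := F y.
  apply: le_integrable (iF) => //.
    apply/measurable_EFinP; apply: measurable_funM; last by have [] := (integrable_EFinP _ _).1 iF.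
    exact: measurable_kappa2.
  move=> s _; rewrite /= lee_fin normrM ler_piMl//.
  exact: normr_kappa_le1.
have -> : \int[leb]_s (kappa (rho j) (t ord0 j) s * partial j w (upd (mix u t y) j s)) =
    - w (upd (mix u t y) j (t ord0 j)).
  exact: (Rintegral_kappa_deriv _ (D y) (cD y) (s0 y) (ds0 y)).
have -> : upd (mix u t y) j (t ord0 j) = mix (j |: u) t y.
  by apply/rowP => i; rewrite !mxE !inE; case: (eqVneq i j) => [->|].
rewrite mulN1r !mulrN mulrA; congr (- (_ * _)).
rewrite /test_ker [RHS](bigD1 j)//= !inE eqxx/=; congr (_ * _).
by apply: eq_bigr => i ij; rewrite !inE (negbTE ij).
Qed.

Lemma Lam_iter v u w t (s : seq 'I_d) : tame w -> uniq s ->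
  (forall j, j \in s -> j \notin u) ->
  Lam v u (iter_partial s w) t =
  if all (mem v) s then (-1) ^+ size s * Lam v (u :|: [set j in s]) w t else 0.
Proof.
move=> tw; elim: s u => [|j s IH] u /=.
  by move=> _ _; rewrite mul1r; congr Lam; apply/setP => i; rewrite !inE orbF.
move=> /andP[js us] su.
have tsw : tame (iter_partial s w).
  by elim: (s) => // i r tr; exact: tame_partial.
rewrite Lam_partial//; last by apply: su; rewrite inE eqxx.
case: ifP => //= jv; rewrite IH//; last first.
  move=> i si; rewrite !inE negb_or su ?andbT; last by rewrite inE si orbT.
  by apply: contraNneq js => <-.
case: ifP => _; last by rewrite oppr0.
rewrite exprS mulN1r mulNr; congr (- (_ * _)).
suff -> : (j |: u) :|: [set i in s] = u :|: [set i in j :: s] by [].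
by apply/setP => i; rewrite !inE; case: (i == j); case: (i \in u); case: (i \in s).
Qed.

(** Exchanging the u-coordinates of y and t turns [H (mix u y t)] into H t; y is left only in the
    kernel and the test function, and integrating it out gives [Lam]. *)
Lemma synth_pairing u v H w : u \subset v -> L2w v H -> tame w ->
  let c t := H t * \prod_(i | i \notin v) rho i (t ord0 i) in
  lam.-integrable setT (fun t => (c t * Lam v u w t)%:E) /\
  \int[lam]_y (synth v u H y * w y) = \int[lam]_t (c t * Lam v u w t).
Proof.
move=> uv LH tw c; have [C [M [C0 M0 wC]]] := tame_le_cube tw.
have mw := tame_measurable tw; have mH := LH.1.
have iJ := integrable_synth_integrand uv LH mw C0 M0 wC.
pose J (z : 'rV[R]_d * 'rV[R]_d) := synth_integrand v u H z * w z.1.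
have mJ : measurable_fun setT J by have [] := (integrable_EFinP _ _).1 iJ.
have [_ ->] := Rintegral_mul_section (measurable_synth_integrand v u mH) mw iJ.
rewrite -[\int[_]_z _](Rintegral_mpres (swap_mpres u) mJ).
have iJs : (lam \x lam)%E.-integrable setT (EFin \o (fun z => J (swap u z))).
  apply/(integrable_mpres (swap_mpres u) (f := EFin \o J)) => //.
  exact/measurable_EFinP.
have JE z : J (swap u z) = c z.2 * (test_ker v u z.2 z.1 * w (mix u z.2 z.1)).
  rewrite /J /synth_integrand /swap/= mixK mulrA; congr (_ * _); rewrite /c -mulrA; congr (_ * _).
  rewrite /ker /test_ker (big_mkcond (fun i => i \notin v))/= -big_split/=.
  apply: eq_bigr => i _; rewrite !inE !mxE.
  case: (boolP (i \in u)) => iu /=; first by rewrite (fintype.subsetP uv _ iu)/= mul1r.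
  by case: (i \in v); rewrite ?mul1r ?mulr1.
have LE t : \int[lam]_y J (swap u (y, t)) = c t * Lam v u w t.
  under eq_Rintegral do rewrite JE/=.
  by rewrite RintegralZl//; exact: integrable_Lam.
split.
  by have := integrable_Rintegral2 iJs; apply: eq_integrable => // t _; rewrite /= LE.
rewrite -(@Rintegral12 _ _ _ _ R lam lam _ iJs) (RFubini iJs)/=.
by apply: eq_Rintegral => t _; rewrite LE.
Qed.

Lemma locally_integrable_cst0 : locally_integrable_rV (cst 0 : 'rV[R]_d -> R).
Proof.
apply/locally_integrable_rVP; split; first exact: measurable_cst.
by move=> M; rewrite integral0_eq ?ltry// => x _; rewrite normr0.
Qed.

(** Both sides of the defining identity are pairings with the same coefficient in t. Differentiating
    w in the directions u amounts to freezing those coordinates in [Lam], with sign (-1)^|u|, and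
    yields 0 as soon as one direction lies outside v. *)
Lemma is_weak_derivative_synth u v H : L2w v H ->
  is_weak_derivative u (synth v finset.set0 H) (if u \subset v then synth v u H else cst 0).
Proof.
move=> LH; split.
  case: ifP => uv; last exact: locally_integrable_cst0.
  exact: locally_integrable_synth.
move=> w /test_function_tame tw.
have tuw : tame (mixed_partial u w).
  by rewrite /mixed_partial; elim: (enum u) => // i r tr; exact: tame_partial.
have [_ ->] := synth_pairing (finset.sub0set v) LH tuw.
have LE t : Lam v finset.set0 (mixed_partial u w) t =
    if u \subset v then (-1) ^+ #|u| * Lam v u w t else 0.
  rewrite /mixed_partial Lam_iter ?enum_uniq//; last by move=> j; rewrite inE.
  have -> : all (mem v) (enum u) = (u \subset v).
    apply/allP/fintype.subsetP => h i; last by rewrite mem_enum => /h.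
    by move=> iu; apply: h; rewrite mem_enum.
  rewrite cardE; case: ifP => // _; congr (_ * _).
  suff -> : finset.set0 :|: [set j in enum u] = u by [].
  by apply/setP => i; rewrite !inE mem_enum.
under [in RHS]eq_Rintegral do rewrite LE.
case: ifP => uv; last first.
  rewrite /Rintegral !integral0_eq ?mulr0// => y _; first by rewrite mulr0.
  by rewrite mul0r.
have [ic ->] := synth_pairing uv LH tw.
under [in RHS]eq_Rintegral do rewrite mulrCA.
(* The sign of the definition and that of the integrations by parts cancel. *)
rewrite RintegralZl// mulrA -exprD addnn -mul2n exprM sqrrN expr1n expr1n mul1r//.
Qed.

Definition depends_on v H := forall x t, H (mix v x t) = H x.

Let rho_int j : \int[leb]_s rho j s = 1. Proof. exact: Rintegral_density. Qed.

Lemma Rintegral_pw_density : \int[lam]_t pw rho t = 1.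
Proof. by rewrite Rintegral_prod// big1. Qed.

Lemma synth_full v H : depends_on v H -> synth v v H = H.
Proof.
move=> dH; apply/funext => y; rewrite /synth.
rewrite [LHS](_ : _ = \int[lam]_t (H y * pw rho t)).
  by rewrite RintegralZl ?Rintegral_pw_density ?mulr1//; exact: integrable_prod.
apply: eq_Rintegral => t _; rewrite /synth_integrand/= dH; congr (_ * _).
by apply: eq_bigr => i _; rewrite finset.setDv inE.
Qed.

Lemma mix_glue u (a : 'rV[R]_#|u|) (b : 'rV[R]_#|~: u|) t :
  mix u (Defs.glue a b) t = mix u (Defs.glue a 0) t.
Proof.
apply/rowP => i; rewrite [LHS]mxE [RHS]mxE; case: (boolP (i \in u)) => // iu.
have -> : i = enum_val (enum_rank_in iu i) by rewrite enum_rankK_in.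
by rewrite !glue_in.
Qed.

Lemma measurable_prod_weight (g : 'I_d -> R -> R) u : (forall i, measurable_fun setT (g i)) ->
  measurable_fun setT (@prod_weight R d g u).
Proof.
by move=> mg; apply: (@measurable_prod_coord _ _ (fun k => g (enum_val k))).
Qed.

Lemma integrable_prod_weight u :
  (lebesgue_rV #|u|).-integrable setT (fun a => (prod_weight rho a)%:E).
Proof. by apply: (@integrable_prod _ _ (fun k => rho (enum_val k))). Qed.

Lemma Rintegral_prod_weight u : \int[lebesgue_rV #|u|]_a prod_weight rho a = 1.
Proof. by rewrite (@Rintegral_prod _ _ (fun k => rho (enum_val k)))// big1. Qed.

(** If v = u, only the mass of rho is left. Otherwise a coordinate j0 of v \ u is among those
    integrated, and its factor int kappa rho is 0. The work lies in the absolute convergence that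
    permits exchanging the integrals for almost every a. *)
Lemma synth_inner u v H : u \subset v -> L2w v H -> depends_on v H ->
  {ae lebesgue_rV #|u|, forall a : 'rV[R]_#|u|,
    (lebesgue_rV #|~: u|).-integrable setT
      (fun b => (synth v u H (Defs.glue a b) * prod_weight rho b)%:E) /\
    \int[lebesgue_rV #|~: u|]_b (synth v u H (Defs.glue a b) * prod_weight rho b) =
    if v == u then H (Defs.glue a 0) else 0}.
Proof.
move=> uv LH dH; have mH := LH.1.
case: eqVneq => [vu|vu].
  rewrite vu in LH dH *; apply: aeW => a; rewrite (synth_full dH).
  have HE b : H (Defs.glue a b) = H (Defs.glue a 0).
    by rewrite -(dH (Defs.glue a b) 0) mix_glue dH.
  under eq_fun do rewrite HE; under eq_Rintegral do rewrite HE.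
  split; first exact: (integrableZl _ (H (Defs.glue a 0)) (integrable_prod_weight (~: u))).
  by rewrite RintegralZl// ?Rintegral_prod_weight ?mulr1//; exact: integrable_prod_weight.
have [j0 j0vu] : exists j, j \in v :\: u.
  apply/set0Pn; apply: contra vu => /eqP vu0; rewrite finset.eqEsubset uv andbT.
  by rewrite -finset.setD_eq0 vu0.
(* The integrated coordinates run over the whole line, so |kappa| is measured by its mean against
   rho rather than by a supremum. *)
pose k i := kappa_mass (rho i).
(* Strict positivity of this weight allows dividing by it in [ae_good]. *)
pose w i := if i \in u then small_weight (rho i) (psi i) else rho i.
pose A i := if i \in v :\: u then k i else rho i.
have k0 i s : 0 <= k i s.
  have P0 : 0 <= distr_fun (rho i) s by apply: distr_fun_ge0.
  have P1 : distr_fun (rho i) s <= 1 by apply: distr_fun_le1.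
  by rewrite /k /kappa_mass; nra.
have mk i : measurable_fun setT (k i) by have [] := sq_kappa_mass i.
have w_gt0 i s : 0 < w i s by rewrite /w; case: ifP => // _; exact: small_weight_gt0.
have mw i : measurable_fun setT (w i).
  by rewrite /w; case: ifP => // _; have [] := sq_small i.
have A0 i s : 0 <= A i s by rewrite /A; case: ifP.
have mA i : measurable_fun setT (A i) by rewrite /A; case: ifP.
have KB : (\int[(lam \x lam)%E]_z (`|H (mix u z.1 z.2)| * pw A z.2 * pw w z.1)%:E < +oo)%E.
  apply: (@key_bound u v H k w) => // [i s|i iu|i iu].
  - exact: ltW.
  - by rewrite /w iu.
  - by rewrite /w (negbTE iu) rho1 ltry.
pose good x := lam.-integrable setT (fun t => (`|H (mix u x t)| * pw A t)%:E).
have mHA : measurable_fun setT (fun z : 'rV[R]_d * 'rV[R]_d => `|H (mix u z.1 z.2)| * pw A z.2).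
  apply: measurable_funM; last by apply: measurableT_comp => //; exact: measurable_pw.
  by apply: measurableT_comp => //; apply: (measurableT_comp mH); exact: measurable_mix.
have iKB : (lam \x lam)%E.-integrable setT
    (fun z => (`|H (mix u z.1 z.2)| * pw A z.2 * pw w z.1)%:E).
  apply/integrable_EFinP; split.
    apply: measurable_funM => //; apply: measurableT_comp => //; exact: measurable_pw.
  under eq_integral => z _.
    rewrite ger0_norm; last by rewrite !mulr_ge0// pw_ge0// => i s; exact: ltW.
    over.
  exact: KB.
have ae_good : {ae lam, forall x, good x}.
  have := ae_integrable1 iKB; apply: filterS => x /= ix.
  have wx : 0 < pw w x by apply: prodr_gt0.
  have := integrableZl measurableT (pw w x)^-1 ix; apply: eq_integrable => // t _.
  by rewrite /= -EFinM mulrC mulfK// gt_eqF.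
have := ae_product_section (ae_mpres (glue_mpres u) ae_good).
(* By [mix_glue] the condition at [glue a b] depends on a alone, so a single b0 is enough. *)
apply: filterS => a /= /ae_exists[b0]; rewrite /good.
under eq_fun do rewrite mix_glue.
move=> igood.
pose F (z : 'rV[R]_#|~: u| * 'rV[R]_d) := synth_integrand v u H (Defs.glue a z.1, z.2).
pose g (b : 'rV[R]_#|~: u|) := prod_weight rho b.
pose Ha t := H (mix u (Defs.glue a 0) t) * \prod_(l < #|u|) rho (enum_val l) (t ord0 (enum_val l)).
pose m t (l : 'I_#|~: u|) s :=
  (if enum_val l \in v then kappa (rho (enum_val l)) (t ord0 (enum_val l)) s
   else rho (enum_val l) (t ord0 (enum_val l))) * rho (enum_val l) s.
have FE z : F z * g z.1 = Ha z.2 * \prod_l m z.2 l (z.1 ord0 l).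
  rewrite /F /synth_integrand/= mix_glue /Ha -!mulrA; congr (_ * _).
  rewrite /ker (prod_setC u) -!mulrA; congr (_ * _).
    by apply: eq_bigr => l _; rewrite inE enum_valP.
  rewrite /g /prod_weight -big_split/=; apply: eq_bigr => l _.
  by have := enum_valP l; rewrite !inE => ->; rewrite /m glue_out.
have mg : measurable_fun setT g by exact: measurable_prod_weight.
have mF : measurable_fun setT F.
  apply: (measurableT_comp (measurable_synth_integrand v u mH)
    (g := fun z : 'rV[R]_#|~: u| * 'rV[R]_d => (Defs.glue a z.1, z.2))).
  apply: measurable_fun_pair => //.
  apply: (measurableT_comp (@measurable_glue R d u) (g := fun z : 'rV[R]_#|~: u| * 'rV[R]_d => (a, z.1))).
  exact: measurable_fun_pair.
have im t l : leb.-integrable setT (EFin \o m t l).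
  rewrite /m; case: (enum_val l \in v); first exact: integrable_kappa_density.
  exact: (integrableZl _ (rho (enum_val l) (t ord0 (enum_val l))) (irho (enum_val l))).
(* The absolute integrals over b reproduce the factors [A], so [igood] is exactly the Tonelli
   condition for [iFg]. *)
have absm t l : (\int[leb]_s `|m t l s|%:E = (A (enum_val l) (t ord0 (enum_val l)))%:E)%E.
  rewrite /m /A; have := enum_valP l; rewrite !inE => ->/=; case: (enum_val l \in v).
    rewrite -integral_kappa_mass//; apply: eq_integral => s _.
    by rewrite normrM (ger0_norm (rho_ge0 _ _)).
  under eq_integral do rewrite ger0_norm ?mulr_ge0// EFinM.
  rewrite ge0_integralZl ?rho1 ?mule1//; last by rewrite lee_fin.
    by apply/measurable_EFinP; exact: mrho.
  by move=> s _; rewrite lee_fin.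
have iFg : (lebesgue_rV #|~: u| \x lam)%E.-integrable setT (fun z => (F z * g z.1)%:E).
  apply/integrable21ltyP.
    by apply/measurable_EFinP; apply: measurable_funM => //; exact: measurableT_comp.
  have [_] := (integrable_EFinP _ _).1 igood; congr (_ < _)%E.
  apply: eq_integral => t _; rewrite normrM normr_id (ger0_norm (pw_ge0 _ A0)).
  under [in RHS]eq_integral => b _ do rewrite /= FE/= normrM normr_prod EFinM.
  rewrite ge0_integralZl//; last 2 first.
  - apply/measurable_EFinP; apply: (@measurable_prod_coord _ _ (fun l s => `|m t l s|)) => l.
    by apply: measurableT_comp => //; have [] := (integrable_EFinP _ _).1 (im t l).
  - by move=> b _; rewrite lee_fin prodr_ge0.
  rewrite (@ge0_integral_prod _ _ (fun l s => `|m t l s|))//; last first.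
    by move=> l; apply: measurableT_comp => //; have [] := (integrable_EFinP _ _).1 (im t l).
  rewrite (eq_bigr (fun l => (A (enum_val l) (t ord0 (enum_val l)))%:E))//.
  rewrite prodEFin -EFinM; congr EFin; rewrite /Ha normrM -mulrA; congr (_ * _).
  rewrite /pw (prod_setC u) normr_prod; congr (_ * _); apply: eq_bigr => l _.
  by rewrite /A inE enum_valP/= ger0_norm.
have [iS SE] := Rintegral_mul_section mF mg iFg.
split; first exact: iS.
rewrite [LHS]SE -(@Rintegral12 _ _ _ _ R (lebesgue_rV #|~: u|) lam _ iFg).
rewrite (@RFubini _ _ _ _ R (lebesgue_rV #|~: u|) lam _ iFg).
rewrite {1}/Rintegral integral0_eq// => t _; congr EFin.
under eq_Rintegral do rewrite FE/=.
rewrite RintegralZl//; last exact: integrable_prod.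
rewrite Rintegral_prod//.
have j0u : j0 \in ~: u by move: j0vu; rewrite !inE => /andP[].
pose l0 := enum_rank_in j0u j0.
have E0 : \int[leb]_s m t l0 s = 0.
  have el0 : enum_val l0 \in v by rewrite enum_rankK_in//; move: j0vu; rewrite inE => /andP[].
  by rewrite /m el0; exact: Rintegral_kappa_density.
by rewrite (bigD1 l0)//= E0 mul0r mulr0.
Qed.

End synthesis.

(** * Weak derivatives *)

Section weak_derivative_theory.
Context {R : realType} {d : nat}.
Local Notation lam := (@lebesgue_rV R d).
Implicit Types (f g : 'rV[R]_d -> R) (u : {set 'I_d}).

Lemma locally_integrable_lin (a : R) f g : locally_integrable_rV f ->
  locally_integrable_rV g -> locally_integrable_rV (fun x => a * f x + g x).
Proof.
move=> [mf fi] [mg gi]; split.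
  by apply: measurable_funD => //; exact: measurable_funM.
move=> K cK; have mK : measurable K.
  by rewrite -(setCK K); apply: measurableC; apply: open_measurable_rV;
     apply: closed_openC; apply: compact_closed => //; exact: norm_hausdorff.
have if_ : lam.-integrable K (EFin \o f).
  apply/integrableP; split; first by apply/measurable_EFinP; exact: measurable_funTS.
  exact: fi.
have ig : lam.-integrable K (EFin \o g).
  apply/integrableP; split; first by apply/measurable_EFinP; exact: measurable_funTS.
  exact: gi.
have := integrableD mK (integrableZl mK a if_) ig.
by move=> /integrableP[_].
Qed.

Lemma locally_integrable_ae f g : locally_integrable_rV f -> measurable_fun setT g ->
  {ae lam, forall x, f x = g x} -> locally_integrable_rV g.
Proof.
move=> lf mg fg; apply/locally_integrable_rVP; split => // M.
have /locally_integrable_rVP[mf /(_ M)] := lf; congr (_ < _)%E.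
apply: ae_eq_integral; first exact: measurable_cube.
- by apply/measurable_EFinP/measurableT_comp => //; exact: measurable_funTS.
- by apply/measurable_EFinP/measurableT_comp => //; exact: measurable_funTS.
- by apply: filterS fg => x /= -> _.
Qed.

Lemma tame_mixed_partial u (v : 'rV[R]_d -> R) : tame v -> tame (mixed_partial u v).
Proof.
move=> tv; rewrite /mixed_partial; elim: (enum u) => // i r tr; exact: tame_partial.
Qed.

Lemma is_weak_derivative_lin (a : R) u f f' g g' :
  locally_integrable_rV f -> locally_integrable_rV f' ->
  is_weak_derivative u f g -> is_weak_derivative u f' g' ->
  is_weak_derivative u (fun x => a * f x + f' x) (fun x => a * g x + g' x).
Proof.
move=> lf lf' [lg gE] [lg' gE']; split; first exact: locally_integrable_lin.
have E (p q v : 'rV[R]_d -> R) : locally_integrable_rV p -> locally_integrable_rV q -> tame v ->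
    \int[lam]_x ((a * p x + q x) * v x) = a * \int[lam]_x (p x * v x) + \int[lam]_x (q x * v x).
  move=> lp lq tv; have ip := locally_integrable_tame lp tv.
  have iq := locally_integrable_tame lq tv.
  under eq_Rintegral do rewrite mulrDl -mulrA.
  rewrite RintegralD//; last exact: (integrableZl _ a ip).
  by rewrite RintegralZl.
move=> v tv; have tv' := test_function_tame tv.
rewrite E// gE// gE'// E//; last exact: tame_mixed_partial.
by rewrite mulrDr mulrCA.
Qed.

Lemma is_weak_derivative0 u : is_weak_derivative u (cst 0) (cst 0 : 'rV[R]_d -> R).
Proof.
split; first exact: locally_integrable_cst0.
move=> v _; rewrite /Rintegral !integral0_eq ?mulr0// => x _; by rewrite mul0r.
Qed.

Lemma is_weak_derivative_sum (I : finType) (F G : I -> 'rV[R]_d -> R) u :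
  (forall i, locally_integrable_rV (F i)) ->
  (forall i, is_weak_derivative u (F i) (G i)) ->
  locally_integrable_rV (fun x => \sum_i F i x) /\
  is_weak_derivative u (fun x => \sum_i F i x) (fun x => \sum_i G i x).
Proof.
move=> lF wF; elim: (index_enum I) => [|i s [IH1 IH2]].
  rewrite (_ : (fun x => _) = cst 0); last by apply/funext => x; rewrite big_nil.
  rewrite (_ : (fun x => \sum_(i <- [::]) G i x) = cst 0); last by apply/funext => x; rewrite big_nil.
  by split; [exact: locally_integrable_cst0|exact: is_weak_derivative0].
rewrite (_ : (fun x => _) = (fun x => 1 * F i x + \sum_(j <- s) F j x)); last first.
  by apply/funext => x; rewrite big_cons mul1r.
rewrite (_ : (fun x => \sum_(j <- i :: s) G j x) = (fun x => 1 * G i x + \sum_(j <- s) G j x)); last first.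
  by apply/funext => x; rewrite big_cons mul1r.
by split; [exact: locally_integrable_lin|exact: is_weak_derivative_lin].
Qed.

(** Against any test function the difference pairs to zero; product test functions suffice for the
    fundamental lemma. *)
Lemma is_weak_derivative_unique u f g g' :
  is_weak_derivative u f g -> is_weak_derivative u f g' ->
  {ae lam, forall x, g x = g' x}.
Proof.
move=> [lg gE] [lg' gE'].
have ld := locally_integrable_lin (-1) lg lg'.
have : {ae lam, forall x, -1 * g x + g' x = 0}.
  apply: fundamental_lemma => // phi tphi.
  have tv : tame (prodf phi (fun=> 0%N)) := tame_prodf (fun=> 0%N) tphi.
  under eq_Rintegral do rewrite mulrDl -mulrA.
  have ig := locally_integrable_tame lg tv; have ig' := locally_integrable_tame lg' tv.
  rewrite RintegralD//; last exact: (integrableZl _ (-1) ig).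
  rewrite RintegralZl//.
  have tv' := tame_test_function tv.
  by rewrite [X in _ * X](gE _ tv') [X in _ + X](gE' _ tv') mulN1r addNr.
by apply: filterS => x; rewrite mulN1r addrC => /subr0_eq.
Qed.

Lemma weak_derivativeP u f : (exists g, is_weak_derivative u f g) ->
  is_weak_derivative u f (weak_derivative u f).
Proof. by move=> h; exact: (xgetPex (cst 0) h). Qed.

Lemma weak_derivative_ae u f g : is_weak_derivative u f g ->
  {ae lam, forall x, weak_derivative u f x = g x}.
Proof.
by move=> h; apply: (@is_weak_derivative_unique u f) => //; apply: weak_derivativeP; exists g.
Qed.

(** An equality of predicates, so that the choice operator behind [weak_derivative] selects
    literally the same function for [f] and [f']. *)
Lemma is_weak_derivative_ae_eq u f f' : measurable_fun setT f -> measurable_fun setT f' ->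
  {ae lam, forall x, f x = f' x} ->
  is_weak_derivative u f = is_weak_derivative u f'.
Proof.
move=> mf mf' ff'; apply/funext => g; apply/propext; rewrite /is_weak_derivative.
suff E v : test_function v -> \int[lam]_x (f x * mixed_partial u v x) =
    \int[lam]_x (f' x * mixed_partial u v x).
  by split=> -[lg gE]; split=> // v tv; rewrite gE// E.
move=> /test_function_tame/(@tame_mixed_partial u)/tame_measurable mv.
rewrite /Rintegral; congr fine; apply: ae_eq_integral => //.
- by apply/measurable_EFinP; exact: measurable_funM.
- by apply/measurable_EFinP; exact: measurable_funM.
- by apply: filterS ff' => x /= -> _.
Qed.

Lemma weak_derivative_ae_eq u f f' : measurable_fun setT f -> measurable_fun setT f' ->
  {ae lam, forall x, f x = f' x} -> weak_derivative u f = weak_derivative u f'.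
Proof.
by move=> mf mf' ff'; rewrite /weak_derivative (is_weak_derivative_ae_eq u mf mf' ff').
Qed.

Lemma is_weak_derivative_set0 f : locally_integrable_rV f ->
  is_weak_derivative finset.set0 f f.
Proof.
move=> lf; split => // v _; rewrite cards0 expr0 mul1r.
by rewrite /mixed_partial enum_set0.
Qed.

Lemma ae_glue_section u (P : 'rV[R]_d -> Prop) : {ae lam, forall x, P x} ->
  {ae lebesgue_rV #|u|, forall a : 'rV[R]_#|u|,
    {ae lebesgue_rV #|~: u|, forall b, P (Defs.glue a b)}}.
Proof. by move=> /(ae_mpres (glue_mpres u)) /ae_product_section. Qed.

Lemma ae_glue_measurable u (A : set 'rV[R]_d) : measurable A ->
  {ae lebesgue_rV #|u|, forall a : 'rV[R]_#|u|,
    {ae lebesgue_rV #|~: u|, forall b, A (Defs.glue a b)}} ->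
  {ae lam, forall x, A x}.
Proof.
move=> mA h; exists (~` A); split => //; first exact: measurableC.
rewrite -(proj2 (glue_mpres u)); last exact: measurableC.
have mg : measurable ((fun p : 'rV[R]_#|u| * 'rV[R]_#|~: u| => Defs.glue p.1 p.2) @^-1` A).
  by rewrite -[X in measurable X]setTI; apply: measurable_glue.
have [N [mN N0 AN]] := ae_product_measurable mg h.
apply: (subset_measure0 _ mN _ N0); last by move=> z /= Az; apply: AN.
by rewrite preimage_setC; exact: measurableC.
Qed.

End weak_derivative_theory.

(** * Primitives and normalisation of test functions of one variable *)

Section antiderivative.
Context {R : realType}.
Local Notation leb := (@lebesgue_measure R).
Implicit Types (phi chi : nat -> R -> R).

Lemma test_tower_lin (a : R) phi chi : test_tower phi -> test_tower chi ->
  test_tower (fun k x => phi k x - a * chi k x).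
Proof.
move=> [Dp [M M0 pM]] [Dc [N N0 cN]]; split.
  move=> k x; have := is_deriveB (Dp k x) (is_deriveZ a (Dc k x)).
  by move/is_derive_eq; apply.
exists (M + N); first by rewrite addr_ge0.
by move=> k x xMN; rewrite pM ?cN ?mulr0 ?subr0//; apply: le_lt_trans xMN; rewrite ?lerDl ?lerDr.
Qed.

(** The primitive from minus infinity is constant beyond the support, equal to the total integral;
    mean zero is what gives it compact support. *)
Lemma test_tower_antiderivative phi : test_tower phi -> \int[leb]_s phi 0%N s = 0 ->
  exists2 theta, test_tower theta & theta 1%N = phi 0%N.
Proof.
move=> tphi phi0; have [iphi _ _] := test_tower_FTC 0 tphi.
have cphi := @test_tower_continuous R phi 0 tphi.
have [D [M M0 pM]] := tphi.
pose th x := \int[leb]_(s in `]-oo, x]) phi 0%N s.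
exists (fun k => if k is k'.+1 then phi k' else th) => //; split.
  case=> [|k] x //.
  have [] := @continuous_FTC1 R (phi 0%N) -oo%O x (x + 1).
  - by rewrite ltrDl.
  - exact: integrableS (iphi 0%N).
  - exact: ltNyr.
  - exact: cphi.
  move=> dth thE; split; first exact: dth.
  by rewrite -derive1E; exact: thE.
exists M => // -[|k] x xM; last exact: pM.
rewrite /th Rintegral_itvNyc; have [x0|x0] := ltP x 0.
  rewrite /Rintegral integral0_eq// => s _; congr EFin.
  case: (leP s x) => sx; rewrite ?mul0r// mul1r pM//.
  by rewrite (lt_le_trans xM)// !ltr0_norm ?lerN2// (le_lt_trans sx).
rewrite -phi0; apply: eq_Rintegral => s _.
case: (leP s x) => sx; rewrite ?mul1r// mul0r pM//.
rewrite (lt_le_trans xM)// ger0_norm// (le_trans (ltW sx))//; exact: ler_norm.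
Qed.

(** The bump is positive on ]0, 1[, so its integral is nonzero and can be normalised. *)
Lemma unit_mass_tower : exists2 phi, test_tower phi & \int[leb]_s phi 0%N s = 1.
Proof.
have tb : test_tower (bump 0 1 (1 : R)) := bump_tower 0 1 ltr01.
have [ib _ _] := test_tower_FTC 0 tb.
set c := \int[leb]_s bump 0 1 1 0 s.
have bpos (s : R) : 0 <= bump 0 1 (1 : R) 0 s.
  by rewrite bump0E !mul1r mulr_ge0//; have /andP[] := flat1_itv (s - 0); have /andP[] := flat1_itv (1 - s).
have c0 : c != 0.
  apply/eqP => c0.
  have : (\int[leb]_s `|(bump 0 1 1 0 s)%:E| = 0)%E.
    transitivity (\int[leb]_s (bump 0 1 1 0 s)%:E)%E.
      by apply: eq_integral => s _; rewrite gee0_abs// lee_fin.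
    by rewrite -EFin_Rintegral ?ib// -/c c0.
  move/ae_eq_integral_abs => /(_ measurableT).
  have mb : measurable_fun setT (fun s : R => (bump 0 1 1 0 s)%:E).
    by have /integrableP[] := ib 0%N.
  move=> /(_ mb) [N [mN N0 NP]].
  have sub : `]0, 1[%classic `<=` N.
    move=> s; rewrite /= in_itv/= => /andP[s0 s1]; apply: NP => /= /(_ I) [].
    apply/eqP; rewrite gt_eqF// bump0E !mul1r subr0 mulr_gt0// /flat ?s0 ?subr_gt0 ?s1;
      by rewrite hornerC mul1r expR_gt0.
  have : (leb (`]0%R, 1%R[%classic : set R) <= leb N)%E by apply: le_measure; rewrite ?inE.
  by rewrite N0 lebesgue_measure_itv/= lte_fin ltr01 sube0 leNgt lte_fin ltr01.
(* The scalar multiple is written as a difference with the zero tower so that [test_tower_lin]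
   applies. *)
exists (fun k x => 0 - (- c^-1) * bump 0 1 1 k x).
  apply: (@test_tower_lin (- c^-1) (fun _ _ => 0)) => //; split; last by exists 0.
  by move=> _ x; exact: is_derive_cst.
under eq_Rintegral do rewrite sub0r mulNr opprK.
by rewrite RintegralZl ?ib// -/c mulVf.
Qed.

End antiderivative.

(** * Functions independent of some coordinates *)

Section averaging.
Context {R : realType} {d : nat}.
Local Notation lam := (@lebesgue_rV R d).
Local Notation leb := (@lebesgue_measure R).
Variables (rho : 'I_d -> R -> R).
Hypotheses (mrho : forall j, measurable_fun setT (rho j))
  (rho_gt0 : forall j x, 0 < rho j x)
  (rho1 : forall j, (\int[leb]_x (rho j x)%:E = 1)%E).
Variables (u : {set 'I_d}) (F : 'rV[R]_d -> R) (chi : nat -> R -> R).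
Hypotheses (lF : locally_integrable_rV F) (tchi : test_tower chi)
  (chi1 : \int[leb]_s chi 0%N s = 1).

Let irho j : leb.-integrable setT (EFin \o rho j).
Proof. exact: integrable_density. Qed.

Let mF : measurable_fun setT F. Proof. exact: lF.1. Qed.

Definition avg_weight i := if i \in u then rho i else chi 0%N.

(* Only the coordinates of t outside u enter F; those in u are dummy variables
   of total mass 1. *)
Definition average x := \int[lam]_t (F (mix u x t) * pw avg_weight t).

Let ichi : leb.-integrable setT (EFin \o chi 0%N).
Proof. by have [/(_ 0%N)] := test_tower_FTC 0 tchi. Qed.

(** One-dimensional factors with common bounds on size and support. The class covers both test
    towers, used for pairings, and indicators of intervals, used for local integrability. *)
Definition cube_weight (p : 'I_d -> R -> R) := exists C M, forall i,
  [/\ 0 <= C, measurable_fun setT (p i), forall s, `|p i s| <= C &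
      forall s, M < `|s| -> p i s = 0].

Lemma cube_weight_bound (p : 'I_d -> R -> R) : cube_weight p ->
  exists C M, [/\ 0 <= C, measurable_fun setT (pw p) &
    forall x : 'rV[R]_d, `|pw p x| <= C * \1_(cube M) x].
Proof.
move=> [C [M h]]; exists (\prod_(i < d) C), M; split.
- by apply: prodr_ge0 => i _; have [] := h i.
- by apply: measurable_pw => i; have [] := h i.
move=> x; rewrite indicE; case: (boolP (x \in cube M)) => [_|].
  rewrite mulr1 normr_prod; apply: ler_prod => i _; rewrite normr_ge0/=.
  by have [_ _ + _] := h i; apply.
rewrite notin_setE => /cubeP/existsNP[i /negP]; rewrite -ltNge => xi.
by rewrite /pw (bigD1 i)//=; have [_ _ _ ->] := h i => //; rewrite mul0r normr0 mulr0.
Qed.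

Lemma integrable_cube_weight (p : 'I_d -> R -> R) i : cube_weight p ->
  leb.-integrable setT (EFin \o p i).
Proof.
move=> [C [M /(_ i)[C0 mp pC pM]]].
have := integrableZl measurableT C (integrable_indic_itv (- M) M true false).
apply: le_integrable => //; first exact/measurable_EFinP.
move=> s _; rewrite /= lee_fin normrM (ger0_norm C0) ger0_norm//.
case: (leP `|s| M) => sM; last by rewrite pM// normr0 mulr_ge0.
by rewrite indicE mem_set ?mulr1//= in_itv/= -ler_norml.
Qed.

Lemma integrable_loc_cube_weight (p : 'I_d -> R -> R) : cube_weight p ->
  lam.-integrable setT (fun x => (F x * pw p x)%:E).
Proof.
move=> /cube_weight_bound[C [M [C0 mp pC]]].
have h := locally_integrable_ge0 lF M.
apply/integrable_EFinP; split; first exact: measurable_funM.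
have m1 : measurable_fun setT (fun x => (`|F x| * \1_(cube M) x)%:E).
  apply/measurable_EFinP; apply: measurable_funM; first exact: measurableT_comp.
  by apply: measurable_indic; exact: measurable_cube.
apply: (@le_lt_trans _ _ (\int[lam]_x (C%:E * (`|F x| * \1_(cube M) x)%:E))%E).
  apply: ge0_le_integral => //.
  - by apply/measurable_EFinP/measurableT_comp => //; exact: measurable_funM.
  - exact: emeasurable_funM.
  - by move=> x _; rewrite -EFinM lee_fin normrM mulrCA ler_wpM2l.
rewrite ge0_integralZl//.
by rewrite lte_mul_pinfty ?lee_fin.
Qed.

Lemma test_tower_cube_weight (phi : 'I_d -> nat -> R -> R) :
  (forall i, test_tower (phi i)) -> cube_weight (fun i => phi i 0%N).
Proof.
move=> tphi.
have hb i : exists CM : R * R, [/\ 0 <= CM.1, 0 <= CM.2, forall s, `|phi i 0%N s| <= CM.1 &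
    forall s, CM.2 < `|s| -> phi i 0%N s = 0].
  have [_ [M M0 pM]] := tphi i.
  have : compact (phi i 0%N @` `[- M, M]%classic).
    apply: continuous_compact; last exact: segment_compact.
    by apply: continuous_subspaceT; exact: test_tower_continuous.
  move=> /compact_bounded[C [Creal h]]; exists (`|C| + 1, M); split => //=; last exact: pM.
  move=> s; case: (leP `|s| M) => sM; last by rewrite pM// normr0.
  apply: h; last by exists s => //; rewrite /= in_itv/= -ler_norml.
  by apply: le_lt_trans (ler_norm _) _; rewrite ltrDl.
have [CM CMP] := choice hb.
exists (\sum_i (CM i).1), (\sum_i (CM i).2) => i.
have [C0 M0 pC pM] := CMP i.
have leC : (CM i).1 <= \sum_i (CM i).1.
  by rewrite (bigD1 i)//= lerDl sumr_ge0// => j _; have [] := CMP j.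
have leM : (CM i).2 <= \sum_i (CM i).2.
  by rewrite (bigD1 i)//= lerDl sumr_ge0// => j _; have [] := CMP j.
split.
- exact: le_trans leC.
- by apply: continuous_measurable_fun; exact: test_tower_continuous.
- by move=> s; apply: le_trans (pC s) leC.
- by move=> s sM; apply: pM; exact: le_lt_trans leM sM.
Qed.

Let pswap (p : 'I_d -> R -> R) i := if i \in u then p i else chi 0%N.

Let cube_weight_pswap p : cube_weight p -> cube_weight (pswap p).
Proof.
move=> [C [M h]]; have [C' [M' h']] := test_tower_cube_weight (fun _ => tchi).
exists (`|C| + `|C'|), (Num.max M M') => i.
rewrite /pswap; case: ifP => iu.
  have [C0 mp pC pM] := h i; split => //.
  - by move=> s; apply: (le_trans (pC s)); rewrite (le_trans (ler_norm _))// lerDl.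
  - by move=> s; rewrite gt_max => /andP[/pM].
have [C0 mp pC pM] := h' i; split => //.
- by move=> s; apply: (le_trans (pC s)); rewrite (le_trans (ler_norm _))// lerDr.
- by move=> s; rewrite gt_max => /andP[_ /pM].
Qed.

(** After the exchange F depends on one point only, weighted by p on u and by chi off u; the other
    point carries rho on u, of mass 1, and p off u, whence the product of integrals. *)
Lemma average_pairing (p : 'I_d -> R -> R) : cube_weight p ->
  lam.-integrable setT (fun x => (average x * pw p x)%:E) /\
  \int[lam]_x (average x * pw p x) =
  (\int[lam]_x (F x * pw (fun i => if i \in u then p i else chi 0%N) x)) *
  \prod_(i | i \notin u) \int[leb]_s p i s.
Proof.
move=> cp.
pose q i := if i \in u then rho i else p i.
have iq i : leb.-integrable setT (EFin \o q i).
  by rewrite /q; case: ifP => // _; exact: integrable_cube_weight.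
have mw i : measurable_fun setT (avg_weight i).
  by rewrite /avg_weight; case: ifP => // _; have [] := (integrable_EFinP _ _).1 ichi.
have mpp : measurable_fun setT (pw p) by have [C [M []]] := cube_weight_bound cp.
pose G (z : 'rV[R]_d * 'rV[R]_d) := F (mix u z.1 z.2) * pw avg_weight z.2.
have mG : measurable_fun setT G.
  apply: measurable_funM; last by apply: measurableT_comp => //; exact: measurable_pw.
  by apply: (measurableT_comp mF); exact: measurable_mix.
have mGp : measurable_fun setT (fun z => G z * pw p z.1).
  by apply: measurable_funM => //; exact: measurableT_comp.
have E z : G (swap u z) * pw p (swap u z).1 = pw q z.1 * (F z.2 * pw (pswap p) z.2).
  rewrite /G /swap/= mixK mulrC mulrCA [in RHS]mulrCA; congr (_ * _).
  rewrite /pw -!big_split/=; apply: eq_bigr => i _; rewrite /avg_weight /q /pswap !mxE.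
  by case: (i \in u); rewrite // mulrC.
have iFp := integrable_loc_cube_weight (cube_weight_pswap cp).
have iT := integrable_tensor (integrable_prod iq) iFp.
have iGp : (lam \x lam)%E.-integrable setT (fun z => (G z * pw p z.1)%:E).
  apply/(integrable_mpres (swap_mpres u)); first exact/measurable_EFinP.
  by apply: eq_integrable iT => // z _; rewrite E.
have [iA ->] := Rintegral_mul_section mG mpp iGp.
split => //.
rewrite -(Rintegral_mpres (swap_mpres u) mGp).
under eq_Rintegral do rewrite E.
rewrite -(@Rintegral12 _ _ _ _ R lam lam (fun z => pw q z.1 * (F z.2 * pw (pswap p) z.2)) iT)/=.
transitivity (\int[lam]_x (pw q x * \int[lam]_y (F y * pw (pswap p) y))).
  by apply: eq_Rintegral => x _; rewrite RintegralZl.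
rewrite RintegralZr//; last exact: integrable_prod.
rewrite mulrC; congr (_ * _).
rewrite Rintegral_prod// [in RHS]big_mkcond/=; apply: eq_bigr => i _.
by rewrite /q; case: (i \in u) => //=; exact: Rintegral_density.
Qed.

Lemma locally_integrable_average : locally_integrable_rV average.
Proof.
have mw i : measurable_fun setT (avg_weight i).
  by rewrite /avg_weight; case: ifP => // _; have [] := (integrable_EFinP _ _).1 ichi.
apply/locally_integrable_rVP; split.
  apply: (@measurable_Rintegral1 _ _ _ _ _ lam (fun z => F (mix u z.1 z.2) * pw avg_weight z.2)).
  apply: measurable_funM; last by apply: measurableT_comp => //; exact: measurable_pw.
  by apply: (measurableT_comp mF); exact: measurable_mix.
move=> M; pose p (i : 'I_d) := \1_(`[- M, M] : set R) : R -> R.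
have cp : cube_weight p.
  exists 1, M => i; split => //.
  - by apply: measurable_indic.
  - by move=> s; rewrite /p indicE; case: (_ \in _); rewrite ?normr1 ?normr0.
  - move=> s sM; rewrite /p indicE memNset//= in_itv/= -ler_norml; apply/negP.
    by rewrite -ltNge.
have [/integrable_EFinP[_ h] _] := average_pairing cp.
apply: le_lt_trans h; rewrite le_eqVlt; apply/orP; left; apply/eqP.
rewrite [LHS]integral_mkcond; apply: eq_integral => x _.
rewrite patchE; case: (boolP (x \in cube M)) => [|].
  rewrite inE => /cubeP xM; rewrite /pw big1 ?mulr1// => i _.
  by rewrite /p indicE mem_set//= in_itv/= -ler_norml.
rewrite notin_setE => /cubeP/existsNP[i xM]; rewrite /pw (bigD1 i)//=.
by rewrite /p indicE memNset ?mul0r ?mulr0 ?normr0//= in_itv/= -ler_norml.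
Qed.

Lemma average_mix x t : average (mix u x t) = average x.
Proof.
apply: eq_Rintegral => s _; congr (F _ * _).
by apply/rowP => i; rewrite !mxE; case: (i \in u).
Qed.

(** The weak form of vanishing derivatives in the directions outside u, on product test functions:
    the multi-index differentiates the j-th factor once. *)
Hypothesis dF : forall (phi : 'I_d -> nat -> R -> R) j, (forall i, test_tower (phi i)) ->
  j \notin u -> \int[lam]_x (F x * prodf phi (fun i => (i == j) : nat) x) = 0.

Let replace (s : seq 'I_d) (phi : 'I_d -> nat -> R -> R) i := if i \in s then chi else phi i.

(** With a the integral of phi_j, the difference phi_j - a chi has mean zero and is therefore the
    derivative of a test function theta. By [dF] it pairs to zero with F, so phi_j can be traded for
    a chi, one coordinate at a time. *)
Let replaceE (phi : 'I_d -> nat -> R -> R) (s : seq 'I_d) : (forall i, test_tower (phi i)) ->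
  uniq s -> (forall j, j \in s -> j \notin u) ->
  \int[lam]_x (F x * prodf phi (fun=> 0%N) x) =
  (\prod_(i <- s) \int[leb]_r phi i 0%N r) *
  \int[lam]_x (F x * prodf (replace s phi) (fun=> 0%N) x).
Proof.
move=> tphi; elim: s => [|j s IH] /=; first by rewrite big_nil mul1r.
move=> /andP[js us] su; rewrite IH//; last by move=> i si; apply: su; rewrite inE si orbT.
rewrite big_cons (mulrC (\int[leb]_r phi j 0%N r)) -[in RHS]mulrA; congr (_ * _).
have ju : j \notin u by apply: su; rewrite inE eqxx.
set a := \int[leb]_r phi j 0%N r.
have tr i : test_tower (replace s phi i) by rewrite /replace; case: ifP.
have tr' i : test_tower (replace (j :: s) phi i) by rewrite /replace; case: ifP.
have [ip _ _] := test_tower_FTC 0 (tphi j).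
have tdiff := test_tower_lin a (tphi j) tchi.
have [|theta tth th1] := test_tower_antiderivative tdiff.
  by rewrite RintegralB// ?RintegralZl// ?chi1 ?mulr1 ?subrr//; exact: (integrableZl _ a ichi).
pose om i := if i == j then theta else replace s phi i.
have tom i : test_tower (om i) by rewrite /om; case: ifP.
have := dF tom ju.
have E x : F x * prodf om (fun i => (i == j) : nat) x =
    F x * prodf (replace s phi) (fun=> 0%N) x - a * (F x * prodf (replace (j :: s) phi) (fun=> 0%N) x).
  rewrite mulrCA -mulrBr; congr (_ * _); rewrite /prodf.
  rewrite (bigD1 j)//= [X in _ = X - _](bigD1 j)//= [X in _ = _ - a * X](bigD1 j)//=.
  have -> : om j (j == j) (x ord0 j) = phi j 0%N (x ord0 j) - a * chi 0%N (x ord0 j).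
    by rewrite /om eqxx (_ : nat_of_bool true = 1%N)// th1.
  have -> : replace s phi j = phi j by rewrite /replace (negbTE js).
  have -> : replace (j :: s) phi j = chi by rewrite /replace inE eqxx.
  rewrite (eq_bigr (fun i => replace s phi i 0%N (x ord0 i))); last first.
    by move=> i ij; rewrite /om (negbTE ij).
  rewrite [X in _ = _ - _ * (_ * X)](eq_bigr (fun i => replace s phi i 0%N (x ord0 i))); last first.
    by move=> i ij; rewrite /replace inE (negbTE ij).
  by rewrite mulrA -mulrBl.
have i1 := locally_integrable_tame lF (tame_prodf (fun=> 0%N) tr).
have i2 := locally_integrable_tame lF (tame_prodf (fun=> 0%N) tr').
under eq_Rintegral do rewrite E.
rewrite RintegralB//; last exact: (integrableZl _ a i2).
by rewrite RintegralZl// => /subr0_eq ->.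
Qed.

(** Once every factor outside u has been traded for chi, pairing with F and pairing with [average]
    give the same number. *)
Lemma average_ae : {ae lam, forall x, F x = average x}.
Proof.
have ld := locally_integrable_lin (-1) locally_integrable_average lF.
have : {ae lam, forall x, -1 * average x + F x = 0}.
  apply: fundamental_lemma => // phi tphi.
  have cp := test_tower_cube_weight tphi.
  have [iA AE] := average_pairing cp.
  under eq_Rintegral do rewrite mulrDl -mulrA.
  rewrite RintegralD//; last 2 first.
  - exact: (integrableZl _ (-1) iA).
  - exact: integrable_loc_cube_weight cp.
  rewrite RintegralZl// mulN1r; apply/eqP; rewrite addrC subr_eq0; apply/eqP.
  rewrite [RHS]AE.
  rewrite (@replaceE phi (enum (~: u)) tphi (enum_uniq _)); last first.
    by move=> j; rewrite mem_enum inE.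
  rewrite mulrC; congr (_ * _).
    apply: eq_Rintegral => x _; congr (_ * _); apply: eq_bigr => i _.
    by rewrite /replace mem_enum inE; case: (i \in u).
  by rewrite big_enum/=; apply: eq_bigl => i; rewrite inE.
by apply: filterS => x; rewrite mulN1r addrC => /subr0_eq.
Qed.

End averaging.

(** * Expansion of functions in the weighted space *)

Section finite_sums.
Context d (X : measurableType d) (R : realType) (m : {measure set X -> \bar R}).

Lemma Rintegral_ae_eq (f g : X -> R) : measurable_fun setT f -> measurable_fun setT g ->
  {ae m, forall x, f x = g x} -> \int[m]_x f x = \int[m]_x g x.
Proof.
move=> mf mg fg; rewrite /Rintegral; congr fine; apply: ae_eq_integral => //.
- exact/measurable_EFinP.
- exact/measurable_EFinP.
- by apply: filterS fg => x /= -> _.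
Qed.

Lemma Rintegral_fsum (I : finType) (F : I -> X -> R) :
  (forall i, m.-integrable setT (EFin \o F i)) ->
  m.-integrable setT (fun x => (\sum_i F i x)%:E) /\
  \int[m]_x (\sum_i F i x) = \sum_i \int[m]_x F i x.
Proof.
move=> iF; elim: (index_enum I) => [|i s [IH1 IH2]].
  rewrite big_nil; under eq_fun do rewrite big_nil.
  under eq_Rintegral do rewrite big_nil.
  by split; [exact: integrable0|rewrite /Rintegral integral0_eq].
rewrite big_cons -IH2; under eq_fun do rewrite big_cons EFinD.
under eq_Rintegral do rewrite big_cons.
by split; [exact: (integrableD measurableT (iF i) IH1)|exact: (RintegralD measurableT (iF i) IH1)].
Qed.

End finite_sums.

Section expansion.
Context {R : realType} {d : nat}.
Local Notation lam := (@lebesgue_rV R d).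
Local Notation leb := (@lebesgue_measure R).
Variables (rho psi : 'I_d -> R -> R) (gamma : {set 'I_d} -> R).
Hypotheses (mrho : forall j, measurable_fun setT (rho j))
  (rho_gt0 : forall j x, 0 < rho j x)
  (rho1 : forall j, (\int[leb]_x (rho j x)%:E = 1)%E)
  (psi_gt0 : forall j x, 0 < psi j x)
  (psi_loc : forall j, locally_integrable setT (psi j))
  (psiV_loc : forall j, locally_integrable setT (fun x => (psi j x)^-1))
  (gamma_gt0 : forall u, 0 < gamma u)
  (left_tail : forall j (c : R),
    (\int[leb]_(t in `]-oo, c]) (distr_fun (rho j) t ^+ 2 / psi j t)%:E < +oo)%E)
  (right_tail : forall j (c : R),
    (\int[leb]_(t in `[c, +oo[) ((1 - distr_fun (rho j) t) ^+ 2 / psi j t)%:E < +oo)%E).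
Local Notation W := (W_space rho psi gamma).
Local Notation inner u f := (@inner_integral R d rho u f).
Local Notation family := (forall u : {set 'I_d}, 'rV[R]_#|u| -> R).
Implicit Types (f : 'rV[R]_d -> R) (h : family) (u v : {set 'I_d}).

Let mpsi j : measurable_fun setT (psi j). Proof. by have [] := psi_loc j. Qed.
Let irho j : leb.-integrable setT (EFin \o rho j).
Proof. exact: integrable_density. Qed.
Let rho_ge0 j s : 0 <= rho j s. Proof. exact: ltW. Qed.
Let psi_ge0 j s : 0 <= psi j s. Proof. exact: ltW. Qed.
Let pwt_gt0 u (a : 'rV[R]_#|u|) : 0 < prod_weight psi a.
Proof. by apply: prodr_gt0. Qed.
Let pwt_ge0 u (a : 'rV[R]_#|u|) : 0 <= prod_weight psi a. Proof. exact: ltW. Qed.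
Let mpwt u : measurable_fun setT (@prod_weight R d psi u).
Proof. exact: measurable_prod_weight. Qed.
Let mpwr u : measurable_fun setT (@prod_weight R d rho u).
Proof. exact: measurable_prod_weight. Qed.

Definition sq_summable h := forall u, measurable_fun setT (h u) /\
  (\int[lebesgue_rV #|u|]_a (h u a ^+ 2 * prod_weight psi a)%:E < +oo)%E.

Let msq u (g : 'rV[R]_#|u| -> R) : measurable_fun setT g ->
  measurable_fun setT (fun a => g a ^+ 2 * prod_weight psi a).
Proof.
by move=> mg; apply: measurable_funM; [exact: measurable_funX|exact: mpwt].
Qed.

Lemma sq_summableP h : sq_summable h <-> forall u, measurable_fun setT (h u) /\
  (lebesgue_rV #|u|).-integrable setT (fun a => (h u a ^+ 2 * prod_weight psi a)%:E).
Proof.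
have E u a : `|h u a ^+ 2 * prod_weight psi a| = h u a ^+ 2 * prod_weight psi a.
  by rewrite ger0_norm// mulr_ge0 ?sqr_ge0.
split=> Lh u; have [mh hu] := Lh u; split => //.
  apply/integrable_EFinP; split; first exact: msq.
  by under eq_integral do rewrite E.
by have /integrable_EFinP[_] := hu; under eq_integral do rewrite E.
Qed.

Lemma sq_summable_lin (c : R) h h' : sq_summable h -> sq_summable h' ->
  sq_summable (fun u a => c * h u a + h' u a).
Proof.
move=> Lh Lh'; apply/sq_summableP => u.
have [mh ih] := (sq_summableP _).1 Lh u; have [mh' ih'] := (sq_summableP _).1 Lh' u.
have mH : measurable_fun setT (fun a => c * h u a + h' u a).
  by apply: measurable_funD => //; exact: measurable_funM.
split => //.
have := integrableD measurableT (integrableZl measurableT (2 * c ^+ 2) ih) (integrableZl measurableT 2 ih').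
apply: le_integrable => //.
  by apply/measurable_EFinP; exact: msq.
move=> a _; rewrite /= lee_fin.
have p0 := pwt_ge0 a; set p := prod_weight psi a in p0 *.
have E (x y : R) : (c * x + y) ^+ 2 <= 2 * c ^+ 2 * x ^+ 2 + 2 * y ^+ 2.
  by have := sqr_ge0 (c * x - y); nra.
rewrite ger0_norm; last by rewrite mulr_ge0// sqr_ge0.
apply: le_trans (ler_norm _); apply: le_trans (ler_wpM2r p0 (E (h u a) (h' u a))) _.
by rewrite le_eqVlt; apply/orP; left; apply/eqP; ring.
Qed.

Lemma measurable_inner u f : (exists g, is_weak_derivative u f g) -> measurable_fun setT (inner u f).
Proof.
move=> /weak_derivativeP[[mg _] _].
apply: (@measurable_Rintegral1 _ _ _ _ R (lebesgue_rV #|~: u|)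
  (fun z : 'rV[R]_#|u| * 'rV[R]_#|~: u| => weak_derivative u f (Defs.glue z.1 z.2) * prod_weight rho z.2)).
apply: measurable_funM; first exact: (measurableT_comp mg (@measurable_glue R d u)).
by apply: (measurableT_comp (@mpwr (~: u))); exact: measurable_snd.
Qed.

Lemma sq_summable_inner f : W f -> sq_summable (fun u => inner u f).
Proof.
move=> [lf wf _ Wfin] u; split; first exact: measurable_inner.
have I0 v : (0 <= \int[lebesgue_rV #|v|]_a (`|inner v f a| ^+ 2 * prod_weight psi a)%:E)%E.
  by apply: integral_ge0 => a _; rewrite lee_fin mulr_ge0// sqr_ge0.
move: Wfin; rewrite /W_sqnorm (bigD1 u)//= => Wfin.
rewrite (eq_integral (fun a => (`|inner u f a| ^+ 2 * prod_weight psi a)%:E)); last first.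
  by move=> a _; rewrite real_normK ?num_real.
rewrite ltNge leye_eq; apply/eqP => Ioo; move: Wfin; rewrite Ioo.
rewrite mulry gtr0_sg ?invr_gt0// mul1e addye ?ltxx//.
rewrite gt_eqF// (lt_le_trans ltNy0)//; apply: sume_ge0 => v _.
by rewrite mule_ge0// lee_fin invr_ge0 ltW.
Qed.

Let msec u (g : 'rV[R]_d -> R) (a : 'rV[R]_#|u|) : measurable_fun setT g ->
  measurable_fun setT (fun b : 'rV[R]_#|~: u| => g (Defs.glue a b) * prod_weight rho b).
Proof.
move=> mg; apply: measurable_funM; last exact: mpwr.
apply: (measurableT_comp mg (g := fun b : 'rV[R]_#|~: u| => Defs.glue a b)).
apply: (measurableT_comp (@measurable_glue R d u) (g := fun b : 'rV[R]_#|~: u| => (a, b))).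
exact: pair1_measurable.
Qed.

(** Allows working with explicit weak derivatives [gs]: they agree almost everywhere with the
    selected ones, hence on almost every section. *)
Lemma W_spaceP f (gs : {set 'I_d} -> 'rV[R]_d -> R) h :
  locally_integrable_rV f -> (forall u, is_weak_derivative u f (gs u)) ->
  (forall u, {ae lebesgue_rV #|u|, forall a : 'rV[R]_#|u|,
    (lebesgue_rV #|~: u|).-integrable setT
      (fun b => (gs u (Defs.glue a b) * prod_weight rho b)%:E) /\
    \int[lebesgue_rV #|~: u|]_b (gs u (Defs.glue a b) * prod_weight rho b) = h u a}) ->
  sq_summable h ->
  W f /\ forall u, {ae lebesgue_rV #|u|, forall a : 'rV[R]_#|u|, inner u f a = h u a}.
Proof.
move=> lf wf ah Lh.
have wf' u : exists g, is_weak_derivative u f g by exists (gs u).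
have key u : {ae lebesgue_rV #|u|, forall a : 'rV[R]_#|u|,
    (lebesgue_rV #|~: u|).-integrable setT (fun b => (inner_integrand rho f a b)%:E) /\
    inner u f a = h u a}.
  have [[mw _] _] := weak_derivativeP (wf' u).
  have := ae_glue_section u (weak_derivative_ae (wf u)).
  move: (ah u); apply: filterS2 => a [ia Ea] Eb.
  have [] := @ae_eq_integrable _ _ _ (lebesgue_rV #|~: u|)
    (fun b => gs u (Defs.glue a b) * prod_weight rho b)
    (fun b => weak_derivative u f (Defs.glue a b) * prod_weight rho b).
  - exact: msec mw.
  - by apply: filterS Eb => b /= ->.
  - exact: ia.
  by move=> i1 E; split; [exact: i1|rewrite -Ea E].
have inh u : {ae lebesgue_rV #|u|, forall a : 'rV[R]_#|u|, inner u f a = h u a}.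
  by apply: filterS (key u) => a [].
split => //; split => //.
  by move=> u; apply: filterS (key u) => a [].
apply: lte_sum_pinfty => u _.
have [mh hoo] := Lh u.
have mi := measurable_inner (wf' u).
rewrite (ae_eq_integral (fun a => (h u a ^+ 2 * prod_weight psi a)%:E))//; last 3 first.
- by apply/measurable_EFinP; apply: msq; exact: measurableT_comp.
- by apply/measurable_EFinP; exact: msq.
- by apply: filterS (inh u) => a -> _; rewrite real_normK ?num_real.
by rewrite lte_mul_pinfty// lee_fin invr_ge0 ltW.
Qed.

Lemma W_lin (c : R) f f' : W f -> W f' -> W (fun x => c * f x + f' x) /\
  forall u, {ae lebesgue_rV #|u|, forall a : 'rV[R]_#|u|,
    inner u (fun x => c * f x + f' x) a = c * inner u f a + inner u f' a}.
Proof.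
move=> Wf Wf'; have [lf wf af _] := Wf; have [lf' wf' af' _] := Wf'.
apply: (@W_spaceP _ (fun u x => c * weak_derivative u f x + weak_derivative u f' x)
  (fun u a => c * inner u f a + inner u f' a)).
- exact: locally_integrable_lin.
- by move=> u; apply: is_weak_derivative_lin => //; exact: weak_derivativeP.
- move=> u; move: (af u) (af' u); apply: filterS2 => a ia ia'.
  under eq_fun do rewrite mulrDl -mulrA EFinD.
  under eq_Rintegral do rewrite mulrDl -mulrA.
  split; first exact: (integrableD measurableT (integrableZl measurableT c ia) ia').
  by rewrite RintegralD//; [rewrite RintegralZl//|exact: (integrableZl _ c ia)].
- by apply: sq_summable_lin; exact: sq_summable_inner.
Qed.

Definition lift h v : 'rV[R]_d -> R := h v \o proj v.

(* The function with the prescribed inner integrals h. *)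
Definition expand h y := \sum_v synth rho v finset.set0 (lift h v) y.

Lemma proj_glue u (a : 'rV[R]_#|u|) b : proj u (Defs.glue a b) = a.
Proof. by apply/rowP => k; rewrite mxE glue_in. Qed.

Lemma depends_on_lift h v : depends_on v (lift h v).
Proof.
move=> x t; rewrite /lift/=; congr (h v _); apply/rowP => k.
by rewrite !mxE enum_valP.
Qed.

Lemma L2w_lift h v : sq_summable h -> L2w rho psi v (lift h v).
Proof.
move=> Lh; have [mh ih] := (sq_summableP _).1 Lh v.
have mH : measurable_fun setT (lift h v) by apply: measurableT_comp => //; exact: measurable_proj.
have sw0 i s : 0 <= split_weight rho psi v i s by rewrite /split_weight; case: ifP.
split => //.
have mF : measurable_fun setT (fun x => (lift h v x ^+ 2 * pw (split_weight rho psi v) x)%:E).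
  apply/measurable_EFinP; apply: measurable_funM; first exact: measurable_funX.
  by apply: measurable_pw => i; rewrite /split_weight; case: ifP.
rewrite -(ge0_integral_mpres (glue_mpres v) mF); last first.
  by move=> x; rewrite lee_fin mulr_ge0 ?sqr_ge0// pw_ge0.
have /integrable_EFinP[_] := integrable_tensor ih (integrable_prod_weight mrho rho_gt0 rho1 (~: v)).
congr (_ < _)%E; apply: eq_integral => -[a b] _ /=.
rewrite ger0_norm; last first.
  by apply: mulr_ge0; [apply: mulr_ge0; [exact: sqr_ge0|exact: pwt_ge0]|exact: prodr_ge0].
rewrite /lift/= proj_glue -mulrA; congr (_ * _)%:E.
rewrite /pw (prod_setC v); congr (_ * _); apply: eq_bigr => k _.
  by rewrite glue_in /split_weight enum_valP.
by rewrite glue_out /split_weight; have := enum_valP k; rewrite inE => /negbTE ->.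
Qed.

(** In the inner integral for u, differentiation kills the summands whose v does not contain u,
    averaging kills those whose v is strictly larger, and v = u remains. *)
Lemma W_expand h : sq_summable h -> W (expand h) /\
  forall u, {ae lebesgue_rV #|u|, forall a : 'rV[R]_#|u|, inner u (expand h) a = h u a}.
Proof.
move=> Lh; have LH v := L2w_lift v Lh.
pose G u v := if u \subset v then synth rho v u (lift h v) else cst 0.
have wG u v : is_weak_derivative u (synth rho v finset.set0 (lift h v)) (G u v).
  by apply: (@is_weak_derivative_synth _ _ rho psi).
have lS v : locally_integrable_rV (synth rho v finset.set0 (lift h v)).
  by apply: (@locally_integrable_synth _ _ rho psi) => //; exact: finset.sub0set.
have S u := is_weak_derivative_sum lS (wG u).
apply: (@W_spaceP _ (fun u x => \sum_v G u v x) h) => //.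
- exact: (S finset.set0).1.
- by move=> u; exact: (S u).2.
move=> u.
have aG v : {ae lebesgue_rV #|u|, forall a : 'rV[R]_#|u|,
    (lebesgue_rV #|~: u|).-integrable setT
      (fun b => (G u v (Defs.glue a b) * prod_weight rho b)%:E) /\
    \int[lebesgue_rV #|~: u|]_b (G u v (Defs.glue a b) * prod_weight rho b) =
    if v == u then lift h v (Defs.glue a 0) else 0}.
  rewrite /G; case: (boolP (u \subset v)) => uv.
    by apply: (@synth_inner _ _ rho psi) => //; exact: depends_on_lift.
  apply: aeW => a.
  have vu : v == u = false.
    by apply: contraNF uv => /eqP ->; exact: fintype.subxx_hint.
  rewrite vu; under eq_fun do rewrite mul0r; under eq_Rintegral do rewrite mul0r.
  by split; [exact: integrable0|rewrite /Rintegral integral0_eq].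
have := @filter_forall _ _ _ _ (ae_filter_ringOfSetsType _) aG; apply: filterS => a Ga.
have [i1 E1] := @Rintegral_fsum _ _ R (lebesgue_rV #|~: u|) _
  (fun v b => G u v (Defs.glue a b) * prod_weight rho b) (fun v => (Ga v).1).
under eq_fun do rewrite mulr_suml; under eq_Rintegral do rewrite mulr_suml.
split; first exact: i1.
rewrite E1 (bigD1 u)//= (Ga u).2 eqxx big1 ?addr0 /lift/= ?proj_glue// => v vu.
by rewrite (Ga v).2 (negbTE vu).
Qed.

(** Removes the dummy coordinates: [glue] splits t, and the part outside v integrates to 1.
    Integrability comes from [L2w_pairing], each kappa(., y_i) being in L^2(dt / psi_i). *)
Lemma expandE h y : sq_summable h -> expand h y =
  \sum_(v : {set 'I_d}) \int[lebesgue_rV #|v|]_a (h v a *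
    \prod_(k < #|v|) kappa (rho (enum_val k)) (a ord0 k) (y ord0 (enum_val k))).
Proof.
move=> Lh; apply: eq_bigr => v _; have LH := L2w_lift v Lh.
pose F t := lift h v t * ker rho v finset.set0 t y.
pose B i s := if i \in v then `|kappa (rho i) s (y ord0 i)| else rho i s.
have skB i : sq_finite (psi i) (fun s => kappa (rho i) s (y ord0 i)) by exact: sq_finite_kappa.
have iF : lam.-integrable setT (EFin \o F).
  apply/integrable_EFinP; split.
    apply: measurable_funM; first exact: LH.1.
    by apply: (measurableT_comp (@measurable_ker _ _ rho mrho rho_gt0 rho1 v finset.set0)
      (g := fun t : 'rV[R]_d => (y, t))); exact: pair1_measurable.
  have := @L2w_pairing _ _ rho psi mrho rho_gt0 rho1 psi_gt0 psi_loc psiV_loc v (lift h v) B LH.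
  rewrite /B; move=> h1; apply: le_lt_trans (h1 _ _ _).
  - rewrite le_eqVlt; apply/orP; left; apply/eqP; apply: eq_integral => t _.
    rewrite /F normrM; congr (_ * _)%:E; rewrite /ker normr_prod; apply: eq_bigr => i _.
    by rewrite finset.setD0; case: (i \in v) => //; rewrite ger0_norm.
  - by move=> i s; case: (i \in v).
  - move=> i iv; rewrite iv; split; first by apply: measurableT_comp => //; have [] := skB i.
    by have [_] := skB i; under [in X in _ -> X]eq_integral do rewrite real_normK ?num_real//.
  - by move=> i /negbTE ->.
rewrite /synth [LHS](_ : _ = \int[lam]_t F t); last first.
  apply: eq_Rintegral => t _; rewrite /synth_integrand/F/=; congr (lift h v _ * _).
  by apply/rowP => i; rewrite mxE inE.
have mF : measurable_fun setT F by have [] := (integrable_EFinP _ _).1 iF.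
rewrite -(Rintegral_mpres (glue_mpres v) mF).
have iFg := (integrable_mpres (glue_mpres v) ((measurable_EFinP _ _).2 mF)).2 iF.
rewrite -(@Rintegral12 _ _ _ _ R (lebesgue_rV #|v|) (lebesgue_rV #|~: v|) _ iFg)/=.
apply: eq_Rintegral => a _.
transitivity (\int[lebesgue_rV #|~: v|]_b ((h v a *
    \prod_(k < #|v|) kappa (rho (enum_val k)) (a ord0 k) (y ord0 (enum_val k))) * prod_weight rho b)).
  apply: eq_Rintegral => b _; rewrite /F /lift/= proj_glue -mulrA; congr (_ * _).
  rewrite /ker finset.setD0 (prod_setC v); congr (_ * _); apply: eq_bigr => k _.
    by rewrite enum_valP glue_in.
  by rewrite glue_out; have := enum_valP k; rewrite inE => /negbTE ->.
by rewrite RintegralZl ?Rintegral_prod_weight ?mulr1//; exact: integrable_prod_weight.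
Qed.

Lemma W_injective f : W f ->
  (forall u, {ae lebesgue_rV #|u|, forall a : 'rV[R]_#|u|, inner u f a = 0}) ->
  {ae lam, forall x, f x = 0}.
Proof.
move=> [lf wf _ _] f0.
have [chi tchi chi1] := @unit_mass_tower R.
(* The induction is on the number of directions not differentiated; for the full set there is no j
   outside u and [dF] is vacuous. *)
have wd0 n u : (#|~: u| < n)%N -> {ae lam, forall x, weak_derivative u f x = 0}.
  elim: n u => [|n IH] u un //.
  pose F := weak_derivative u f.
  have [lF FE] : is_weak_derivative u f F := weak_derivativeP (wf u).
  have dF (phi : 'I_d -> nat -> R -> R) j : (forall i, test_tower (phi i)) -> j \notin u ->
      \int[lam]_x (F x * prodf phi (fun i => (i == j) : nat) x) = 0.
    move=> tphi ju.
    have tt k : test_function (prodf phi k) := tame_test_function (tame_prodf k tphi).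
    rewrite (FE _ (tt _)) mixed_partial_prodf//.
    have [lG GE] := weak_derivativeP (wf (j |: u)).
    have G0 : {ae lam, forall x, weak_derivative (j |: u) f x = 0}.
      apply: IH; rewrite -ltnS; apply: leq_trans un; rewrite ltnS.
      rewrite [leqRHS](cardsD1 j) inE ju add1n ltnS subset_leq_card//.
      by apply/fintype.subsetP => i; rewrite !inE negb_or.
    (* Differentiating the product once in each direction of [j |: u] is the same as differentiating
       in the directions u with an extra order in j; the pairing of f with it is 0 by [G0]. *)
    have := GE _ (tt (fun=> 0%N)); rewrite mixed_partial_prodf//.
    rewrite (@Rintegral_ae_eq _ _ _ _ _ (cst 0)); last 3 first.
    - apply: measurable_funM; first exact: lG.1.
      exact: tame_measurable (tame_prodf (fun=> 0%N) tphi).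
    - exact: measurable_cst.
    - by apply: filterS G0 => x /= ->; rewrite mul0r.
    have -> : (fun i : 'I_d => (i \in j |: u) + 0)%N = (fun i => (i \in u) + (i == j))%N.
      apply/funext => i; rewrite !inE addn0; case: eqVneq => [->|] /=; last by rewrite addn0.
      by rewrite (negbTE ju).
    rewrite {1}/Rintegral integral0_eq//= => /esym/eqP; rewrite mulf_eq0 signr_eq0/= => /eqP ->.
    by rewrite mulr0.
  have Fav : {ae lam, forall x, F x = average rho u F chi x} by apply: average_ae.
  apply: (@ae_glue_measurable _ _ u [set x | F x = 0]).
    rewrite (_ : [set x | F x = 0] = F @^-1` [set 0])//.
    by rewrite -[X in measurable X]setTI; apply: lF.1.
  move: (f0 u) (ae_glue_section u Fav); apply: filterS2 => a Ia Fa.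
  (* On almost every fibre F equals the constant c, and averaging c against rho returns the inner
     integral at a. *)
  pose c := average rho u F chi (Defs.glue a 0).
  have cE b : average rho u F chi (Defs.glue a b) = c.
    by rewrite -(average_mix rho u F chi (Defs.glue a b) 0) mix_glue average_mix.
  have c0 : c = 0.
    rewrite -Ia /inner_integral /inner_integrand.
    rewrite (@Rintegral_ae_eq _ _ _ _ _ (fun b => c * prod_weight rho b)).
    - rewrite RintegralZl ?Rintegral_prod_weight ?mulr1//.
      exact: integrable_prod_weight.
    - exact: msec lF.1.
    - by apply: measurable_funM; [exact: measurable_cst|exact: mpwr].
    - by apply: filterS Fa => b /= E; rewrite -(cE b) -E.
  by apply: filterS Fa => b /= ->; rewrite cE.
have := weak_derivative_ae (is_weak_derivative_set0 lf).
have := wd0 _ finset.set0 (ltnSn _); apply: filterS2 => x -> //.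
Qed.

Lemma W_expansion f : W f -> {ae lam, forall x, f x = expand (fun u => inner u f) x}.
Proof.
move=> Wf; have Lf := sq_summable_inner Wf.
have [We Ee] := W_expand Lf.
have [Wd Ed] := W_lin (-1) We Wf.
have : {ae lam, forall x, -1 * expand (fun u => inner u f) x + f x = 0}.
  apply: W_injective; first exact: Wd.
  move=> u; move: (Ee u) (Ed u); apply: filterS2 => a E1 E2.
  by apply: etrans E2 _; rewrite E1 mulN1r addNr.
by apply: filterS => x; rewrite mulN1r addrC => /subr0_eq.
Qed.

Lemma integrable_sq_summable_mul h h' u : sq_summable h -> sq_summable h' ->
  (lebesgue_rV #|u|).-integrable setT (fun a => (h u a * h' u a * prod_weight psi a)%:E).
Proof.
move=> /sq_summableP/(_ u)[mh ih] /sq_summableP/(_ u)[mh' ih'].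
have := integrableD measurableT ih ih'; apply: le_integrable => //.
  apply/measurable_EFinP; apply: measurable_funM; last exact: mpwt.
  exact: measurable_funM.
move=> a _; rewrite /= lee_fin -mulrDl !normrM ler_wpM2r//.
rewrite -(real_normK (num_real (h u a))) -(real_normK (num_real (h' u a))).
rewrite [leRHS]ger0_norm ?addr_ge0 ?sqr_ge0//.
by have := sqr_ge0 (`|h u a| - `|h' u a|); nra.
Qed.

(* The inner integrals of the kernel in its first variable. *)
Definition kernel_coef (y : 'rV[R]_d) : family := fun u a => gamma u *
  \prod_(k < #|u|) (kappa (rho (enum_val k)) (a ord0 k) (y ord0 (enum_val k)) /
    psi (enum_val k) (a ord0 k)).

Let ikk j x y : leb.-integrable setT
  (fun t => (kappa (rho j) t x * kappa (rho j) t y / psi j t)%:E).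
Proof. exact: integrable_kappa_kappa. Qed.

Lemma sq_summable_kernel_coef y : sq_summable (kernel_coef y).
Proof.
apply/sq_summableP => u; split.
  apply: measurable_funM; first exact: measurable_cst.
  apply: (@measurable_prod_coord _ _ (fun k s => kappa (rho (enum_val k)) s (y ord0 (enum_val k)) / psi (enum_val k) s)) => k.
  apply: measurable_funM; last by have [] := psiV_loc (enum_val k).
  exact: measurable_kappa1.
have := @integrable_prod _ _ (fun (k : 'I_#|u|) s => kappa (rho (enum_val k)) s (y ord0 (enum_val k)) *
  kappa (rho (enum_val k)) s (y ord0 (enum_val k)) / psi (enum_val k) s) (fun k => ikk _ _ _).
move=> /(integrableZl measurableT (gamma u ^+ 2)); apply: eq_integrable => // a _.
rewrite -EFinM /kernel_coef exprMn -prodrXl -[in RHS]mulrA; congr (_ * _)%:E.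
rewrite /prod_weight -big_split/=; apply: eq_bigr => k _.
by field; rewrite gt_eqF.
Qed.

Lemma expand_kernel_coef y : expand (kernel_coef y) = (W_kernel rho psi gamma)^~ y.
Proof.
apply/funext => x; rewrite expandE; last exact: sq_summable_kernel_coef.
apply: eq_bigr => u _; rewrite big_enum_val.
transitivity (\int[lebesgue_rV #|u|]_a (gamma u *
  \prod_(k < #|u|) (kappa (rho (enum_val k)) (a ord0 k) (x ord0 (enum_val k)) *
    kappa (rho (enum_val k)) (a ord0 k) (y ord0 (enum_val k)) / psi (enum_val k) (a ord0 k)))).
  apply: eq_Rintegral => a _; rewrite /kernel_coef -mulrA -big_split/=; congr (_ * _).
  by apply: eq_bigr => k _; rewrite mulrC mulrA.
have ip (k : 'I_#|u|) := ikk (enum_val k) (x ord0 (enum_val k)) (y ord0 (enum_val k)).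
rewrite RintegralZl//; last exact: (integrable_prod ip).
rewrite (Rintegral_prod ip); congr (_ * _); apply: eq_bigr => k _.
by rewrite (@eta_kernelE _ (rho (enum_val k)) (psi (enum_val k))).
Qed.

Lemma W_kernel_in y : W ((W_kernel rho psi gamma)^~ y).
Proof.
by rewrite -expand_kernel_coef; apply: (W_expand (sq_summable_kernel_coef y)).1.
Qed.

(** The factors gamma_u and 1 / psi_u in [kernel_coef] cancel the weights of the inner product,
    leaving the bare kappa factors of [expandE]. *)
Lemma W_inner_kernel f y : W f ->
  W_inner rho psi gamma f ((W_kernel rho psi gamma)^~ y) = expand (fun u => inner u f) y.
Proof.
move=> Wf; have Lf := sq_summable_inner Wf; have Lk := sq_summable_kernel_coef y.
rewrite -expand_kernel_coef expandE//; have [Wk Ek] := W_expand Lk.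
apply: eq_bigr => u _.
have ifk := integrable_sq_summable_mul u Lf Lk.
rewrite (@Rintegral_ae_eq _ _ _ _ _ (fun a => inner u f a * kernel_coef y a * prod_weight psi a)).
- rewrite -RintegralZl//; apply: eq_Rintegral => a _.
  rewrite /kernel_coef mulrC -!mulrA; congr (_ * _).
  rewrite mulrC -!mulrA mulrCA mulVf ?mulr1 ?gt_eqF// /prod_weight.
  by rewrite -big_split/=; apply: eq_bigr => k _; field; rewrite gt_eqF.
- apply: measurable_funM; last exact: mpwt.
  apply: measurable_funM; first exact: (Lf u).1.
  exact: (sq_summable_inner Wk u).1.
- by have [] := (integrable_EFinP _ _).1 ifk.
- by apply: filterS (Ek u) => a ->.
Qed.

End expansion.

(** * Completeness *)

Section weighted_L2_complete.
Context d (X : measurableType d) (R : realType) (m : {measure set X -> \bar R}).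
Variables (w : X -> R) (g : nat -> X -> R).
Hypotheses (mw : measurable_fun setT w) (w_gt0 : forall x, 0 < w x)
  (mg : forall n, measurable_fun setT (g n)).

Let msq (p q : X -> R) : measurable_fun setT p -> measurable_fun setT q ->
  measurable_fun setT (fun x => ((p x - q x) ^+ 2 * w x)%:E).
Proof.
move=> mp mq; apply/measurable_EFinP; apply: measurable_funM; last exact: mw.
by apply: measurable_funX; exact: measurable_funB.
Qed.

Let cvg_geometric_step (u : nat -> R) (D : R) : 0 <= D ->
  (forall k, `|u k.+1 - u k| <= D * 2^-1 ^+ k) -> cvgn u.
Proof.
move=> D0 uD; have -> : u = (fun n => u 0%N + series (telescope u) n).
  by apply/funext => n; exact: eq_sum_telescope.
apply: is_cvgD; first exact: is_cvg_cst.
apply: normed_cvg; apply: (@series_le_cvg _ _ (geometric D 2^-1)) => //=.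
- by move=> n; rewrite mulr_ge0// exprn_ge0// invr_ge0.
- by apply: is_cvg_geometric_series; rewrite ger0_norm ?invr_ge0// invf_lt1// ltr1n.
Qed.

(** The weight 4^k keeps the integrals of the increments summable, by 2^-(k+1), so the weighted
    series is finite almost everywhere. There the k-th increment is O(2^-k), and a geometric
    comparison gives convergence. *)
Let ae_cvg_fast (n : nat -> nat) :
  (forall k, (\int[m]_x ((g (n k.+1) x - g (n k) x) ^+ 2 * w x)%:E <=
    (((4%:R ^+ k) * (2 ^ k.+1)%:R)^-1)%:E)%E) ->
  {ae m, forall x, cvgn (fun k => g (n k) x)}.
Proof.
move=> fast.
pose a k x := (4%:R ^+ k * ((g (n k.+1) x - g (n k) x) ^+ 2 * w x))%:E.
have a0 k x : (0 <= a k x)%E.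
  by rewrite lee_fin mulr_ge0 ?exprn_ge0// mulr_ge0 ?sqr_ge0// ltW.
have ma k : measurable_fun setT (a k).
  apply/measurable_EFinP; apply: measurable_funM; first exact: measurable_cst.
  by apply/measurable_EFinP; exact: msq.
have mS : measurable_fun setT (fun x => \sum_(0 <= k <oo) a k x)%E.
  by apply: ge0_emeasurable_sum.
have S0 x : (0 <= \sum_(0 <= k <oo) a k x)%E by apply: nneseries_ge0.
have iS : m.-integrable setT (fun x => \sum_(0 <= k <oo) a k x)%E.
  apply/integrableP; split => //.
  under eq_integral do rewrite gee0_abs//.
  rewrite integral_nneseries//.
  apply: (@le_lt_trans _ _ (\sum_(0 <= k <oo) (1 / (2 ^ k.+1)%:R)%:E)%E); last first.
    by apply: le_lt_trans (epsilon_trick0 xpredT (ler01 : 0 <= 1 :> R)) _; rewrite ltry.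
  apply: lee_nneseries => [k _ _|k _]; first by apply: integral_ge0.
  rewrite /a; under eq_integral do rewrite EFinM.
  rewrite ge0_integralZl//; last 2 first.
  - exact: msq.
  - by move=> x _; rewrite lee_fin mulr_ge0 ?sqr_ge0// ltW.
  apply: le_trans (lee_wpmul2l _ (fast k)) _; first by rewrite lee_fin exprn_ge0.
  rewrite -EFinM lee_fin invfM mulrA mulfV ?mul1r// expf_neq0//.
have := integrable_ae measurableT iS; apply: filterS => x /(_ I) Sfin.
set C := fine (\sum_(0 <= k <oo) a k x)%E.
have C0 : 0 <= C by apply: fine_ge0.
have aC k : 4%:R ^+ k * ((g (n k.+1) x - g (n k) x) ^+ 2 * w x) <= C.
  rewrite -lee_fin /C fineK//.
  have : (\sum_(0 <= l < k.+1) a l x <= \sum_(0 <= l <oo) a l x)%E.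
    by apply: nneseries_lim_ge => l _ _; exact: a0.
  by apply: le_trans; rewrite big_nat_recr//= leeDr// sume_ge0.
(* Since D >= 1, one has C / w <= D <= D^2, which bounds the increments without taking a square
   root. *)
pose D := 1 + C / w x.
have D1 : 1 <= D by rewrite /D lerDl divr_ge0// ltW.
apply: (@cvg_geometric_step _ D); first exact: le_trans D1.
move=> k; set r := g (n k.+1) x - g (n k) x.
rewrite -(@ler_pXn2r _ 2) ?nnegrE//; last first.
  by rewrite mulr_ge0 ?exprn_ge0 ?invr_ge0//; exact: le_trans D1.
rewrite real_normK ?num_real// exprMn.
have wx := w_gt0 x; have := aC k; rewrite -/r => h.
have p4 : 0 < 4%:R ^+ k :> R by rewrite exprn_gt0.
have -> : (2^-1 ^+ k) ^+ 2 = (4%:R ^+ k)^-1 :> R.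
  by rewrite -exprM mulnC exprM -exprVn; congr (_ ^+ _); field.
have : r ^+ 2 <= C / w x / 4%:R ^+ k.
  rewrite ler_pdivlMr// ler_pdivlMr//; apply: le_trans h.
  by rewrite le_eqVlt; apply/orP; left; apply/eqP; ring.
move/le_trans; apply; apply: ler_wpM2r; first by rewrite invr_ge0 ltW.
apply: (@le_trans _ _ D); first by rewrite /D lerDr.
by rewrite expr2 ler_peMl// (le_trans _ D1).
Qed.

(** The Riesz-Fischer argument: a fast subsequence converges almost everywhere, and Fatou's lemma
    carries the Cauchy estimate to its limit. *)
Lemma weighted_L2_complete :
  (forall e : R, 0 < e -> exists N, forall i j, (N <= i)%N -> (N <= j)%N ->
    (\int[m]_x ((g i x - g j x) ^+ 2 * w x)%:E < e%:E)%E) ->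
  exists2 h : X -> R, measurable_fun setT h & forall e : R, 0 < e ->
    exists N, forall i, (N <= i)%N ->
    (\int[m]_x ((g i x - h x) ^+ 2 * w x)%:E <= e%:E)%E.
Proof.
move=> cauchy.
have eps k : 0 < ((4%:R ^+ k) * (2 ^ k.+1)%:R)^-1 :> R.
  by rewrite invr_gt0 mulr_gt0 ?exprn_gt0// ltr0n expn_gt0.
have [N NP] := choice (fun k => cauchy _ (eps k)).
(* The sum makes n k at least N l for every l <= k, and the summand k makes it unbounded. *)
pose n k := (k + \sum_(l < k.+1) N l)%N.
have nN k : (N k <= n k)%N by rewrite /n big_ord_recr/= addnA leq_addl.
have nS k : (N k <= n k.+1)%N.
  by apply: leq_trans (nN k) _; apply: leq_add => //; rewrite [leqRHS]big_ord_recr leq_addr.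
have cvg := ae_cvg_fast (fun k => ltW (NP k _ _ (nS k) (nN k))).
(* The upper limit is measurable and defined everywhere; it is the limit wherever that exists. *)
pose h x := fine (limn_esup (fun k => (g (n k) x)%:E)).
have mh : measurable_fun setT h.
  apply: measurableT_comp => //; apply: measurable_fun_limn_esup => k.
  exact/measurable_EFinP.
exists h => // e e0; have [M MP] := cauchy _ e0; exists M => i Mi.
pose F k x := ((g i x - g (n k) x) ^+ 2 * w x)%:E.
(* Almost everywhere the integrand is the limit of [F k x], hence its lower limit, the form required
   by Fatou's lemma. *)
rewrite (ae_eq_integral (fun x => limn_einf (F ^~ x)))//; last 3 first.
- exact: msq.
- rewrite (_ : (fun x => _) = (fun x => - limn_esup (fun k => - F k x))%E).
    apply: measurableT_comp => //; apply: measurable_fun_limn_esup => k.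
    by apply: measurableT_comp => //; exact: msq.
  by apply/funext => x; rewrite -limn_einfN; congr limn_einf; apply/funext => k; exact/esym/oppeK.
- apply: filterS cvg => x cx _; apply/esym.
  apply: (cvg_limn_einf_sup _).1; apply: cvg_EFin; first exact: nearW.
  apply: cvgM; last exact: cvg_cst.
  have -> : h x = limn (fun k => g (n k) x).
    rewrite /h (cvg_limn_einf_sup (l := (limn (fun k => g (n k) x))%:E) _).2//.
    by apply: cvg_EFin; first exact: nearW.
  under eq_fun do rewrite expr2; rewrite expr2.
  by apply: cvgM; apply: cvgB => //; exact: cvg_cst.
apply: le_trans (fatou _ _ _ _) _ => //.
- by move=> k; exact: msq.
- by move=> k x _; rewrite lee_fin mulr_ge0 ?sqr_ge0// ltW.
rewrite limn_einf_lim; apply: lime_le; first exact: is_cvg_einfs.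
exists M => // k /= Mk; apply: le_trans (ereal_inf_lbound _) (ltW (MP i (n k) Mi _)).
- by exists k => //=.
- by apply: leq_trans Mk _; rewrite /n leq_addr.
Qed.

End weighted_L2_complete.

(** * The Hilbert space structure *)

Section hilbert.
Context {R : realType} {d : nat}.
Local Notation lam := (@lebesgue_rV R d).
Local Notation leb := (@lebesgue_measure R).
Variables (rho psi : 'I_d -> R -> R) (gamma : {set 'I_d} -> R).
Hypotheses (mrho : forall j, measurable_fun setT (rho j))
  (rho_gt0 : forall j x, 0 < rho j x)
  (rho1 : forall j, (\int[leb]_x (rho j x)%:E = 1)%E)
  (psi_gt0 : forall j x, 0 < psi j x)
  (psi_loc : forall j, locally_integrable setT (psi j))
  (psiV_loc : forall j, locally_integrable setT (fun x => (psi j x)^-1))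
  (gamma_gt0 : forall u, 0 < gamma u)
  (left_tail : forall j (c : R),
    (\int[leb]_(t in `]-oo, c]) (distr_fun (rho j) t ^+ 2 / psi j t)%:E < +oo)%E)
  (right_tail : forall j (c : R),
    (\int[leb]_(t in `[c, +oo[) ((1 - distr_fun (rho j) t) ^+ 2 / psi j t)%:E < +oo)%E).
Local Notation W := (W_space rho psi gamma).
Local Notation inner u f := (@inner_integral R d rho u f).
Local Notation family := (forall u : {set 'I_d}, 'rV[R]_#|u| -> R).
Implicit Types (f : 'rV[R]_d -> R) (h : family) (u v : {set 'I_d}).

Let mpsi j : measurable_fun setT (psi j). Proof. by have [] := psi_loc j. Qed.
Local Notation ip := (W_inner rho psi gamma).
Let pwt_gt0 u (a : 'rV[R]_#|u|) : 0 < prod_weight psi a.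
Proof. by apply: prodr_gt0. Qed.
Let pwt_ge0 u (a : 'rV[R]_#|u|) : 0 <= prod_weight psi a. Proof. exact: ltW. Qed.
Let mpwt u : measurable_fun setT (@prod_weight R d psi u).
Proof. exact: measurable_prod_weight. Qed.
Let gammaV_ge0 u : 0 <= (gamma u)^-1. Proof. by rewrite invr_ge0 ltW. Qed.
Let sq f (Wf : W f) : sq_summable psi (fun u => inner u f).
Proof. exact: sq_summable_inner Wf. Qed.
Let sq_lin (c : R) h h' : sq_summable psi h -> sq_summable psi h' ->
  sq_summable psi (fun u a => c * h u a + h' u a).
Proof. exact: sq_summable_lin. Qed.
Let int_mul h h' u : sq_summable psi h -> sq_summable psi h' ->
  (lebesgue_rV #|u|).-integrable setT (fun a => (h u a * h' u a * prod_weight psi a)%:E).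
Proof. exact: integrable_sq_summable_mul. Qed.
Let m_mul h h' u : sq_summable psi h -> sq_summable psi h' ->
  measurable_fun setT (fun a => h u a * h' u a * prod_weight psi a).
Proof. by move=> Lh Lh'; have /integrable_EFinP[] := int_mul u Lh Lh'. Qed.
Let Wlin (c : R) f f' (Wf : W f) (Wf' : W f') :
  W (fun x => c * f x + f' x) /\
  forall u, {ae lebesgue_rV #|u|, forall a : 'rV[R]_#|u|,
    inner u (fun x => c * f x + f' x) a = c * inner u f a + inner u f' a}.
Proof. exact: W_lin. Qed.

Lemma W_inner_coef f f' h h' : W f -> W f' -> sq_summable psi h -> sq_summable psi h' ->
  (forall u, {ae lebesgue_rV #|u|, forall a : 'rV[R]_#|u|, inner u f a = h u a}) ->
  (forall u, {ae lebesgue_rV #|u|, forall a : 'rV[R]_#|u|, inner u f' a = h' u a}) ->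
  ip f f' = \sum_(u : {set 'I_d}) (gamma u)^-1 *
    \int[lebesgue_rV #|u|]_a (h u a * h' u a * prod_weight psi a).
Proof.
move=> Wf Wf' Lh Lh' fh fh'; apply: eq_bigr => u _; apply: (congr2 *%R (erefl _)).
apply: Rintegral_ae_eq.
- by have /integrable_EFinP[] := int_mul u (sq Wf) (sq Wf').
- exact: m_mul.
- by move: (fh u) (fh' u); apply: filterS2 => a -> ->.
Qed.

Lemma W_ae_eq f g : W f -> measurable_fun setT g -> {ae lam, forall x, f x = g x} -> W g.
Proof.
move=> Wf mg fg; have [lf wf af _] := Wf.
suff [] : W g /\ forall u, {ae lebesgue_rV #|u|, forall a : 'rV[R]_#|u|, inner u g a = inner u f a} by [].
apply: (@W_spaceP _ _ rho psi gamma mrho psi_loc gamma_gt0 g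
  (fun u => weak_derivative u f) (fun u => inner u f)); last exact: sq Wf.
- exact: locally_integrable_ae lf mg fg.
- move=> u; rewrite -(is_weak_derivative_ae_eq u lf.1 mg fg); exact: weak_derivativeP.
- by move=> u; apply: filterS (af u) => a ia; split.
Qed.

Let coef_ip h h' := \sum_(u : {set 'I_d}) (gamma u)^-1 *
  \int[lebesgue_rV #|u|]_a (h u a * h' u a * prod_weight psi a).

Let coef_ip_sym h h' : coef_ip h h' = coef_ip h' h.
Proof.
apply: eq_bigr => u _; apply: (congr2 *%R (erefl _)); apply: eq_Rintegral => a _.
by rewrite (mulrC (h u a)).
Qed.

Let coef_ip_lin (c : R) h h' k : sq_summable psi h -> sq_summable psi h' -> sq_summable psi k ->
  coef_ip (fun u a => c * h u a + h' u a) k = c * coef_ip h k + coef_ip h' k.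
Proof.
move=> Lh Lh' Lk; rewrite mulr_sumr -big_split/=; apply: eq_bigr => u _.
have i1 := int_mul u Lh Lk; have i2 := int_mul u Lh' Lk.
under eq_Rintegral do rewrite !mulrDl -!(mulrA c).
rewrite RintegralD//; last exact: (integrableZl _ c i1).
by rewrite RintegralZl// mulrDr mulrCA.
Qed.

Lemma W_inner_sym f g : ip f g = ip g f.
Proof. exact: (coef_ip_sym (fun u => inner u f) (fun u => inner u g)). Qed.

Lemma W_inner_lin (c : R) f g k : W f -> W g -> W k ->
  ip (fun x => c * f x + g x) k = c * ip f k + ip g k.
Proof.
move=> Wf Wg Wk; have [Wl El] := Wlin c Wf Wg.
apply: etrans (coef_ip_lin c (sq Wf) (sq Wg) (sq Wk)).
apply: (W_inner_coef Wl Wk (sq_lin c (sq Wf) (sq Wg)) (sq Wk) El).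
by move=> u; apply: aeW.
Qed.

Lemma W_inner_ge0 f : 0 <= ip f f.
Proof.
apply: sumr_ge0 => u _; apply: mulr_ge0 => //; apply: Rintegral_ge0 => a _.
by rewrite mulr_ge0// -expr2 sqr_ge0.
Qed.

Lemma W_inner_definite f : W f -> ip f f = 0 -> {ae lam, forall x, f x = 0}.
Proof.
move=> Wf /eqP; rewrite psumr_eq0; last first.
  move=> u _; apply: mulr_ge0 => //; apply: Rintegral_ge0 => a _.
  by rewrite mulr_ge0// -expr2 sqr_ge0.
move=> /allP f0; apply: (@W_injective _ _ rho psi gamma) => // u.
have /eqP := f0 u (mem_index_enum u); rewrite /= => /eqP.
rewrite mulf_eq0 gt_eqF ?invr_gt0//= => /eqP I0.
have iu := int_mul u (sq Wf) (sq Wf).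
have : (\int[lebesgue_rV #|u|]_a `|(inner u f a * inner u f a * prod_weight psi a)%:E| = 0)%E.
  under eq_integral => a _.
    rewrite gee0_abs; last by rewrite lee_fin mulr_ge0// -expr2 sqr_ge0.
    over.
  by rewrite -EFin_Rintegral ?I0.
move/ae_eq_integral_abs => /(_ measurableT); have /integrableP[miu _] := iu.
move=> /(_ miu); apply: filterS => a /(_ I) [] /eqP.
by rewrite mulf_eq0 (gt_eqF (pwt_gt0 a)) orbF mulf_eq0 orbb => /eqP.
Qed.

Lemma W_sub f f' h h' : W f -> W f' -> sq_summable psi h -> sq_summable psi h' ->
  (forall u, {ae lebesgue_rV #|u|, forall a : 'rV[R]_#|u|, inner u f a = h u a}) ->
  (forall u, {ae lebesgue_rV #|u|, forall a : 'rV[R]_#|u|, inner u f' a = h' u a}) ->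
  ip (fun x => f x - f' x) (fun x => f x - f' x) = \sum_(u : {set 'I_d}) (gamma u)^-1 *
    \int[lebesgue_rV #|u|]_a ((h u a - h' u a) ^+ 2 * prod_weight psi a).
Proof.
move=> Wf Wf' Lh Lh' fh fh'.
have -> : (fun x => f x - f' x) = (fun x => -1 * f' x + f x).
  by apply/funext => x; rewrite mulN1r addrC.
have [Wl El] := Wlin (-1) Wf' Wf.
have E u : {ae lebesgue_rV #|u|, forall a : 'rV[R]_#|u|,
    inner u (fun x => -1 * f' x + f x) a = -1 * h' u a + h u a}.
  by move: (El u) (fh u) (fh' u); apply: filterS3 => a E1 E2 E3; rewrite E1 E2 E3.
have LD := sq_lin (-1) Lh' Lh.
rewrite (W_inner_coef Wl Wl LD LD E E); apply: eq_bigr => u _; apply: (congr2 *%R (erefl _)).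
by apply: eq_Rintegral => a _; rewrite mulN1r addrC expr2.
Qed.

(** A Cauchy sequence has Cauchy inner integrals in each weighted L^2 space; the limits form a
    family h, and [expand] turns it into the limit in the space. *)
Lemma W_complete (F : nat -> 'rV[R]_d -> R) : (forall n, W (F n)) ->
  (forall e : R, 0 < e ->
    \forall m & n \near \oo, ip_norm ip (fun x => F m x - F n x) < e) ->
  exists2 f, W f & ip_norm ip (fun x => F n x - f x) @[n --> \oo] --> (0 : R).
Proof.
move=> WF cauchy; have LF n := sq (WF n).
have FF n u : {ae lebesgue_rV #|u|, forall a : 'rV[R]_#|u|, inner u (F n) a = inner u (F n) a}.
  exact: aeW.
have isq h u : sq_summable psi h ->
    (lebesgue_rV #|u|).-integrable setT (fun a => (h u a ^+ 2 * prod_weight psi a)%:E).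
  by move=> /(sq_summableP psi_gt0 psi_loc)/(_ u)[].
have Lsub h h' : sq_summable psi h -> sq_summable psi h' ->
    sq_summable psi (fun u a => h u a - h' u a).
  move=> Lh Lh' u; have := sq_lin (-1) Lh' Lh u.
  by under eq_fun do rewrite mulN1r addrC; under eq_integral do rewrite mulN1r addrC.
have L2 u := @weighted_L2_complete _ _ R (lebesgue_rV #|u|) (@prod_weight R d psi u)
  (fun n => inner u (F n)) (@mpwt u) (@pwt_gt0 u) (fun n => (LF n u).1).
have {}L2 u : exists2 h : 'rV[R]_#|u| -> R, measurable_fun setT h & forall e : R, 0 < e ->
    exists N, forall i, (N <= i)%N ->
    (\int[lebesgue_rV #|u|]_a ((inner u (F i) a - h a) ^+ 2 * prod_weight psi a)%:E <= e%:E)%E.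
  apply: L2 => e e0.
  (* The u-th term of the squared norm carries the factor 1 / gamma_u, so this threshold bounds the
     u-th integral by e. *)
  have e'0 : 0 < Num.sqrt (e / gamma u) by rewrite sqrtr_gt0 divr_gt0.
  have [[A B] /= [[N1 _ N1A] [N2 _ N2B]] AB] := cauchy _ e'0.
  exists (maxn N1 N2) => i j; rewrite !geq_max => /andP[i1 i2] /andP[j1 j2].
  have := AB (i, j) (conj (N1A i i1) (N2B j j2)); rewrite /= /ip_norm.
  rewrite ltr_sqrt ?divr_gt0// (W_sub (WF i) (WF j) (LF i) (LF j) (FF i) (FF j)).
  have iD := isq _ u (Lsub _ _ (LF i) (LF j)).
  rewrite -EFin_Rintegral// lte_fin => /(le_lt_trans _) h.
  have : (gamma u)^-1 * \int[lebesgue_rV #|u|]_a ((inner u (F i) a - inner u (F j) a) ^+ 2 * prod_weight psi a) < e / gamma u.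
    apply: h; rewrite (bigD1 u)//= lerDl; apply: sumr_ge0 => v _.
    by apply: mulr_ge0 => //; apply: Rintegral_ge0 => a _; rewrite mulr_ge0// sqr_ge0.
  by rewrite mulrC ltr_pM2r// invr_gt0.
(* The type of h u depends on u, so the limits are picked one by one from the existence
   statement. *)
pose h u := s2val (cid2 (L2 u)).
have mh u : measurable_fun setT (h u) := s2valP (cid2 (L2 u)).
have hP u := s2valP' (cid2 (L2 u)).
have Lh : sq_summable psi h.
  have [N NP] := choice (fun u => hP u 1 ltr01).
  (* A rank beyond every N u: h is recovered as F_M - (F_M - h), a difference of two square-summable
     families. *)
  pose M := (\sum_u N u)%N.
  have LD : sq_summable psi (fun u a => inner u (F M) a - h u a).
    move=> u; split; first exact: (measurable_funB (LF M u).1 (mh u)).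
    apply: le_lt_trans (NP u M _) _; last exact: ltry.
    by rewrite /M (bigD1 u)//= leq_addr.
  move=> u; have := Lsub _ _ (LF M) LD u.
  by under eq_fun do rewrite subKr; under eq_integral do rewrite subKr.
have [Wf Ef] := W_expand mrho rho_gt0 rho1 psi_gt0 psi_loc psiV_loc gamma_gt0 left_tail right_tail Lh.
exists (expand rho h) => //.
apply/cvgr0Pnorm_lt => e e0.
(* The added 1 makes S positive and the final bound e^2 (S - 1) / S strictly less than e^2. *)
pose S := 1 + \sum_(u : {set 'I_d}) (gamma u)^-1.
have S0 : 0 < S by rewrite /S ltr_pwDl// sumr_ge0.
have e'0 : 0 < e ^+ 2 / S by rewrite divr_gt0// exprn_gt0.
have [N NP] := choice (fun u => hP u _ e'0).
exists (\sum_u N u)%N => // n /= Nn.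
rewrite ger0_norm ?sqrtr_ge0// /ip_norm -[ltRHS]ger0_norm ?(ltW e0)// -sqrtr_sqr.
rewrite ltr_sqrt ?exprn_gt0//.
rewrite (W_sub (WF n) Wf (LF n) Lh (FF n) Ef).
apply: (@le_lt_trans _ _ (\sum_(u : {set 'I_d}) (gamma u)^-1 * (e ^+ 2 / S))).
  apply: ler_sum => u _; apply: ler_wpM2l => //; rewrite -lee_fin.
  rewrite EFin_Rintegral; last exact: (isq _ u (Lsub _ _ (LF n) Lh)).
  by apply: NP; apply: leq_trans Nn; rewrite (bigD1 u)//= leq_addr.
rewrite -mulr_suml mulrA ltr_pdivrMr// mulrC ltr_pM2l ?exprn_gt0//.
by rewrite /S ltrDr.
Qed.

Lemma W_hilbert : ae_hilbert lam W ip.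
Proof.
have aeP (f g : 'rV[R]_d -> R) : f = g %[ae lam] -> {ae lam, forall x, f x = g x}.
  by apply: filterS => x; apply.
split.
- by move=> f [[]].
- by move=> f g Wf mg /aeP; exact: W_ae_eq.
(* The zero function is obtained from a known element, as the difference of a kernel section with
   itself. *)
- have Wk : W ((W_kernel rho psi gamma)^~ 0) by exact: W_kernel_in.
  have := (Wlin (-1) Wk Wk).1; congr W_space.
  by apply/funext => x; rewrite mulN1r addNr.
- by move=> c f g Wf Wg; exact: (Wlin c Wf Wg).1.
(* Functions equal almost everywhere have the same selected weak derivatives, so the two integrands
   coincide pointwise. *)
- move=> f f' g [lf _ _ _] [lf' _ _ _] _ /aeP ff'; apply: eq_bigr => u _.
  apply: (congr2 *%R (erefl _)); apply: eq_Rintegral => a _; apply: (congr2 *%R _ (erefl _)); apply: (congr2 *%R _ (erefl _)).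
  by rewrite /inner_integral /inner_integrand (weak_derivative_ae_eq u lf.1 lf'.1 ff').
- by move=> f g _ _; exact: W_inner_sym.
- exact: W_inner_lin.
- by move=> f _; exact: W_inner_ge0.
- by move=> f Wf /(W_inner_definite Wf); apply: filterS => x ->.
- exact: W_complete.
Qed.

End hilbert.
Theorem theorem11 (R : realType) (d : nat)
    (rho psi : 'I_d -> R -> R) (gamma : {set 'I_d} -> R)
    (d_ge1 : (1 <= d)%N)
    (rho_measurable : forall j, measurable_fun setT (rho j))
    (rho_gt0 : forall j x, 0 < rho j x)
    (rho_pdf : forall j, (\int[lebesgue_measure]_x (rho j x)%:E = 1)%E)
    (psi_gt0 : forall j x, 0 < psi j x)
    (psi_locint : forall j, locally_integrable setT (psi j))
    (psiV_locint : forall j, locally_integrable setT (fun x => (psi j x)^-1))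
    (gamma_gt0 : forall u, 0 < gamma u)
    (left_tail : forall j (c : R),
      (\int[lebesgue_measure]_(t in `]-oo, c])
        (distr_fun (rho j) t ^+ 2 / psi j t)%:E < +oo)%E)
    (right_tail : forall j (c : R),
      (\int[lebesgue_measure]_(t in `[c, +oo[)
        ((1 - distr_fun (rho j) t) ^+ 2 / psi j t)%:E < +oo)%E) :
  ae_rkhs (lebesgue_rV d) (W_space rho psi gamma) (W_inner rho psi gamma)
    (W_kernel rho psi gamma).
Proof.
have K_in y : W_space rho psi gamma ((W_kernel rho psi gamma)^~ y) by exact: W_kernel_in.
split; first exact: W_hilbert.
  exact: K_in.
move=> f Wf.
have repr y : W_inner rho psi gamma f ((W_kernel rho psi gamma)^~ y) =
    expand rho (fun u => inner_integral rho (u := u) f) y by exact: W_inner_kernel.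
have Lf := sq_summable_inner rho_measurable psi_gt0 gamma_gt0 Wf.
split.
  rewrite (_ : (fun y => _) = expand rho (fun u => inner_integral rho (u := u) f)).
    by apply: (W_expand _ _ _ _ _ _ _ _ _ Lf).1.
  exact/funext.
have : {ae lebesgue_rV d, forall x, f x = expand rho (fun u => inner_integral rho (u := u) f) x}.
  by apply: (@W_expansion _ _ rho psi gamma).
by apply: filterS => x fx _; rewrite repr.
Qed.
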